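(* Let $q\in(0,1)$ and $G\in\{B,C,D\}$. The Martin boundary of the BC type $q$-Gelfand–Tsetlin graph (of type $G$) is in bijection with the set $\mathfrak Y$, under the map $\mathbf y\mapsto\{M^{\mathbf y}_N\}_{N\ge1}$.
   Context: $\epsilon=\frac12,1,0$ for $G=B,C,D$. $\mathbb{GT}^+_N$ is the set of $\lambda=(\lambda_1\ge\cdots\ge\lambda_N\ge0)\in\mathbb Z^N$. With $V^s(z_1,\ldots,z_N)=\prod_{i<j}(z_i+z_i^{-1}-z_j-z_j^{-1})$, $\chi^G_\lambda(z_1,\ldots,z_N)$ is the Laurent polynomial equal to $1/V^s(z_1,\ldots,z_N)$ times $\det\big[\frac{z_j^{\lambda_i+N-i+1/2}-z_j^{-(\lambda_i+N-i+1/2)}}{z_j^{1/2}-z_j^{-1/2}}\big]$ for $G=B$, $\det\big[\frac{z_j^{\lambda_i+N-i+1}-z_j^{-(\lambda_i+N-i+1)}}{z_j-z_j^{-1}}\big]$ for $G=C$, $\det\big[z_j^{\lambda_i+N-i}+z_j^{-(\lambda_i+N-i)}\big]$ for $G=D$ (all $1\le i,j\le N$). BC type $q$-Gelfand–Tsetlin graph: the sequence $\{\mathbb{GT}^+_N,\Lambda^{N+1}_N\}_{N\ge1}$, where for $\lambda\in\mathbb{GT}^+_{N+1}$ the numbers $\Lambda^{N+1}_N(\lambda,\mu)$, $\mu\in\mathbb{GT}^+_N$, are the unique coefficients in $$\frac{\chi^G_\lambda(x_1,\ldots,x_N,q^{N+\epsilon})}{\chi^G_\lambda(q^\epsilon,q^{1+\epsilon},\ldots,q^{N+\epsilon})}=\sum_{\mu\in\mathbb{GT}^+_N}\Lambda^{N+1}_N(\lambda,\mu)\frac{\chi^G_\mu(x_1,\ldots,x_N)}{\chi^G_\mu(q^\epsilon,q^{1+\epsilon},\ldots,q^{N-1+\epsilon})}.$$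 These matrices are stochastic. For $N>k$, $\Lambda^N_k=\Lambda^N_{N-1}\cdots\Lambda^{k+1}_k$. A coherent system is a sequence of probability measures $M_N$ on $\mathbb{GT}^+_N$, $N\ge1$, with $M_{N+1}\Lambda^{N+1}_N=M_N$ for all $N$. The Martin boundary is the set of coherent systems $\{M_k\}_{k\ge1}$ for which there exists a sequence $\{\lambda(N)\in\mathbb{GT}^+_N\}_{N\ge1}$ with $M_k(\mu)=\lim_{N\to\infty}\Lambda^N_k(\lambda(N),\mu)$ for all $k\ge1$, $\mu\in\mathbb{GT}^+_k$. $\mathfrak Y$ is the set of integer sequences $\mathbf y=(0\le y_1\le y_2\le\cdots)$; $\{\lambda(N)\in\mathbb{GT}^+_N\}$ stabilizes to $\mathbf y$ if $\lim_{N\to\infty}\lambda(N)_{N+1-i}=y_i$ for all $i\ge1$. $M^{\mathbf y}_k(\mu)=\lim_{N\to\infty}\Lambda^N_k(\lambda(N),\mu)$ for any $\{\lambda(N)\}$ stabilizing to $\mathbf y$ (the limit exists, does not depend on the sequence, and $\{M^{\mathbf y}_k\}_{k\ge1}$ is a coherent system of probability measures). *)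

(* Defs.v *)
From HB Require Import structures.
From mathcomp Require Import all_boot all_order all_algebra finmap.
From mathcomp Require Import all_classical all_reals all_analysis.

Set Implicit Arguments.
Unset Strict Implicit.
Unset Printing Implicit Defensive.

Import Order.TTheory GRing.Theory Num.Theory.
Import numFieldNormedType.Exports.

Local Open Scope classical_set_scope.
Local Open Scope ring_scope.

Inductive bcd_type := TypeB | TypeC | TypeD.

Definition epsilon (R : realType) (G : bcd_type) : R :=
  match G with TypeB => 2^-1 | TypeC => 1 | TypeD => 0 end.

Definition GT (N : nat) := {lam : N.-tuple nat | sorted geq lam}.

(* Finitely supported families of coefficients indexed by exponent vectors. *)
Definition laurent (R : realType) (N : nat) :=
  {fsfun {ffun 'I_N -> int} -> R with 0}.

(* Only meaningful when all the coordinates of z are nonzero. *)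
Definition leval (R : realType) (N : nat) (P : laurent R N) (z : N.-tuple R) : R :=
  \sum_(a <- finsupp P) P a * \prod_(j < N) tnth z j ^ a j.

Definition symm_vandermonde (R : realType) (N : nat) (z : N.-tuple R) : R :=
  \prod_(i < N) \prod_(j < N | (i < j)%N)
    (tnth z i + (tnth z i)^-1 - tnth z j - (tnth z j)^-1).

(* Here m stands for lambda_i + N - i. The half-integer powers of type B are
   taken at positive reals. *)
Definition char_entry (R : realType) (G : bcd_type) (m : nat) (z : R) : R :=
  match G with
  | TypeB => (z `^ (m%:R + 2^-1) - z `^ (- (m%:R + 2^-1)))
             / (z `^ 2^-1 - z `^ (- 2^-1))
  | TypeC => (z ^+ m.+1 - z ^- m.+1) / (z - z^-1)
  | TypeD => z ^+ m + z ^- m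
  end.

(* The unique Laurent polynomial given by the determinantal formula at all
   positive points where no denominator vanishes. Such points form a nonempty
   open subset of R^N, so this determines the coefficients. Indices start from 0, so that
   N - i becomes N - i.+1. *)
Definition chi (R : realType) (G : bcd_type) (N : nat) (lam : GT N) :
    laurent R N :=
  xget [fsfun]
    [set P : laurent R N | forall z : N.-tuple R,
       (forall j, 0 < tnth z j /\ tnth z j != 1) -> symm_vandermonde z != 0 ->
       leval P z = (symm_vandermonde z)^-1 *
         \det (\matrix_(i < N, j < N)
                 char_entry G (tnth (val lam) i + (N - i.+1)) (tnth z j))].

Definition qpoint (R : realType) (q : R) (G : bcd_type) (N : nat) :
    N.-tuple R :=
  [tuple q `^ (j%:R + epsilon R G) | j < N].

(* The equality of Laurent polynomials in x_1, ..., x_N is expressed by their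
   equality at all points with nonzero coordinates. *)
Definition cotransition (R : realType) (q : R) (G : bcd_type) (N : nat)
    (lam : GT N.+1) : {fsfun GT N -> R with 0} :=
  xget [fsfun]
    [set c : {fsfun GT N -> R with 0} | forall x : N.-tuple R,
       (forall j, tnth x j != 0) ->
       leval (chi R G lam) [tuple of rcons x (q `^ (N%:R + epsilon R G))]
         / leval (chi R G lam) (qpoint q G N.+1)
       = \sum_(mu <- finsupp c)
           c mu * (leval (chi R G mu) x / leval (chi R G mu) (qpoint q G N))].

(* cotransition_iter q G k m is the matrix Lambda^(m + k)_k. *)
Fixpoint cotransition_iter (R : realType) (q : R) (G : bcd_type) (k m : nat) :
    GT (m + k) -> GT k -> R :=
  match m with
  | 0 => fun lam mu => (lam == mu)%:R
  | m'.+1 => fun lam mu =>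
      \sum_(nu <- finsupp (cotransition q G lam))
        cotransition q G lam nu * cotransition_iter q G nu mu
  end.

Definition prob_mass (R : realType) (T : choiceType) (p : T -> R) : Prop :=
  (forall x, 0 <= p x) /\ \esum_(x in [set: T]) (p x)%:E = 1%E.

(* M n is a measure on GT n.+1, as the levels of the graph start from 1. *)
Definition coherent_system (R : realType) (q : R) (G : bcd_type)
    (M : forall n, GT n.+1 -> R) : Prop :=
  (forall n, prob_mass (M n)) /\
  (forall n (mu : GT n.+1),
     \esum_(lam in [set: GT n.+2]) (M n.+1 lam * cotransition q G lam mu)%:E
     = (M n mu)%:E).

Definition martin_boundary (R : realType) (q : R) (G : bcd_type) :
    set (forall n, GT n.+1 -> R) :=
  [set M | coherent_system q G M /\
     exists lam : forall N, GT N, forall n (mu : GT n.+1),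
       cotransition_iter q G (lam (m + n.+1)%N) mu @[m --> \oo] --> M n mu].

(* y i stands for y_(i+1). *)
Definition frakY : set (nat -> nat) := [set y | nondecreasing_seq y].

(* nth 0 (lam N) (N - i.+1) is the (i+1)-st part of lam N from the right. *)
Definition stabilizes (lam : forall N, GT N) (y : nat -> nat) : Prop :=
  forall i, nth 0%N (val (lam N)) (N - i.+1) @[N --> \oo] --> y i.

(* The common limit along all the sequences which stabilize to y; the default
   value is irrelevant as this limit exists when y is in frakY. *)
Definition boundary_measure (R : realType) (q : R) (G : bcd_type)
    (y : nat -> nat) : forall n, GT n.+1 -> R :=
  fun n mu => xget 0 [set l : R | forall lam : forall N, GT N,
    stabilizes lam y ->
    cotransition_iter q G (lam (m + n.+1)%N) mu @[m --> \oo] --> l].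

(* Main.v *)
Require Import Defs.
From HB Require Import structures.
From mathcomp Require Import all_boot all_order all_algebra all_fingroup finmap.
From mathcomp Require Import all_classical all_reals all_analysis.
From mathcomp Require Import lra zify.

Set Implicit Arguments.
Unset Strict Implicit.
Unset Printing Implicit Defensive.

Import Order.TTheory GRing.Theory Num.Theory.
Import numFieldNormedType.Exports.
Local Open Scope classical_set_scope.
Local Open Scope ring_scope.

(** The theorem holds because, at the level of the exponents
    [lambda_i + N - i], the transition matrices are given by determinants which
    can be estimated uniformly.

    In the variable [z + 2 + z^-1] the entries of the three determinants become
    polynomials [charp m] in one variable, with a three-term recurrence common to
    all types, and the specialization points become the nodes
    [node n = symval (q ^ (n + epsilon))], which grow like [q ^ - n].  Two facts
    rule the computations.  The values [(charp l).[node j]] are, up to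
    normalization, symmetric in [l] and [j] ([charp_dual]).  And multiplication by
    the variable has nonnegative coefficients in the basis [charp], so that the
    norm [nrm] is well behaved under products.  Write [L 0 < L 1 < ...] for the
    exponents of a signature.  By duality, Lagrange interpolation at the
    [node (L r)] gives polynomials [gpoly N L j] in the span of the
    [charp (L r)] which are dual to the evaluations at the first [N] nodes;
    dividing them by their zeros at the nodes of index at least [k] gives
    [hpoly N L k j].  Then [Lambda^N_k (lambda, mu)] is the alternant of [mu] at
    the nodes times the minor with columns [mu] of the matrix of coefficients of
    the [hpoly N L k j] ([trans], [iter_trans]).  That the numbers are nonnegative
    follows from the Christoffel-Darboux formula, one level at a time.

    Since the nodes grow geometrically, all infinite products converge, and there
    are three estimates.
    - [transL_trunc]: as long as the first exponents are bounded, the law at a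
      fixed level is determined in total variation by the [n] smallest exponents
      up to [O(q ^ n)].  Hence it converges in l1 along a stabilizing sequence, to
      a limit depending on [y] only; no mass is lost and coherence passes to the
      limit.
    - [transL_escape]: if the exponent of a given index is large, the law at some
      level is close to zero at every point.  As the points of the boundary are
      probability measures, each exponent of a sequence defining one of them stays
      bounded.
    - [phi_gpoly0_gap]: the coefficient of [gpoly N L 0] on [charp m] vanishes if
      [m] is not an exponent, and is bounded away from zero if it is.  These
      coefficients can be read off the law at level 1 up to a small error, so that
      law determines which exponents occur ([occurs_stable]).

    The last point gives injectivity.  Together with the second one it shows that
    the exponents of a sequence which defines a boundary point are eventually
    constant, that is, the sequence stabilizes; this is surjectivity. *)

(** * Infinite products *)

Section Products.
Variable R : realType.
Implicit Types (a : nat -> R) (m n : nat).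

Lemma prod1D_le_expR m n a : (forall i, (m <= i < n)%N -> 0 <= a i) ->
  \prod_(m <= i < n) (1 + a i) <= expR (\sum_(m <= i < n) a i).
Proof.
move=> a0; rewrite expR_sum big_nat [leRHS]big_nat.
apply: ler_prod => i /a0 ai; rewrite addr_ge0 //=.
exact: expR_ge1Dx.
Qed.

Lemma prod1D_sub1 m n a A : (forall i, (m <= i < n)%N -> 0 <= a i) ->
  \sum_(m <= i < n) a i <= A -> \prod_(m <= i < n) (1 + a i) - 1 <= A * expR A.
Proof.
move=> a0 aA.
have h : \prod_(m <= i < n) (1 + a i) <= expR A.
  by apply: le_trans (prod1D_le_expR a0) _; rewrite ler_expR.
have h2 : expR A * expR (- A) = 1 by rewrite -expRD subrr expR0.
have h3 : 1 - A <= expR (- A) by apply: expR_ge1Dx.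
have h4 : expR A * (1 - A) <= 1 by rewrite -[leRHS]h2 ler_wpM2l // expR_ge0.
by move: h4 h; rewrite mulrBr mulr1 (mulrC A); lra.
Qed.

Variable q : R.
Hypotheses (q_gt0 : 0 < q) (q_lt1 : q < 1).

Local Ltac qlra := move: q_gt0 q_lt1; lra.

Lemma sum_geom_le m n : \sum_(m <= i < n) q ^+ i <= q ^+ m / (1 - q).
Proof.
have h0 : 0 < 1 - q by qlra.
have [nm|mn] := leqP n m.
  by rewrite big_geq// divr_ge0 ?exprn_ge0// ltW.
have : (\sum_(m <= i < n) q ^+ i) * (1 - q) = q ^+ m - q ^+ n.
  rewrite mulr_suml (@telescope_sumr_eq _ m n (fun i => - q ^+ i))//; last 1 first.
  - by move=> i _; rewrite exprS; lra.
  - by rewrite opprK addrC.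
  - exact: ltnW.
move=> h; rewrite ler_pdivlMr// h lerBlDr lerDl exprn_ge0// ltW//.
Qed.

Lemma sum_geom_shift_le m n b : (b <= m)%N ->
  \sum_(m <= i < n) q ^+ (i - b) <= q ^+ (m - b) / (1 - q).
Proof.
move=> bm; apply: le_trans (sum_geom_le (m - b) (n - b)).
rewrite -{1}(subnK bm) addnC -{1}[b in X in X <= _]addn0.
have [nb|bn] := leqP n b.
  by rewrite big_geq ?big_geq//; lia.
rewrite -{1}(subnK (ltnW bn)) [(n - b + b)%N]addnC.
rewrite addn0 addnC big_addn addKn big_nat [leRHS]big_nat.
by apply: ler_sum => i _; rewrite addnK.
Qed.

(** Each factor is at least the inverse of [1 + q ^+ i / (1 - q)], and the
    product of the latter is bounded by an exponential. *)
Lemma qprod_lower : exists2 c : R, 0 < c <= 1 &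
  forall n, c <= \prod_(1 <= i < n) (1 - q ^+ i).
Proof.
have h0 : 0 < 1 - q by qlra.
pose A := ((1 - q) ^- 2 : R).
exists (expR (- A)).
  by rewrite expR_gt0 /= -expR0 ler_expR oppr_le0 invr_ge0 exprn_ge0// ltW.
move=> n.
have qi1 i : (1 <= i)%N -> q ^+ i <= q.
  by case: i => // i _; rewrite exprS -[leRHS]mulr1 ler_wpM2l ?exprn_ile1// ltW.
have P0 : 0 < \prod_(1 <= i < n) (1 - q ^+ i).
  rewrite big_nat prodr_gt0// => i /andP[i1 _].
  by have := qi1 _ i1; qlra.
rewrite expRN invf_ple ?posrE ?expR_gt0//.
rewrite big_nat -prodfV -big_nat.
apply: le_trans (_ : \prod_(1 <= i < n) (1 + q ^+ i / (1 - q)) <= _).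
  rewrite big_nat [leRHS]big_nat; apply: ler_prod => i /andP[i1 _].
  have h := qi1 _ i1; have h' : 0 < q ^+ i by rewrite exprn_gt0.
  apply/andP; split; first by rewrite invr_ge0; qlra.
  rewrite invf_ple ?posrE; [|qlra|]; last first.
    by rewrite addr_gt0// divr_gt0.
  set x := q ^+ i in h h' *.
  rewrite -[leLHS]mul1r ler_pdivrMr; last by rewrite addr_gt0// divr_gt0.
  have -> : (1 - x) * (1 + x / (1 - q)) = 1 + x * (q - x) / (1 - q).
    have e : (1 - q) / (1 - q) = 1 by rewrite mulfV// lt0r_neq0.
    have -> : x * (q - x) / (1 - q) = x * (1 - x) / (1 - q) - x.
      have -> : q - x = (1 - x) - (1 - q) by lra.
      by rewrite mulrBr mulrBl -[x * (1 - q) / _]mulrA e mulr1.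
    by qlra.
  by rewrite lerDl divr_ge0 ?mulr_ge0//; qlra.
apply: le_trans (prod1D_le_expR _) _.
  by move=> i _; rewrite divr_ge0 ?exprn_ge0 ?ltW.
rewrite ler_expR -mulr_suml /A expr2 invfM.
rewrite ler_wpM2r ?invr_ge0 ?(ltW h0)//.
apply: le_trans (sum_geom_le _ _) _.
by rewrite ler_pdivrMr// mulVf ?lt0r_neq0 ?expr1//; qlra.
Qed.

End Products.

(** * The Cauchy-Binet formula *)

Section CauchyBinet.
Variables (R : comPzRingType) (k B : nat).
Implicit Types (f g : {ffun 'I_k -> 'I_B}) (A : 'M[R]_(k, B)) (C : 'M[R]_(B, k)).

Definition decreasing g := [forall i : 'I_k, forall j : 'I_k, (i < j)%N ==> (g j < g i)%N].

Lemma decreasingP g :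
  reflect (forall i j : 'I_k, (i < j)%N -> (g j < g i)%N) (decreasing g).
Proof.
apply: (iffP forallP) => h i; last by apply/forallP => j; apply/implyP/h.
by move=> j; move/forallP: (h i) => /(_ j) /implyP.
Qed.

(** Multilinearity of the determinant in the rows of the product; antisymmetry
    is not used yet. *)
Lemma det_mulmx_rowsub A C :
  \det (A *m C) = \sum_(f : {ffun 'I_k -> 'I_B}) (\prod_i A i (f i)) * \det (rowsub f C).
Proof.
rewrite [LHS]/determinant.
under eq_bigr => s _.
  under eq_bigr do rewrite mxE.
  rewrite bigA_distr_bigA mulr_sumr.
  over.
rewrite exchange_big /=; apply: eq_bigr => f _.
rewrite /determinant mulr_sumr; apply: eq_bigr => s _.
rewrite big_split /= mulrCA; congr (_ * (_ * _)).
by apply: eq_bigr => i _; rewrite mxE.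
Qed.

Lemma det_rowsub_perm g (s : 'S_k) C :
  \det (rowsub [ffun i => g (s i)] C) = (-1) ^+ s * \det (rowsub g C).
Proof.
rewrite -det_perm -det_mulmx -row_permE; congr (\det _).
by apply/matrixP => i j; rewrite !mxE ffunE.
Qed.

Lemma det_rowsub_noninj f C : ~~ injectiveb f -> \det (rowsub f C) = 0.
Proof.
move=> /injectivePn [i [j ij fij]].
by apply: (determinant_alternate ij) => l; rewrite !mxE fij.
Qed.

Lemma sorted_decreasing g : decreasing g ->
  sorted (fun a b : 'I_B => (b < a)%N) [seq g i | i <- enum 'I_k].
Proof.
move=> /decreasingP gd; rewrite sorted_map.
apply: (@sub_sorted _ (fun i j : 'I_k => (i < j)%N)) => [i j|]; first exact: gd.
by have := iota_ltn_sorted 0 k; rewrite -val_enum_ord sorted_map.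
Qed.

Lemma injective_decreasing_perm f : injectiveb f ->
  exists g (s : 'S_k), decreasing g /\ f = [ffun i => g (s i)].
Proof.
move=> /injectiveP finj.
pose r := fun a b : 'I_B => (b <= a)%N.
pose t0 := [tuple f i | i < k].
pose t := [tuple of sort r t0].
have /tuple_permP [p hp] : perm_eq t0 t by rewrite perm_sym perm_sort.
have rtr : transitive r by move=> a b c; rewrite /r => h1 h2; apply: leq_trans h2 h1.
have rtot : total r by move=> a b; rewrite /r; exact: leq_total.
have rrefl : reflexive r by move=> a; rewrite /r.
have st : sorted r t by apply: sort_sorted.
have ut : uniq t.
  by rewrite sort_uniq /= map_inj_uniq ?enum_uniq.
exists [ffun i => tnth t i], p; split; last first.
  apply/ffunP => i; rewrite !ffunE.
  have -> : f i = tnth t0 i by rewrite tnth_mktuple.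
  rewrite (tnth_nth (f i)) hp -(tnth_nth (f i) [tuple tnth t (p i0) | i0 < k]).
  by rewrite tnth_mktuple.
apply/decreasingP => i j ij; rewrite !ffunE !(tnth_nth (f i)).
have szt : size t = k by rewrite size_tuple.
have := sorted_leq_nth rtr rrefl (f i) st.
move=> /(_ i j); rewrite !inE szt !ltn_ord => /(_ isT isT (ltnW ij)).
rewrite /r leq_eqVlt => /orP[/eqP/val_inj/eqP|//].
by rewrite nth_uniq ?szt ?ltn_ord// => /eqP e; move: ij; rewrite e ltnn.
Qed.

Lemma decreasing_perm_inj g g' (s s' : 'S_k) : decreasing g -> decreasing g' ->
  [ffun i => g (s i)] = [ffun i => g' (s' i)] -> g = g' /\ s = s'.
Proof.
move=> gd gd' e.
have eg i : g (s i) = g' (s' i) by move/ffunP: e => /(_ i); rewrite !ffunE.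
have pe : perm_eq [seq g i | i <- enum 'I_k] [seq g' i | i <- enum 'I_k].
  have -> : [seq g' i | i <- enum 'I_k] = [tuple g' i | i < k] by [].
  apply/tuple_permP; exists (s^-1 * s')%g.
  have -> : [seq g i | i <- enum 'I_k] = [tuple g i | i < k] by [].
  congr val; apply: eq_mktuple => i.
  by rewrite tnth_mktuple permM -eg permKV.
have gg : g = g'.
  have tr : transitive (fun a b : 'I_B => (b < a)%N).
    by move=> a b c h1 h2; apply: ltn_trans h2 h1.
  have asym : antisymmetric (fun a b : 'I_B => (b < a)%N).
    by move=> a b /andP[h1 h2]; have := ltn_trans h1 h2; rewrite ltnn.
  have h := sorted_eq tr asym (sorted_decreasing gd) (sorted_decreasing gd') pe.
  apply/ffunP => i; move/eq_in_map: h => /(_ i); apply.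
  by rewrite mem_enum.
split=> //; subst g'.
apply/permP => i; have := eg i.
move/decreasingP: gd => gd h.
case: (ltngtP (s i) (s' i)) => [/gd|/gd|/val_inj//]; rewrite h ltnn//.
Qed.

(** In [det_mulmx_rowsub] only injective maps contribute, and each of them is,
    in a unique way, a permutation followed by a decreasing map. Decreasing
    maps are used because they are the exponents of signatures. *)
Lemma cauchy_binet A C : \det (A *m C) =
  \sum_(g | decreasing g) \det (colsub g A) * \det (rowsub g C).
Proof.
rewrite det_mulmx_rowsub.
pose X f := \prod_i A i (f i) * \det (rowsub f C).
pose D := [set gs : {ffun 'I_k -> 'I_B} * 'S_k | decreasing gs.1]%SET.
pose h (gs : {ffun 'I_k -> 'I_B} * 'S_k) := [ffun i => gs.1 (gs.2 i)].
transitivity (\sum_(f in h @: D) X f).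
  rewrite [LHS](bigID (mem (h @: D))) /= [X in _ + X]big1 ?addr0// => f fD.
  rewrite det_rowsub_noninj ?mulr0//; apply: contra fD.
  move=> /injective_decreasing_perm [g [s [gd fE]]].
  by apply/imsetP; exists (g, s) => //; rewrite inE.
rewrite big_imset /=; last first.
  move=> [g s] [g' s']; rewrite !inE /= => gd gd' e.
  by have [-> ->] : g = g' /\ s = s' := decreasing_perm_inj gd gd' e.
transitivity (\sum_(gs | decreasing gs.1) X (h gs)).
  by apply: eq_bigl => gs; rewrite inE.
transitivity (\sum_(g | decreasing g) \sum_(s : 'S_k) X (h (g, s))).
  rewrite pair_big_dep /=; apply: eq_big => [[g s]|[g s]] //=.
  by rewrite andbT.
apply: eq_bigr => g gd; rewrite [X in _ = X * _]/determinant mulr_suml.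
apply: eq_bigr => s _; rewrite /X /h /= det_rowsub_perm mulrCA mulrA.
congr (_ * _ * _); apply: eq_bigr => i _; rewrite !mxE ffunE//.
Qed.

End CauchyBinet.

(** * Orthogonal polynomials and the norm attached to them *)

Section CharPoly.
Variables (R : realType) (G : bcd_type).
Implicit Types (f g : {poly R}) (x y : R) (m n : nat).

Definition charp_lead : R := match G with TypeD => 2 | _ => 1 end.
Definition charp_shift : R := match G with TypeB => 1 | _ => 2 end.
Notation c0 := charp_lead.
Notation d0 := charp_shift.

(** Entries of the determinants as polynomials in [z + 2 + z^-1]: the
    recurrence is common to the three types, which differ by the initial
    values. See [char_entryE]. *)
Fixpoint charp (m : nat) : {poly R} :=
  match m with
  | 0 => c0%:P
  | m1.+1 => match m1 with
             | 0 => 'X - d0%:P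
             | m2.+1 => ('X - 2%:P) * charp m1 - charp m2
             end
  end.
Arguments charp : simpl never.
Notation p := charp.

Lemma charpSS m : p m.+2 = ('X - 2%:P) * p m.+1 - p m. Proof. by []. Qed.

Lemma charp_lead_cases : c0 = 1 \/ c0 = 2.
Proof. by rewrite /c0; case: G; [left|left|right]. Qed.

Lemma charp_lead_gt0 : 0 < c0.
Proof. by rewrite /c0; case: G; rewrite ?ltr01 ?ltr0n. Qed.

Lemma charp_lead_neq0 : c0 != 0. Proof. by rewrite gt_eqF ?charp_lead_gt0. Qed.

Lemma charp_shift_gt0 : 0 < d0.
Proof. by rewrite /d0; case: G; rewrite ?ltr01 ?ltr0n. Qed.

(** Multiplication by the variable in the basis [charp], acting on
    coefficients. That its entries are nonnegative is the reason for shifting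
    [z + z^-1] by [2]. *)
Definition mulX_coef (a : nat -> R) (m : nat) : R :=
  match m with
  | 0 => d0 * a 0%N + a 1%N
  | 1 => c0 * a 0%N + 2 * a 1%N + a 2%N
  | m'.+2 => a m'.+1 + 2 * a m'.+2 + a m'.+3
  end.
Notation S := mulX_coef.

Lemma mulX_charp0 : 'X * p 0 = d0 *: p 0 + c0 *: p 1.
Proof.
rewrite -[p 0]/(c0%:P) -[p 1]/('X - d0%:P) -!mul_polyC mulrBr addrC.
by rewrite mulrC [d0%:P * _]mulrC subrK.
Qed.

Lemma mulX_charp1 m : 'X * p m.+1 = p m + 2 *: p m.+1 + p m.+2.
Proof.
rewrite charpSS -!mul_polyC mulrBl.
by rewrite -[X in _ = _ + X]addrA -opprD addrCA [2%:P * _ + _]addrC subrr addr0.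
Qed.

Definition phi_basis (i m : nat) : R :=
  iter i S (fun n => (n == 0%N)%:R / c0) m.

(** Coefficient of [f] on [charp m]: by construction, multiplication by the
    variable acts on these coefficients as the nonnegative tridiagonal operator
    [mulX_coef]. *)
Definition phi (m : nat) (f : {poly R}) : R :=
  \sum_(i < size f) f`_i * phi_basis i m.

Lemma phiE n m f : (size f <= n)%N -> phi m f = \sum_(i < n) f`_i * phi_basis i m.
Proof.
move=> sn; rewrite [LHS]/phi (big_ord_widen _ (fun i => f`_i * phi_basis i m) sn).
rewrite big_mkcond; apply: eq_bigr => i _; case: ifPn => //.
by rewrite -leqNgt => /leq_sizeP /(_ _ (leqnn _)) ->; rewrite mul0r.
Qed.

Lemma phi_is_linear m : linear (phi m).
Proof.
move=> a f g.
pose n := maxn (size (a *: f + g)) (maxn (size f) (size g)).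
rewrite /GRing.scale /=.
rewrite !(@phiE n) /n ?leq_max ?leqnn ?orbT// mulr_sumr -big_split.
by apply: eq_bigr => i _; rewrite coefD coefZ mulrDl mulrA.
Qed.

HB.instance Definition _ m :=
  GRing.isLinear.Build R {poly R} R _ (phi m) (phi_is_linear m).

Lemma phiZ m a f : phi m (a *: f) = a * phi m f.
Proof. by rewrite linearZ. Qed.

Lemma mulX_coef_lin (I : finType) (c : I -> R) (a : I -> nat -> R) m :
  S (fun n => \sum_i c i * a i n) m = \sum_i c i * S (a i) m.
Proof.
case: m => [|[|m]] /=; rewrite !mulr_sumr -?big_split /=; apply: eq_bigr => i _; lra.
Qed.

Lemma eq_mulX_coef a b : a =1 b -> S a =1 S b.
Proof. by move=> ab [|[|m]] /=; rewrite !ab. Qed.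

Lemma phi_mulX m f : phi m ('X * f) = S (phi^~ f) m.
Proof.
have sX : (size ('X * f)%R <= (size f).+1)%N.
  by rewrite (leq_trans (size_polyMleq _ _))// size_polyX.
rewrite (phiE _ sX) big_ord_recl coefXM mul0r add0r.
rewrite /phi mulX_coef_lin; apply: eq_bigr => i _.
by rewrite coefXM /=.
Qed.

Lemma phi_polyC m c : phi m c%:P = c * ((m == 0%N)%:R / c0).
Proof.
by rewrite (@phiE 1) ?size_polyC ?leq_b1// big_ord_recl big_ord0 addr0 coefC.
Qed.

Lemma phi_1 m : phi m 1 = (m == 0%N)%:R / c0.
Proof. by rewrite -[1]/(1%:P) phi_polyC mul1r. Qed.

Lemma phi_charp m n : phi m (p n) = (m == n)%:R.
Proof.
have [n' ltn] := ubnP n; elim: n' => // n' IH in n m ltn *.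
case: n => [|[|n]] in ltn *.
- by rewrite phi_polyC mulrCA divff ?charp_lead_neq0 ?mulr1.
- have -> : p 1 = c0^-1 *: ('X * p 0 - d0 *: p 0).
    rewrite mulX_charp0 addrC addrA addNr add0r scalerA mulVf ?scale1r//.
    exact: charp_lead_neq0.
  rewrite phiZ linearB /= phiZ phi_mulX.
  rewrite (@eq_mulX_coef _ (fun m => (m == 0%N)%:R)); last first.
    by move=> i; rewrite IH.
  rewrite IH//; case: m => [|[|m]] /=; rewrite ?mulr1 ?mulr0 ?addr0 ?subr0 ?subrr ?mulr0//.
  by rewrite mulVf// charp_lead_neq0.
- have -> : p n.+2 = 'X * p n.+1 - 2 *: p n.+1 - p n.
    by rewrite charpSS mulrBl -mul_polyC.
  rewrite !linearB /= phiZ phi_mulX.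
  rewrite (@eq_mulX_coef _ (fun m => (m == n.+1)%:R)); last first.
    by move=> i; rewrite IH//; lia.
  rewrite !IH; [|lia|lia].
  case: m => [|[|m]] /=.
  + by case: n {ltn} => [|n] /=; lra.
  + by case: n {ltn} => [|[|n]] /=; lra.
  + rewrite !eqSS.
    lra.
Qed.

Definition spanned n f := exists a : nat -> R, f = \sum_(m < n) a m *: p m.

Lemma spannedD n f g : spanned n f -> spanned n g -> spanned n (f + g).
Proof.
move=> [a ->] [b ->]; exists (fun i => a i + b i).
by rewrite -big_split; apply: eq_bigr => i _; rewrite scalerDl.
Qed.

Lemma spannedZ n c f : spanned n f -> spanned n (c *: f).
Proof.
move=> [a ->]; exists (fun i => c * a i).
by rewrite scaler_sumr; apply: eq_bigr => i _; rewrite scalerA.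
Qed.

Lemma spanned_charp n m : (m < n)%N -> spanned n (p m).
Proof.
move=> mn; exists (fun i => (i == m)%:R).
rewrite (bigD1 (Ordinal mn))//= eqxx scale1r big1 ?addr0// => i.
by rewrite -val_eqE /= => /negPf ->; rewrite scale0r.
Qed.

Lemma spanned_sum n (I : Type) (r : seq I) (P : pred I) (F : I -> {poly R}) :
  (forall i, P i -> spanned n (F i)) -> spanned n (\sum_(i <- r | P i) F i).
Proof.
move=> h; apply: big_ind => //; last exact: spannedD.
by exists (fun=> 0); rewrite big1// => i _; rewrite scale0r.
Qed.

Lemma spanned_mulX n f : spanned n f -> spanned n.+1 ('X * f).
Proof.
move=> [a ->]; rewrite mulr_sumr; apply: spanned_sum => i _.
rewrite -scalerAr; apply: spannedZ.
case: i => [[|i] /= ilt]; last first.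
  rewrite mulX_charp1; apply: spannedD; [apply: spannedD; [|apply: spannedZ]|].
  - by apply: spanned_charp; lia.
  - by apply: spanned_charp; lia.
  - by apply: spanned_charp; lia.
rewrite mulX_charp0.
by apply: spannedD; apply: spannedZ; apply: spanned_charp; lia.
Qed.

Lemma spanned_size n f : (size f <= n)%N -> spanned n f.
Proof.
move=> sn; rewrite -[f]coefK poly_def; apply: spanned_sum => i _.
apply: spannedZ.
have h : forall j, (j < n)%N -> spanned j.+1 ('X^j).
  elim => [_|j IH jn].
    have -> : 'X^0 = c0^-1 *: p 0 :> {poly R}.
      by rewrite -[p 0]/(c0%:P) -mul_polyC -polyCM mulVf// charp_lead_neq0.
    by apply: spannedZ; apply: spanned_charp.
  by rewrite exprS; apply: spanned_mulX; apply: IH; lia.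
have [a ->] := h i (leq_trans (ltn_ord i) sn).
apply: spanned_sum => j _; apply: spannedZ; apply: spanned_charp.
by apply: leq_trans (ltn_ord j) (leq_trans (ltn_ord i) sn).
Qed.

Lemma phi_sum_charp n (a : nat -> R) m :
  phi m (\sum_(i < n) a i *: p i) = if (m < n)%N then a m else 0.
Proof.
rewrite linear_sum /=; case: ifP => [mn|mn].
  rewrite (bigD1 (Ordinal mn))//= phiZ phi_charp eqxx mulr1 big1 ?addr0// => i.
  by rewrite -val_eqE /= eq_sym phiZ phi_charp => /negPf ->; rewrite mulr0.
rewrite big1// => i _; rewrite phiZ phi_charp.
case: eqP => [mi|]; last by rewrite mulr0.
by have := ltn_ord i; rewrite -mi mn.
Qed.

Lemma phi_expand n f : (size f <= n)%N -> f = \sum_(m < n) phi m f *: p m.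
Proof.
move=> /spanned_size [a fE]; rewrite {1}fE; apply: eq_bigr => m _.
by rewrite fE phi_sum_charp ltn_ord.
Qed.

Lemma phi_size n f : (size f <= n)%N -> phi n f = 0.
Proof. by move=> /spanned_size [a ->]; rewrite phi_sum_charp ltnn. Qed.

Lemma horner_expand n f x : (size f <= n)%N ->
  f.[x] = \sum_(m < n) phi m f * (p m).[x].
Proof.
move=> /phi_expand {1}->; rewrite horner_sum.
by apply: eq_bigr => i _; rewrite hornerZ.
Qed.

(** ** Values of the polynomials *)

Lemma horner_charp0 x : (p 0).[x] = c0. Proof. by rewrite hornerC. Qed.

Lemma horner_charp1 x : (p 1).[x] = x - d0.
Proof. by rewrite hornerXsubC. Qed.

Lemma horner_charpSS m x : (p m.+2).[x] = (x - 2) * (p m.+1).[x] - (p m).[x].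
Proof. by rewrite charpSS hornerD hornerN hornerM hornerXsubC. Qed.

(** The threshold [4] is the least value of [z + 2 + z^-1] over positive [z]. *)
Lemma charp_ge1_incr m x : 4 <= x ->
  1 <= (p m).[x] /\ (p m).[x] <= (p m.+1).[x].
Proof.
move=> x4; elim: m => [|m [IH1 IH2]].
  rewrite horner_charp0 horner_charp1 /c0 /d0; case: G; lra.
split; first lra.
rewrite horner_charpSS; nra.
Qed.

Lemma charp_ge1 m x : 4 <= x -> 1 <= (p m).[x].
Proof. by move=> /(charp_ge1_incr m) []. Qed.

Lemma charp_gt0 m x : 4 <= x -> 0 < (p m).[x].
Proof. by move=> /(charp_ge1 m); lra. Qed.

Lemma charpS_bounds m x : 4 <= x ->
  x / 4 * (p m).[x] <= (p m.+1).[x] <= x * (p m).[x].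
Proof.
move=> x4; case: m => [|m].
  by rewrite horner_charp0 horner_charp1 /c0 /d0; case: G; lra.
have [h1 h2] := charp_ge1_incr m x4; rewrite horner_charpSS; apply/andP.
by split; nra.
Qed.

Lemma charp_lower m x : 4 <= x -> (x / 4) ^+ m <= (p m).[x].
Proof.
move=> x4; elim: m => [|m IH]; first by rewrite expr0 charp_ge1.
have /andP[h _] := charpS_bounds m x4; apply: le_trans h.
by rewrite exprS ler_wpM2l//; lra.
Qed.

Lemma charp_upper m x : 4 <= x -> (p m).[x] <= 2 * x ^+ m.
Proof.
move=> x4; elim: m => [|m IH].
  by rewrite horner_charp0 expr0; case: charp_lead_cases => ->; lra.
have /andP[_ h] := charpS_bounds m x4; apply: le_trans h _.
by rewrite exprS mulrCA ler_wpM2l//; lra.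
Qed.

(** Reciprocals, up to a common factor, of the squared norms of the orthogonal
    polynomials [charp]. *)
Definition cd_weight (m : nat) : R := if m == 0%N then c0^-1 else 1.

Lemma cd_weight_gt0 m : 0 < cd_weight m.
Proof. by rewrite /cd_weight; case: ifP => // _; rewrite invr_gt0 charp_lead_gt0. Qed.

Lemma christoffel_darboux l x y :
  (p l.+1).[x] * (p l).[y] - (p l).[x] * (p l.+1).[y] =
  (x - y) * \sum_(m < l.+1) cd_weight m * ((p m).[x] * (p m).[y]).
Proof.
elim: l => [|l IH].
  rewrite big_ord_recl big_ord0 addr0 !horner_charp1 !horner_charp0 /cd_weight /=.
  rewrite mulKf ?charp_lead_neq0//; lra.
rewrite big_ord_recr /= -[cd_weight l.+1]/1 mulrDr -IH !horner_charpSS; lra.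
Qed.

Lemma charp_monotone m x y : 4 <= x -> x <= y -> (p m).[x] <= (p m).[y].
Proof.
move=> x4 xy; have y4 : 4 <= y by lra.
elim: m => [|m IH]; first by rewrite !horner_charp0.
have h : 0 <= (p m.+1).[y] * (p m).[x] - (p m).[y] * (p m.+1).[x].
  rewrite christoffel_darboux mulr_ge0 ?subr_ge0// sumr_ge0// => i _.
  by rewrite !mulr_ge0// ltW// ?cd_weight_gt0 ?charp_gt0.
rewrite -(ler_pM2r (charp_gt0 m x4)).
have := charp_gt0 m.+1 x4; nra.
Qed.

(** ** The norm *)

(** A weighted l1 norm on coefficients. As multiplication by the variable has
    nonnegative coefficients in the basis [charp], it has norm at most [x]. *)
Definition nrm x f : R := \sum_(m < size f) `|phi m f| * (p m).[x].

Lemma nrmE n x f : (size f <= n)%N -> nrm x f = \sum_(m < n) `|phi m f| * (p m).[x].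
Proof.
move=> sn; rewrite [LHS]/nrm (big_ord_widen _ (fun m => `|phi m f| * (p m).[x]) sn).
rewrite big_mkcond; apply: eq_bigr => i _; case: ifPn => //.
by rewrite -leqNgt => /phi_size ->; rewrite normr0 mul0r.
Qed.

Lemma nrm_ge0 x f : 4 <= x -> 0 <= nrm x f.
Proof.
move=> x4; apply: sumr_ge0 => m _.
by rewrite mulr_ge0// ltW// charp_gt0.
Qed.

Lemma nrmZ x a f : nrm x (a *: f) = `|a| * nrm x f.
Proof.
rewrite (nrmE _ (size_scale_leq a f)) mulr_sumr.
by apply: eq_bigr => m _; rewrite phiZ normrM mulrA.
Qed.

Lemma nrm0 x : nrm x 0 = 0.
Proof. by rewrite -(scale0r 0) nrmZ normr0 mul0r. Qed.

Lemma nrmN x f : nrm x (- f) = nrm x f.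
Proof. by rewrite -scaleN1r nrmZ normrN1 mul1r. Qed.

Lemma nrmD x f g : 4 <= x -> nrm x (f + g) <= nrm x f + nrm x g.
Proof.
move=> x4; pose n := maxn (size (f + g)) (maxn (size f) (size g)).
rewrite !(@nrmE n) /n ?leq_max ?leqnn ?orbT// -big_split.
apply: ler_sum => m _; rewrite /= linearD -mulrDl.
by rewrite ler_wpM2r ?ler_normD// ltW// charp_gt0.
Qed.

Lemma nrmB x f g : 4 <= x -> nrm x (f - g) <= nrm x f + nrm x g.
Proof. by move=> x4; rewrite -(nrmN x g) nrmD. Qed.

Lemma nrm_sum x (I : Type) (r : seq I) (P : pred I) (F : I -> {poly R}) : 4 <= x ->
  nrm x (\sum_(i <- r | P i) F i) <= \sum_(i <- r | P i) nrm x (F i).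
Proof.
move=> x4; apply: (big_ind2 (fun f b => nrm x f <= b)); rewrite ?nrm0//.
by move=> f a g b fa gb; apply: le_trans (nrmD f g x4) _; apply: lerD.
Qed.

Lemma nrm1 x : nrm x 1 = 1.
Proof.
rewrite /nrm size_polyC oner_eq0 big_ord_recl big_ord0 addr0 phi_1 horner_charp0.
by rewrite eqxx ger0_norm ?divr_ge0 ?ltW ?charp_lead_gt0// divfK ?charp_lead_neq0.
Qed.

Lemma nrm_charp x m : 4 <= x -> nrm x (p m) = (p m).[x].
Proof.
move=> x4; pose n := maxn (size (p m)) m.+1.
have mn : (m < n)%N by rewrite leq_max leqnn orbT.
rewrite (@nrmE n) ?leq_maxl// (bigD1 (Ordinal mn))//= phi_charp eqxx normr1 mul1r.
rewrite big1 ?addr0// => i; rewrite -val_eqE /= phi_charp => /negPf ->.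
by rewrite normr0 mul0r.
Qed.

Lemma phi_le x m f : 4 <= x -> `|phi m f| * (p m).[x] <= nrm x f.
Proof.
move=> x4; pose n := maxn (size f) m.+1.
have mn : (m < n)%N by rewrite leq_max leqnn orbT.
rewrite (@nrmE n) ?leq_maxl// (bigD1 (Ordinal mn))//= lerDl.
by apply: sumr_ge0 => i _; rewrite mulr_ge0// ltW// charp_gt0.
Qed.

Lemma normr_phi_le x m f : 4 <= x -> `|phi m f| <= nrm x f / (p m).[x].
Proof. by move=> x4; rewrite ler_pdivlMr ?charp_gt0// phi_le. Qed.

Lemma normr_mulX_coef a m : `|S a m| <= S (fun n => `|a n|) m.
Proof.
have h1 := charp_shift_gt0; have h2 := charp_lead_gt0.
have n2 b : `|2 * b| = 2 * `|b| by rewrite normrM ger0_norm.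
have nd b : `|d0 * b| = d0 * `|b| by rewrite normrM (ger0_norm (ltW h1)).
have nc b : `|c0 * b| = c0 * `|b| by rewrite normrM (ger0_norm (ltW h2)).
case: m => [|[|m]] /=.
- by rewrite -nd ler_normD.
- by rewrite -nc -n2 (le_trans (ler_normD _ _))// lerD2r ler_normD.
- by rewrite -n2 (le_trans (ler_normD _ _))// lerD2r ler_normD.
Qed.

(** The absolute values of the coefficients of [f] define a polynomial with
    the same norm, equal to its value at [x]; multiplication by the variable
    is then exact. *)
Lemma nrm_mulX x f : 4 <= x -> nrm x ('X * f) <= x * nrm x f.
Proof.
move=> x4; pose n := size f.
pose g := \sum_(m < n) `|phi m f| *: p m.
have phig m : phi m g = `|phi m f|.
  rewrite /g (phi_sum_charp n (fun i => `|phi i f|)); case: ltnP => // nm.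
  by rewrite phi_size ?normr0.
have gx : g.[x] = nrm x f.
  by rewrite horner_sum; apply: eq_bigr => m _; rewrite hornerZ.
pose N := maxn (size ('X * f)) (size ('X * g)).
rewrite (@nrmE N) ?leq_maxl// -gx -{2}(hornerX x) -hornerM.
rewrite (@horner_expand N) ?leq_maxr//; apply: ler_sum => m _.
apply: ler_wpM2r; first by rewrite ltW// charp_gt0.
rewrite !phi_mulX (eq_mulX_coef phig); exact: (normr_mulX_coef (phi^~ f) m).
Qed.

(** Linear factor with value [1] at [a] and [0] at [t]. *)
Definition lfactor (a t : R) : {poly R} := (t - a)^-1 *: (t%:P - 'X).

Lemma horner_lfactor a t x : (lfactor a t).[x] = (t - x) / (t - a).
Proof. by rewrite hornerZ hornerD hornerN hornerX hornerC mulrC. Qed.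

Lemma mul_lfactor a t f : lfactor a t * f = (t - a)^-1 *: ((t%:P - 'X) * f).
Proof. by rewrite /lfactor -scalerAl. Qed.

Lemma nrm_lfactor x a t f : 4 <= x -> 0 <= t ->
  nrm x (lfactor a t * f) <= (t + x) / `|t - a| * nrm x f.
Proof.
move=> x4 t0; rewrite mul_lfactor nrmZ normfV -mulrA mulrCA ler_wpM2l ?invr_ge0//.
rewrite mulrBl (le_trans (nrmB _ _ x4))// mulrDl lerD ?nrm_mulX//.
by rewrite mul_polyC nrmZ ger0_norm.
Qed.

Lemma nrm_lfactor_lower x a t f : 4 <= x -> 0 <= t ->
  (t - x) / `|t - a| * nrm x f <= nrm x (lfactor a t * f).
Proof.
move=> x4 t0; rewrite mul_lfactor nrmZ normfV -mulrA mulrCA ler_wpM2l ?invr_ge0//.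
have := nrmD ((t%:P - 'X) * f) ('X * f) x4.
rewrite -mulrDl subrK mul_polyC nrmZ (ger0_norm t0).
by have := nrm_mulX f x4; lra.
Qed.

(** The factor is [1] up to a term of order [1 / t]. *)
Lemma nrm_lfactor_sub x a t f : 4 <= x -> 0 <= a -> t != a ->
  nrm x (lfactor a t * f - f) <= (x + a) / `|t - a| * nrm x f.
Proof.
move=> x4 a0 ta.
have -> : lfactor a t * f - f = (t - a)^-1 *: ((a%:P - 'X) * f).
  rewrite mul_lfactor -{2}[f]scale1r -(@mulVf _ (t - a)) ?subr_eq0//.
  rewrite -scalerA -scalerBr -(mul_polyC (t - a)) -mulrBl; congr (_ *: (_ * _)).
by rewrite polyCB opprB [LHS]addrC addrA subrK.
rewrite nrmZ normfV -mulrA mulrCA ler_wpM2l ?invr_ge0//.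
rewrite mulrBl (le_trans (nrmB _ _ x4))// mulrDl addrC lerD ?nrm_mulX//.
by rewrite mul_polyC nrmZ ger0_norm.
Qed.

End CharPoly.

(** * Nodes *)

Section Nodes.
Variable (R : realType).
Implicit Types (z : R) (G : bcd_type).

Definition symval z : R := z + 2 + z^-1.

(** The recurrence is solved by sequences of this shape; [K], [A] and the sign
    [e] are determined by the two initial values, which treats the three types
    together. *)
Lemma charp_explicit G (K A e z : R) m : z != 0 -> A != 0 ->
  K * (A + e * A^-1) = charp_lead R G ->
  K * (A * z + e * (A * z)^-1) = symval z - charp_shift R G ->
  (charp R G m).[symval z] = K * (A * z ^+ m + e * (A * z ^+ m)^-1).
Proof.
move=> z0 A0 h0 h1.
suff h : (charp R G m).[symval z] = K * (A * z ^+ m + e * (A * z ^+ m)^-1) /\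
    (charp R G m.+1).[symval z] = K * (A * z ^+ m.+1 + e * (A * z ^+ m.+1)^-1).
  by case: h.
elim: m => [|m [IH1 IH2]].
  by rewrite horner_charp0 horner_charp1 expr0 expr1 mulr1 h0 h1.
split=> //; rewrite horner_charpSS IH1 IH2 /symval.
have zz : z * z^-1 = 1 by rewrite mulfV.
rewrite !exprS !invfM; set u := z^-1 in zz *; set Y := (z ^+ m)^-1; set X := z ^+ m.
set B := A^-1.
have -> : (z + 2 + u - 2) * (K * (A * (z * X) + e * (B * (u * Y)))) =
  K * (A * z * (z * X) + e * (z * u) * B * Y + A * (z * u) * X + e * B * u * (u * Y)).
  by lra.
by rewrite zz; lra.
Qed.

Lemma char_entryE G m z : 0 < z -> z != 1 ->
  char_entry G m z = (charp R G m).[symval z].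
Proof.
move=> z0 z1; have zn0 : z != 0 by rewrite gt_eqF.
have zz : z * z^-1 = 1 by rewrite mulfV.
have zzn : z - z^-1 != 0.
  apply/eqP => h; move: z1.
  by rewrite -(sqrp_eq1 (ltW z0)) expr2 {2}(subr0_eq h) zz eqxx.
case: G => /=.
- set w := z `^ 2^-1.
  have w0 : 0 < w by rewrite powR_gt0.
  have wn0 : w != 0 by rewrite gt_eqF.
  have ww : w * w = z.
    rewrite -powRD; last by rewrite zn0 implybT.
    have -> : 2^-1 + 2^-1 = 1 :> R by lra.
    by rewrite powRr1// ltW.
  have wV : w * w^-1 = 1 by rewrite mulfV.
  have wwn : w - w^-1 != 0.
    apply/eqP => h; move: z1; rewrite -ww.
    by rewrite {2}(subr0_eq h) wV eqxx.
  rewrite !powRN.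
  have -> : z `^ (m%:R + 2^-1) = w * z ^+ m.
    rewrite powRD; last by rewrite zn0 implybT.
    by rewrite powR_mulrn ?ltW// mulrC.
  rewrite (@charp_explicit _ (w - w^-1)^-1 w (-1))//.
  + by rewrite mulrC mulN1r.
  + by rewrite mulN1r mulVf.
  + rewrite /symval /= -ww; apply: (mulfI wwn); rewrite mulVKf//.
    rewrite !invfM; set v := w^-1 in wV *.
    have -> : (w - v) * (w * w + 2 + v * v - 1) =
      w * (w * w) + (w - v) - w * (w * v) + v * (w * v) - v * (v * v) by lra.
    by rewrite wV; lra.
- rewrite (@charp_explicit _ (z - z^-1)^-1 z (-1))//.
  + by rewrite mulrC mulN1r exprS.
  + by rewrite mulN1r mulVf.
  + rewrite /symval /=; apply: (mulfI zzn); rewrite mulVKf//.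
    by rewrite !invfM; lra.
- rewrite (@charp_explicit _ 1 1 1) ?oner_neq0//.
  + by rewrite !mul1r.
  + by rewrite invr1 /=; lra.
  + by rewrite /symval /= !mul1r; lra.
Qed.

End Nodes.

Section QNodes.
Variables (R : realType) (G : bcd_type) (q : R).
Hypotheses (q_gt0 : 0 < q) (q_lt1 : q < 1).
Notation eps := (epsilon R G).
Notation p := (charp R G).

Definition qnode (n : nat) : R := q `^ (n%:R + eps).
Definition node (n : nat) : R := symval (qnode n).

Lemma qpow_neq0 : q != 0. Proof. by rewrite gt_eqF. Qed.

Lemma epsilon_ge0 : 0 <= eps.
Proof. by case: G => //=; rewrite ?invr_ge0. Qed.

Lemma qnodeD n m : qnode (n + m) = q ^+ m * qnode n.
Proof.
rewrite /qnode -powR_mulrn ?ltW// -powRD; last by rewrite qpow_neq0 implybT.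
by rewrite natrD addrA [m%:R + _]addrC.
Qed.

Lemma qnode_gt0 n : 0 < qnode n. Proof. exact: powR_gt0. Qed.

Lemma qnode_le1 n : qnode n <= 1.
Proof.
rewrite -(powRr0 q); apply: ger_powR; first by rewrite q_gt0 ltW.
by rewrite addr_ge0// epsilon_ge0.
Qed.

Lemma qnode_le_exp n : qnode n <= q ^+ n.
Proof. by rewrite -(add0n n) qnodeD ler_piMr ?qnode_le1// exprn_ge0// ltW. Qed.

Lemma qexp_le1 n : q ^+ n <= 1. Proof. by rewrite exprn_ile1 ?ltW. Qed.
Lemma qexp_ge0 n : 0 <= q ^+ n. Proof. by rewrite exprn_ge0// ltW. Qed.
Lemma qexp_gt0 n : 0 < q ^+ n. Proof. by rewrite exprn_gt0. Qed.
Lemma qexp_lt1 n : (0 < n)%N -> q ^+ n < 1.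
Proof. by move=> n0; rewrite exprn_ilt1 ?ltW//; lia. Qed.

Lemma symval_ge4 (z : R) : 0 < z -> 4 <= symval z.
Proof.
move=> z0; have zz : z * z^-1 = 1 by rewrite mulfV// gt_eqF.
rewrite /symval -(ler_pM2l z0) !mulrDr zz.
by have := sqr_ge0 (z - 1); rewrite expr2; lra.
Qed.

Lemma node_ge4 n : 4 <= node n. Proof. by apply: symval_ge4; exact: qnode_gt0. Qed.

Lemma node_gt0 n : 0 < node n. Proof. by have := node_ge4 n; lra. Qed.
Lemma node_ge0 n : 0 <= node n. Proof. by rewrite ltW// node_gt0. Qed.
(** Nodes are separated geometrically. With [z = qnode a] and [d = q ^+ (b -
    a)], multiplication by [d * z] turns the claim into a polynomial
    inequality. *)
Lemma node_diff a b : (a < b)%N ->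
  node b * (1 - q ^+ (b - a)) ^+ 4 <= node b - node a.
Proof.
move=> ab; rewrite /node /symval.
have -> : qnode b = q ^+ (b - a) * qnode a by rewrite -qnodeD subnKC// ltnW.
have d1 : q ^+ (b - a) < 1 by rewrite qexp_lt1// subn_gt0.
have d0 := qexp_gt0 (b - a).
have z0 := qnode_gt0 a; have z1 := qnode_le1 a.
set d := q ^+ _ in d0 d1 *; set z := qnode a in z0 z1 *.
have zz : z * z^-1 = 1 by rewrite mulfV// gt_eqF.
have dd : d * d^-1 = 1 by rewrite mulfV// gt_eqF.
rewrite !invfM -(ler_pM2l (mulr_gt0 d0 z0)).
set u := z^-1 in zz *; set e := d^-1 in dd *.
have -> : d * z * ((d * z + 2 + e * u) * (1 - d) ^+ 4) =
   ((d * z) ^+ 2 + 2 * (d * z) + (d * e) * (z * u)) * (1 - d) ^+ 4 by lra.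
have -> : d * z * (d * z + 2 + e * u - (z + 2 + u)) =
   (d * z) ^+ 2 + (d * e) * (z * u) - d * z ^+ 2 - d * (z * u) by lra.
rewrite zz dd !mulr1.
have -> : (d * z) ^+ 2 + 2 * (d * z) + 1 = (1 + d * z) ^+ 2 by lra.
have -> : (d * z) ^+ 2 + 1 - d * z ^+ 2 - d = (1 - d) * (1 - d * z ^+ 2) by lra.
have h1 : (1 + d * z) * (1 - d) <= 1 by nra.
have h2 : 0 <= (1 + d * z) * (1 - d) by rewrite mulr_ge0//; nra.
have -> : (1 + d * z) ^+ 2 * (1 - d) ^+ 4 =
   (((1 + d * z) * (1 - d)) ^+ 2 * (1 - d)) * (1 - d) by lra.
rewrite mulrC ler_pM2l ?subr_gt0//.
have h3 : ((1 + d * z) * (1 - d)) ^+ 2 <= 1 by rewrite exprn_ile1.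
have h4 : z ^+ 2 <= 1 by rewrite exprn_ile1// ltW.
by apply: (@le_trans _ _ (1 - d)); nra.
Qed.

Lemma node_ltn a b : (a < b)%N -> node a < node b.
Proof.
move=> ab; rewrite -subr_gt0; apply: lt_le_trans (node_diff ab).
rewrite mulr_gt0 ?node_gt0// exprn_gt0// subr_gt0 qexp_lt1// subn_gt0//.
Qed.

Lemma node_leq a b : (a <= b)%N -> node a <= node b.
Proof. by rewrite leq_eqVlt => /orP[/eqP->//|/node_ltn/ltW]. Qed.

Lemma node_inj : injective node.
Proof.
move=> a b e; case: (ltngtP a b) => // /node_ltn; by rewrite e ltxx.
Qed.

Lemma node_ratio a b : (a <= b)%N -> node a <= 4 * q ^+ (b - a) * node b.
Proof.
move=> ab; rewrite /node /symval.
have -> : qnode b = q ^+ (b - a) * qnode a by rewrite -qnodeD subnKC.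
have d0 := qexp_gt0 (b - a); have d1 := qexp_le1 (b - a).
have z0 := qnode_gt0 a; have z1 := qnode_le1 a.
set d := q ^+ _ in d0 d1 *; set z := qnode a in z0 z1 *.
have zz : z * z^-1 = 1 by rewrite mulfV// gt_eqF.
have dd : d * d^-1 = 1 by rewrite mulfV// gt_eqF.
rewrite !invfM -(ler_pM2l z0).
set u := z^-1 in zz *; set e := d^-1 in dd *.
have -> : z * (4 * d * (d * z + 2 + e * u)) =
   4 * ((d * z) ^+ 2 + 2 * (d * z) + (d * e) * (z * u)) by lra.
have -> : z * (z + 2 + u) = z ^+ 2 + 2 * z + z * u by lra.
have h4 : z ^+ 2 <= 1 by rewrite exprn_ile1// ltW.
rewrite zz dd mulr1.
have := sqr_ge0 (d * z); have : 0 <= d * z by rewrite mulr_ge0 ?ltW.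
lra.
Qed.

Lemma node_inv_le n : (node n)^-1 <= q ^+ n.
Proof.
rewrite -[leRHS]invrK lef_pV2 ?posrE ?invr_gt0 ?qexp_gt0 ?node_gt0//.
rewrite /node /symval; apply: (@le_trans _ _ (qnode n)^-1).
  by rewrite lef_pV2 ?posrE ?qexp_gt0 ?qnode_gt0// qnode_le_exp.
by rewrite lerDr addr_ge0// ltW// qnode_gt0.
Qed.

(** ** Self-duality *)

(** Up to a factor which depends on [j] only, this is the value of [charp m]
    at [node j]; it is symmetric. *)
Definition dual_kernel (m j : nat) : R :=
  let Q := q `^ ((m%:R + eps) * (j%:R + eps)) in
  match G with TypeD => Q + Q^-1 | _ => Q - Q^-1 end.

Lemma dual_kernelC m j : dual_kernel m j = dual_kernel j m.
Proof. by rewrite /dual_kernel mulrC. Qed.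

Lemma qpow_inv_neq (r : R) : 0 < r -> q `^ r - (q `^ r)^-1 != 0.
Proof.
move=> r0; rewrite lt_eqF// subr_lt0.
have h : q `^ r < 1.
  have -> : 1 = 1 `^ r :> R by rewrite powR1.
  by apply: gt0_ltr_powR => //; rewrite nnegrE ?ler01// ltW.
by apply: (lt_trans h); rewrite invf_gt1// powR_gt0.
Qed.

Lemma charp_node m j : (p m).[node j] =
  dual_kernel m j / match G with TypeD => 1 | _ => dual_kernel 0 j end.
Proof.
rewrite /node; set z := qnode j.
have z0 : 0 < z by exact: qnode_gt0.
have zn0 : z != 0 by rewrite gt_eqF.
pose A := q `^ (eps * (j%:R + eps)).
have A0 : 0 < A by exact: powR_gt0.
have QE : q `^ ((m%:R + eps) * (j%:R + eps)) = A * z ^+ m.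
  have h : q `^ (m%:R * (j%:R + eps)) = z ^+ m.
    by rewrite mulrC powRrM powR_mulrn// ltW.
  rewrite mulrDl powRD; last by rewrite qpow_neq0 implybT.
  by rewrite h mulrC.
have Q0E : q `^ ((0%:R + eps) * (j%:R + eps)) = A by rewrite add0r.
rewrite /dual_kernel QE Q0E {Q0E QE}.
have AE : A = q `^ (eps * (j%:R + eps)) by [].
have zE : z = q `^ (j%:R + eps) by [].
move: A z A0 z0 zn0 AE zE => A z A0 z0 zn0; case: (G) => AE zE.
- have Az : A * A = z.
    rewrite AE zE -powRD; last by rewrite qpow_neq0 implybT.
    by rewrite -mulrDl /=; congr (q `^ _); lra.
  have AV : A * A^-1 = 1 by rewrite mulfV ?gt_eqF.
  have AA : A - A^-1 != 0.
    have h12 : 0 < 2^-1 :> R by rewrite invr_gt0.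
    have hj : 0 < j%:R + 2^-1 :> R by rewrite ltr_wpDl.
    by rewrite AE qpow_inv_neq//= mulr_gt0.
  rewrite (@charp_explicit _ _ (A - A^-1)^-1 A (-1)) ?gt_eqF//.
  + by rewrite mulrC mulN1r.
  + by rewrite mulN1r mulVf.
  + rewrite /symval /= -Az; apply: (mulfI AA); rewrite mulVKf//.
    rewrite !invfM; set v := A^-1 in AV *.
    have -> : (A - v) * (A * A + 2 + v * v - 1) =
      A * (A * A) + (A - v) - A * (A * v) + v * (A * v) - v * (v * v) by lra.
    by rewrite AV; lra.
- have Az : A = z by rewrite AE zE mul1r.
  have zz : z * z^-1 = 1 by rewrite mulfV.
  have zzn : z - z^-1 != 0.
    by rewrite zE qpow_inv_neq//= ltr_wpDl.
  rewrite Az (@charp_explicit _ _ (z - z^-1)^-1 z (-1))//.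
  + by rewrite mulrC mulN1r.
  + by rewrite mulN1r mulVf.
  + rewrite /symval /=; apply: (mulfI zzn); rewrite mulVKf//.
    by rewrite !invfM; lra.
- have -> : A = 1 by rewrite AE mul0r powRr0.
  rewrite (@charp_explicit _ _ 1 1 1) ?oner_neq0//.
  + by rewrite !mul1r divr1.
  + by rewrite invr1 /=; lra.
  + by rewrite /symval /= !mul1r; lra.
Qed.

(** The exponents [n + epsilon] of the nodes are those of the entries of the
    determinants, whence a symmetry between index and argument. *)
Lemma charp_dual l j :
  (p l).[node j] * (p j).[node 0] = (p j).[node l] * (p l).[node 0].
Proof.
rewrite !charp_node (dual_kernelC j l).
have h k : dual_kernel 0 k = dual_kernel k 0 by rewrite dual_kernelC.
have hn k : match G with TypeD => 1 | _ => dual_kernel 0 k end != 0.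
  have e1 : match G with TypeD => True | _ => 0 < eps end.
    by case: G => //=; rewrite invr_gt0.
  move: e1; rewrite /dual_kernel; case: (G) => e1; rewrite ?oner_neq0//.
  - by apply: qpow_inv_neq; rewrite add0r mulr_gt0// ltr_wpDl.
  - by apply: qpow_inv_neq; rewrite add0r mulr_gt0// ltr_wpDl.
rewrite -(h j) -(h l); move: (hn j) (hn l) (hn 0%N) => {hn}.
rewrite /dual_kernel; case: (G) => hj hl h0.
- by rewrite -!mulrA !mulKf.
- by rewrite -!mulrA !mulKf.
- by rewrite /= !add0r !mul0r powRr0.
Qed.

Lemma charp_dual_div l j :
  (p l).[node j] / (p l).[node 0] = (p j).[node l] / (p j).[node 0].
Proof.
have n0 k : (p k).[node 0] != 0 by rewrite gt_eqF// charp_gt0// node_ge4.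
by apply/eqP; rewrite eqr_div// charp_dual mulrC [X in _ == X]mulrC mulrC.
Qed.

End QNodes.

(** * Interpolation at the nodes *)

Definition increasing (N : nat) (L : nat -> nat) :=
  forall r r' : nat, (r < r')%N -> (r' < N)%N -> (L r < L r')%N.

Lemma increasing_sub N L (r r' : nat) : increasing N L ->
  (r <= r')%N -> (r' < N)%N -> (L r + (r' - r) <= L r')%N.
Proof.
move=> Li; elim: r' => [|r' IH] rr rN.
  by rewrite leqn0 in rr; rewrite (eqP rr) subn0 addn0.
rewrite leq_eqVlt in rr; case/orP: rr => [/eqP->|rr].
  by rewrite subnn addn0.
have := IH rr (ltnW rN); have := Li r' r'.+1 (leqnn _) rN.
by rewrite subSn//; lia.
Qed.

Lemma increasing_ge N L r : increasing N L -> (r < N)%N -> (r <= L r)%N.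
Proof. by move=> Li rN; have := increasing_sub Li (leq0n r) rN; lia. Qed.

Lemma increasing_leq N L (r r' : nat) : increasing N L ->
  (r <= r')%N -> (r' < N)%N -> (L r <= L r')%N.
Proof. by move=> Li rr rN; have := increasing_sub Li rr rN; lia. Qed.

Lemma increasing_inj N L (r r' : nat) : increasing N L ->
  (r < N)%N -> (r' < N)%N -> L r = L r' -> r = r'.
Proof.
move=> Li rN rN' e; case: (ltngtP r r') => // h.
  by have := Li _ _ h rN'; rewrite e ltnn.
by have := Li _ _ h rN; rewrite e ltnn.
Qed.

Lemma increasing_le N N' L : (N' <= N)%N -> increasing N L -> increasing N' L.
Proof. by move=> NN Li r r' rr rN; apply: Li => //; apply: leq_trans NN. Qed.

Section Interpolation.
Variables (R : realType) (G : bcd_type) (q : R).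
Hypotheses (q_gt0 : 0 < q) (q_lt1 : q < 1).
Notation p := (charp R G).
Notation node := (node G q).
Notation phi := (@phi R G).

Lemma charp_node0_gt0 m : 0 < (p m).[node 0].
Proof. by rewrite charp_gt0// node_ge4. Qed.

Lemma charp_node0_neq0 m : (p m).[node 0] != 0.
Proof. by rewrite gt_eqF// charp_node0_gt0. Qed.

Lemma lfactor_self (a t : R) : t != a -> (lfactor a t).[a] = 1.
Proof. by move=> ta; rewrite horner_lfactor divff// subr_eq0. Qed.

Lemma lfactor_root (a t : R) : (lfactor a t).[t] = 0.
Proof. by rewrite horner_lfactor subrr mul0r. Qed.

Lemma size_lfactor (a t : R) : (size (lfactor a t) <= 2)%N.
Proof.
rewrite (leq_trans (size_scale_leq _ _))//.
by rewrite -opprB size_polyN size_XsubC.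
Qed.

Definition node_lagrange (N : nat) (L : nat -> nat) (r : nat) : {poly R} :=
  \prod_(0 <= r' < N | r' != r) lfactor (node (L r)) (node (L r')).

Lemma node_neq N L r r' : increasing N L -> (r < N)%N -> (r' < N)%N ->
  r' != r -> node (L r') != node (L r).
Proof.
move=> Li rN rN' /negP rr; apply/eqP => /(node_inj q_gt0 q_lt1) e.
by apply: rr; rewrite (increasing_inj Li rN' rN e).
Qed.

Lemma node_lagrange_node N L r i : increasing N L -> (r < N)%N -> (i < N)%N ->
  (node_lagrange N L r).[node (L i)] = (i == r)%:R.
Proof.
move=> Li rN iN; rewrite horner_prod; have [->|ir] := eqVneq i r.
  rewrite big_nat_cond big1// => r' /andP[rN' rr].
  by rewrite lfactor_self// (node_neq Li).
by rewrite (big_rem i) ?mem_index_iota//= ir lfactor_root mul0r.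
Qed.

Lemma size_node_lagrange N L r : (r < N)%N -> (size (node_lagrange N L r) <= N)%N.
Proof.
move=> rN; rewrite /node_lagrange big_mkord.
pose F (i : 'I_N) := lfactor (node (L r)) (node (L i)).
apply: leq_trans (size_poly_prod_leq _ _) _.
have h : (\sum_(i < N | (i : nat) != r) size (F i) <= \sum_(i < N | (i : nat) != r) 2)%N.
  by apply: leq_sum => i _; exact: size_lfactor.
have hc : #|[pred i : 'I_N | (i : nat) != r]| = N.-1.
  have := cardC (pred1 (Ordinal rN)); rewrite card1 card_ord => e.
  rewrite -(@eq_card _ [predC pred1 (Ordinal rN)]).
    exact: (congr1 predn e).
  by move=> i; rewrite !inE -val_eqE.
move: h; rewrite sum_nat_const hc /F; set s := (\sum_(_ | _) _)%N; lia.
Qed.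

Lemma node_lagrange_biorth1 N L (r i : 'I_N) : increasing N L ->
  \sum_(j < N) phi j (node_lagrange N L r) * (p j).[node (L i)] = (r == i)%:R.
Proof.
move=> Li; rewrite -horner_expand ?size_node_lagrange// node_lagrange_node//.
by rewrite eq_sym.
Qed.

(** A left inverse of a square matrix is a right inverse. *)
Lemma node_lagrange_biorth2 N L (j j' : 'I_N) : increasing N L ->
  \sum_(r < N) phi j (node_lagrange N L r) * (p j').[node (L r)] = (j == j')%:R.
Proof.
move=> Li.
pose B : 'M[R]_N := \matrix_(r, j) phi j (node_lagrange N L r).
pose C : 'M[R]_N := \matrix_(j, i) (p j).[node (L i)].
have BC : B *m C = 1%:M.
  apply/matrixP => r i; rewrite !mxE -(node_lagrange_biorth1 _ _ Li).
  by apply: eq_bigr => l _; rewrite !mxE.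
have /matrixP /(_ j' j) := mulmx1C BC.
rewrite !mxE eq_sym => <-; apply: eq_bigr => r _.
by rewrite !mxE mulrC.
Qed.

(** Dual basis, to evaluation at the first [N] nodes, of the span of the
    [p (L r)]. *)
Definition gpoly (N : nat) (L : nat -> nat) (j : nat) : {poly R} :=
  (p j).[node 0] *:
    \sum_(r < N) (phi j (node_lagrange N L r) / (p (L r)).[node 0]) *: p (L r).

Lemma gpolyE N L j : gpoly N L j = (p j).[node 0] *:
    \sum_(r < N) (phi j (node_lagrange N L r) / (p (L r)).[node 0]) *: p (L r).
Proof. by []. Qed.

(** Self-duality turns the values of [p (L r)] at [node i] into those of [p i]
    at [node (L r)], to which [node_lagrange_biorth2] applies. *)
Lemma gpoly_node N L (j i : nat) : increasing N L -> (j < N)%N -> (i < N)%N ->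
  (gpoly N L j).[node i] = (i == j)%:R.
Proof.
move=> Li jN iN; rewrite hornerZ horner_sum.
under eq_bigr => r _.
  rewrite hornerZ -mulrA [_^-1 * _]mulrC charp_dual_div// mulrA.
  over.
rewrite -mulr_suml (node_lagrange_biorth2 (Ordinal jN) (Ordinal iN) Li).
rewrite -val_eqE /= [j == i]eq_sym.
have [->|ij] := eqVneq i j; last by rewrite mul0r mulr0.
by rewrite mul1r mulfV// charp_node0_neq0.
Qed.

Lemma gpoly_interp N L (r : nat) (x : R) : increasing N L -> (r < N)%N ->
  \sum_(j < N) (p (L r)).[node j] * (gpoly N L j).[x] = (p (L r)).[x].
Proof.
move=> Li rN.
transitivity (\sum_(i < N) (\sum_(j < N) phi j (node_lagrange N L i) * (p j).[node (L r)])
   * ((p (L r)).[node 0] / (p (L i)).[node 0] * (p (L i)).[x])).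
  under [RHS]eq_bigr do rewrite mulr_suml.
  rewrite exchange_big /=; apply: eq_bigr => j _.
  rewrite hornerZ horner_sum !mulr_sumr; apply: eq_bigr => i _.
  rewrite hornerZ mulrA charp_dual//.
  set a := (p j).[_]; set b := (p _).[node 0]; set c := phi _ _.
  by lra.
rewrite (bigD1 (Ordinal rN))//= (node_lagrange_biorth1 (Ordinal rN) (Ordinal rN))//.
rewrite eqxx mul1r divff ?charp_node0_neq0// mul1r big1 ?addr0// => i ir.
by rewrite (node_lagrange_biorth1 i (Ordinal rN))// (negPf ir) mul0r.
Qed.

Definition hden (j m n : nat) : {poly R} :=
  \prod_(m <= i < n) lfactor (node j) (node i).

Lemma hden_prod j m n : hden j m n = \prod_(m <= i < n) lfactor (node j) (node i).
Proof. by []. Qed.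

(** The division is exact by [hpolyM], as [gpoly N L j] vanishes at the nodes
    of indices [k], ..., [N - 1]. *)
Definition hpoly (N : nat) (L : nat -> nat) (k j : nat) : {poly R} :=
  gpoly N L j %/ hden j k N.

Lemma hdenE (j m n : nat) : (j < m)%N ->
  exists2 c, c != 0 & hden j m n = c *: \prod_(i <- [seq node i | i <- index_iota m n]) ('X - i%:P).
Proof.
move=> jm; exists (\prod_(m <= i < n) - (node i - node j)^-1).
  rewrite big_nat prodf_seq_neq0; apply/allP => l _; apply/implyP => /andP[ml _].
  rewrite oppr_eq0 invr_eq0 subr_eq0.
  by apply/eqP => /(node_inj q_gt0 q_lt1) e; lia.
rewrite big_map -scaler_prod; apply: eq_bigr => i _.
by rewrite scaleNr -scalerN opprB.
Qed.

Lemma hpolyM N L (k j : nat) : increasing N L -> (j < k)%N -> (k <= N)%N ->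
  hpoly N L k j * hden j k N = gpoly N L j.
Proof.
move=> Li jk kN; apply: divpK.
have [c c0 ->] := hdenE N jk; rewrite dvdpZl//.
apply: uniq_roots_dvdp.
  apply/allP => x /mapP [i]; rewrite mem_index_iota => /andP[ki iN] ->.
  rewrite rootE gpoly_node// ?(leq_trans jk)//.
  by rewrite gtn_eqF ?eqxx// (leq_trans jk).
rewrite uniq_rootsE map_inj_uniq ?iota_uniq//; exact: node_inj.
Qed.

End Interpolation.

(** * Bounds for the dual bases *)

Section Bounds.
Variables (R : realType) (G : bcd_type) (q : R).
Hypotheses (q_gt0 : 0 < q) (q_lt1 : q < 1).
Notation p := (charp R G).
Notation node := (node G q).
Notation phi := (@phi R G).
Notation nrm := (@nrm R G).
Notation lag := (node_lagrange G q).
Notation gpoly := (gpoly G q).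
Local Ltac qlra := move: q_gt0 q_lt1; lra.

Let node4 := node_ge4 G q_gt0.
Let nodegt := node_gt0 G q_gt0.
Let node0le := node_ge0 G q_gt0.

Definition qconst : R := s2val (cid2 (qprod_lower q_gt0 q_lt1)).

Lemma qconst_gt0 : 0 < qconst.
Proof. by rewrite /qconst; case: cid2 => c /= /andP[]. Qed.

Lemma qconst_le n : qconst <= \prod_(1 <= i < n) (1 - q ^+ i).
Proof. by rewrite /qconst; case: cid2 => c /= _. Qed.

Lemma onem_qexp_ge0 i : 0 <= 1 - q ^+ i.
Proof. by rewrite subr_ge0 qexp_le1. Qed.

Lemma onem_qexp_le1 i : 1 - q ^+ i <= 1.
Proof. by rewrite lerBlDr lerDl qexp_ge0. Qed.

Lemma onem_qexp_gt0 i : (0 < i)%N -> 0 < 1 - q ^+ i.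
Proof. by move=> i0; rewrite subr_gt0 qexp_lt1. Qed.

Lemma qconst_le_left r : qconst <= \prod_(0 <= i < r) (1 - q ^+ (r - i)).
Proof.
rewrite big_nat_rev /= add0n; apply: le_trans (qconst_le r.+1) _.
rewrite big_add1 /= big_nat [leRHS]big_nat le_eqVlt; apply/orP; left; apply/eqP.
by apply: eq_bigr => i /andP[_ ir]; rewrite subKn.
Qed.

Lemma qconst_le_right b m n : (b < m)%N ->
  qconst <= \prod_(m <= i < n) (1 - q ^+ (i - b)).
Proof.
move=> bm; have [nm|mn] := leqP n m.
  by rewrite big_geq//; apply: le_trans (qconst_le 0) _; rewrite big_geq.
have -> : \prod_(m <= i < n) (1 - q ^+ (i - b)) = \prod_(m - b <= i < n - b) (1 - q ^+ i).
  rewrite -{1}(subnK (ltnW bm)) big_addn; apply: eq_bigr => i _.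
  by rewrite addnK.
apply: le_trans (qconst_le (n - b)) _.
rewrite (@big_cat_nat _ _ _ (m - b))//=; [|lia|lia].
rewrite ler_piMl//.
  by apply: prodr_ge0 => i _; exact: onem_qexp_ge0.
by apply: prodr_ile1 => i _; rewrite onem_qexp_ge0 onem_qexp_le1.
Qed.

Lemma prod_inv4 (I : eqType) (r : seq I) (F : I -> R) :
  qconst <= \prod_(i <- r) F i -> \prod_(i <- r) (F i ^+ 4)^-1 <= (qconst ^+ 4)^-1.
Proof.
move=> h; have h0 := lt_le_trans qconst_gt0 h.
rewrite prodfV prodrXl lef_pV2 ?posrE ?exprn_gt0 ?qconst_gt0//.
by rewrite lerXn2r ?nnegrE// ltW// qconst_gt0.
Qed.

Definition lag_const : R := locked ((qconst ^- 4) ^+ 2).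

Lemma lag_constE : lag_const = qconst ^- 4 * qconst ^- 4.
Proof. by rewrite /lag_const -lock expr2. Qed.

Lemma lag_const_ge0 : 0 <= lag_const.
Proof.
by rewrite lag_constE mulr_ge0// invr_ge0 exprn_ge0// ltW// qconst_gt0.
Qed.

Section FixedSet.
Variables (N : nat) (L : nat -> nat).
Hypothesis Linc : increasing N L.

(** [lratio r] is what remains of the nodes below [L r] in the Lagrange
    polynomial at [L r]; it decays superexponentially. *)
Definition lratio (r : nat) : R := \prod_(0 <= i < r) (node (L i) / node (L r)).

Lemma ratio_ge0 r : 0 <= lratio r.
Proof. by apply: prodr_ge0 => i _; rewrite divr_ge0. Qed.

Lemma node_gap a b : (a < b)%N ->
  node b / `|node b - node a| <= ((1 - q ^+ (b - a)) ^+ 4)^-1.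
Proof.
move=> ab; have h := node_diff G q_gt0 q_lt1 ab.
have hp : 0 < (1 - q ^+ (b - a)) ^+ 4 by rewrite exprn_gt0// onem_qexp_gt0// subn_gt0.
have hd : 0 < node b - node a by rewrite subr_gt0 node_ltn.
rewrite gtr0_norm// ler_pdivrMr// mulrC ler_pdivlMr//.
Qed.

Lemma inv4_le a b : (0 < a)%N -> (a <= b)%N ->
  ((1 - q ^+ b) ^+ 4)^-1 <= ((1 - q ^+ a) ^+ 4)^-1.
Proof.
move=> a0 ab; have b0 := leq_trans a0 ab.
rewrite lef_pV2 ?posrE ?exprn_gt0 ?onem_qexp_gt0//.
rewrite lerXn2r ?nnegrE ?onem_qexp_ge0// lerB//.
by apply: ler_wiXn2l => //; exact: ltW.
Qed.

(** A factor with [L i] above [L r] is at most [1 + x / node (L i)] up to the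
    factor of a convergent product; a factor with [L i] below [L r] gains
    moreover the ratio [node (L i) / node (L r)]. *)
Lemma nrm_lagrange x r : 4 <= x -> (r < N)%N ->
  nrm x (lag N L r) <= lag_const *
    \prod_(0 <= i < N) (1 + x / node (L i)) * lratio r.
Proof.
move=> x4 rN; have x0 : 0 <= x by lra.
have xt i : 0 <= x / node (L i) by rewrite divr_ge0.
apply: (@le_trans _ _ (\prod_(0 <= i < N | i != r)
    ((node (L i) + x) / `|node (L i) - node (L r)|))).
  apply: (big_rec2 (fun (b : R) f => nrm x f <= b)).
    by rewrite nrm1.
  move=> i b f _ h; apply: le_trans (nrm_lfactor _ _ _ x4 _) _ => //.
  by rewrite ler_wpM2l// divr_ge0// addr_ge0.
have -> : \prod_(0 <= i < N | i != r) ((node (L i) + x) / `|node (L i) - node (L r)|) =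
  \prod_(0 <= i < N | i != r) (1 + x / node (L i)) *
  \prod_(0 <= i < N | i != r) (node (L i) / `|node (L i) - node (L r)|).
  rewrite -big_split; apply: eq_bigr => i _ /=.
  by rewrite [RHS]mulrA [(1 + _) * _]mulrDl mul1r divfK ?gt_eqF.
rewrite [leRHS]mulrAC [leRHS]mulrC; apply: ler_pM.
- by apply: prodr_ge0 => i _; rewrite addr_ge0.
- by apply: prodr_ge0 => i _; rewrite divr_ge0.
- rewrite [leRHS](bigID (fun i => i != r)) /= ler_peMr//.
    by apply: prodr_ge0 => i _; rewrite addr_ge0.
  elim/big_rec : _ => // i y _ y1.
  by rewrite -[leLHS]mulr1 ler_pM// lerDl.
rewrite (@big_cat_nat _ _ _ r)//=; last exact: ltnW.
rewrite [X in X * _ <= _]/= [X in _ * X <= _]big_ltn_cond// eqxx /=.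
rewrite mulrC lag_constE -mulrA; apply: ler_pM.
- by apply: prodr_ge0 => i _; rewrite divr_ge0.
- by apply: prodr_ge0 => i _; rewrite divr_ge0.
- apply: le_trans (prod_inv4 (qconst_le_right N (leqnn r.+1))).
  rewrite big_mkcond big_nat [leRHS]big_nat; apply: ler_prod => i /andP[ri iN].
  rewrite gtn_eqF//= divr_ge0//=.
  apply: le_trans (node_gap (Linc ri iN)) _.
  by apply: inv4_le; [rewrite subn_gt0|have := increasing_sub Linc (ltnW ri) iN; lia].
- apply: (@le_trans _ _ (\prod_(0 <= i < r) (((1 - q ^+ (r - i)) ^+ 4)^-1 * (node (L i) / node (L r))))).
    rewrite big_mkcond big_nat [leRHS]big_nat; apply: ler_prod => i /andP[_ ir].
    rewrite ltn_eqF//= divr_ge0//=.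
    have -> : node (L i) / `|node (L i) - node (L r)| =
        node (L r) / `|node (L r) - node (L i)| * (node (L i) / node (L r)).
      by rewrite [RHS]mulrC [RHS]mulrA divfK ?gt_eqF// distrC.
    rewrite ler_wpM2r ?divr_ge0//.
    apply: le_trans (node_gap (Linc ir rN)) _.
    by apply: inv4_le; [rewrite subn_gt0|have := increasing_sub Linc (ltnW ir) rN; lia].
  rewrite big_split /= ler_wpM2r ?ratio_ge0//.
  exact: prod_inv4 (qconst_le_left r).
Qed.

Lemma ratio_le1 i j : (i < N)%N -> (j <= i)%N -> node (L j) / node (L i) <= 1.
Proof.
move=> iN ji; rewrite ler_pdivrMr// mul1r.
by apply: node_leq => //; exact: increasing_leq ji iN.
Qed.

Lemma ratio_le_prefix n r : (n <= r)%N -> (r < N)%N ->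
  lratio r <= \prod_(0 <= i < n) (node (L i) / node (L r)).
Proof.
move=> nr rN; rewrite /lratio (@big_cat_nat _ _ _ n)//= ler_piMr//.
  by apply: prodr_ge0 => i _; rewrite divr_ge0.
rewrite big_nat; apply: prodr_ile1 => i /andP[ni ir].
by rewrite divr_ge0//= ratio_le1// ltnW.
Qed.

Lemma ratio_le_geom r : (r < N)%N -> lratio r <= 4 * q ^+ r.
Proof.
move=> rN; case: r rN => [|r] rN.
  by rewrite /lratio big_geq// expr0; lra.
apply: le_trans (ratio_le_prefix (n := 1) _ rN) _ => //.
rewrite big_nat1 ler_pdivrMr//.
have h : (L 0 + r.+1 <= L r.+1)%N.
  by have := increasing_sub Linc (leq0n r.+1) rN; rewrite subn0.
apply: le_trans (node_ratio G q_gt0 q_lt1 (leq_trans (leq_addr _ _) h)) _.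
rewrite ler_wpM2r// ler_wpM2l//.
by apply: ler_wiXn2l; rewrite ?ltW//; lia.
Qed.

Lemma sum_ratio_le : \sum_(r < N) lratio r <= 4 / (1 - q).
Proof.
apply: (@le_trans _ _ (4 * \sum_(0 <= r < N) q ^+ r)).
  rewrite mulr_sumr big_mkord; apply: ler_sum => r _; exact: ratio_le_geom.
rewrite ler_wpM2l// (le_trans (sum_geom_le q_gt0 q_lt1 _ _))//.
by rewrite expr0 mul1r.
Qed.

Lemma prod_node_le x : 4 <= x ->
  \prod_(0 <= i < N) (1 + x / node (L i)) <= expR (x / (1 - q)).
Proof.
move=> x4; apply: le_trans (prod1D_le_expR _) _.
  by move=> i _; rewrite divr_ge0//; lra.
rewrite ler_expR; apply: (@le_trans _ _ (x * \sum_(0 <= i < N) q ^+ i)).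
  rewrite mulr_sumr big_nat [leRHS]big_nat; apply: ler_sum => i /andP[_ iN].
  rewrite ler_wpM2l//; first lra.
  apply: le_trans (node_inv_le G q_gt0 q_lt1 _) _.
  by apply: ler_wiXn2l; rewrite ?ltW// (increasing_ge Linc).
rewrite ler_wpM2l//; first lra.
by rewrite (le_trans (sum_geom_le q_gt0 q_lt1 _ _))// expr0 mul1r.
Qed.

Lemma nrm_gpoly x j : 4 <= x -> nrm x (gpoly N L j) <=
  (p j).[node 0] * \sum_(r < N) `|phi j (lag N L r)| * ((p (L r)).[x] / (p (L r)).[node 0]).
Proof.
move=> x4; rewrite nrmZ gtr0_norm ?charp_node0_gt0//.
apply: ler_wpM2l; first by rewrite ltW// charp_node0_gt0.
apply: le_trans (nrm_sum _ _ _ _ x4) _; apply: ler_sum => r _.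
rewrite nrmZ nrm_charp// normrM normfV (gtr0_norm (charp_node0_gt0 _ _ _))//.
by rewrite mulrAC mulrA.
Qed.

End FixedSet.

(** At [node 0] the values of the [p (L r)] cancel against their
    normalization, and [lratio] is summable. *)
Lemma nrm_gpoly0 j : exists C, forall N L, increasing N L ->
  nrm (node 0) (gpoly N L j) <= C.
Proof.
pose x := node 0.
exists ((p j).[x] * (lag_const * expR (x / (1 - q)) * (4 / (1 - q)))).
move=> N L Li; apply: le_trans (nrm_gpoly _ _ _ (node4 0)) _.
apply: ler_wpM2l; first by rewrite ltW// charp_node0_gt0.
apply: le_trans (ler_wpM2l _ (sum_ratio_le Li)); last first.
  by rewrite mulr_ge0 ?expR_ge0 ?lag_const_ge0.
rewrite mulr_sumr; apply: ler_sum => r _.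
rewrite divff ?charp_node0_neq0// mulr1.
apply: le_trans (normr_phi_le _ _ _ (node4 0)) _.
have C0 := lag_const_ge0.
rewrite ler_pdivrMr ?charp_node0_gt0//.
apply: le_trans (nrm_lagrange Li (node4 0) (ltn_ord r)) _.
apply: (@le_trans _ _ (lag_const * expR (x / (1 - q)) * lratio L r)).
  by rewrite ler_wpM2r ?ratio_ge0// ler_wpM2l ?prod_node_le.
rewrite ler_peMr ?charp_ge1//.
by rewrite mulr_ge0 ?ratio_ge0// mulr_ge0// expR_ge0.
Qed.

(** At most [k] of the nodes [node (L i)] are below [node X], so that Lagrange
    polynomials have norm of order [node X ^+ k] at [node X], while [p k.+1]
    has size [node X ^+ k.+1] there. *)
Lemma nrm_gpoly_escape k : exists2 C, 0 <= C & forall N L X, increasing N L ->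
  (k < N)%N -> (X <= L k)%N -> nrm (node 0) (gpoly N L k.+1) <= C / node X.
Proof.
pose E := expR (4 / (1 - q)).
have q1 : 0 < 1 - q by qlra.
exists ((p k.+1).[node 0] * (lag_const * E * 2 ^+ k * 4 ^+ k.+1 * (4 / (1 - q)))).
  rewrite !mulr_ge0 ?lag_const_ge0 ?expR_ge0 ?exprn_ge0 ?invr_ge0//.
  - by rewrite ltW// charp_node0_gt0.
  - exact: ltW.
move=> N L X Li kN XL; apply: le_trans (nrm_gpoly _ _ _ (node4 0)) _.
rewrite -[leRHS]mulrA; apply: ler_wpM2l; first by rewrite ltW// charp_node0_gt0.
rewrite [leRHS]mulrAC; apply: le_trans (ler_wpM2l _ (sum_ratio_le Li)); last first.
  rewrite divr_ge0// !mulr_ge0 ?lag_const_ge0 ?expR_ge0 ?exprn_ge0//.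
rewrite mulr_sumr; apply: ler_sum => r _.
rewrite divff ?charp_node0_neq0// mulr1.
apply: le_trans (normr_phi_le _ _ _ (node4 X)) _.
rewrite ler_pdivrMr ?charp_gt0//.
set x := node X.
have x0 : 0 < x := nodegt X. have x0le : 0 <= x := ltW x0.
have x4 : 4 <= x := node4 X.
apply: le_trans (nrm_lagrange Li x4 (ltn_ord r)) _.
apply: (@le_trans _ _ (lag_const * ((2 * x) ^+ k * E) * lratio L r)); last first.
  rewrite [leRHS]mulrAC ler_wpM2r ?ratio_ge0//.
  apply: (@le_trans _ _ (lag_const * E * 2 ^+ k * 4 ^+ k.+1 / x * (x / 4) ^+ k.+1)).
    rewrite exprMn expr_div_n exprS [x ^+ k.+1]exprS.
    set a := 4 * 4 ^+ k; have a0 : a != 0 by rewrite mulf_neq0 ?expf_neq0.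
    have -> : lag_const * E * 2 ^+ k * a / x * (x * x ^+ k / a) =
      lag_const * E * 2 ^+ k * x ^+ k * (a / a) * (x / x) by lra.
    by rewrite !divff// ?gt_eqF// !mulr1; lra.
  rewrite ler_wpM2l ?charp_lower//.
  rewrite divr_ge0 ?(ltW x0)//.
  by rewrite !mulr_ge0 ?lag_const_ge0 ?expR_ge0 ?exprn_ge0.
rewrite ler_wpM2r ?ratio_ge0// ler_wpM2l ?lag_const_ge0//.
rewrite (@big_cat_nat _ _ _ k)//=; last exact: ltnW.
apply: ler_pM.
- by apply: prodr_ge0 => i _; rewrite addr_ge0// divr_ge0.
- by apply: prodr_ge0 => i _; rewrite addr_ge0// divr_ge0.
- rewrite -[X in _ <= _ ^+ X](subn0 k) -prodr_const_nat.
  apply: ler_prod => i _; rewrite addr_ge0 ?divr_ge0//=.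
  have : x / node (L i) <= x.
    by rewrite ler_pdivrMr// ler_peMr ?ltW//; have := node4 (L i); lra.
  by lra.
- apply: le_trans (prod1D_le_expR _) _.
    by move=> i _; rewrite divr_ge0.
  rewrite ler_expR; apply: (@le_trans _ _ (\sum_(k <= i < N) 4 * q ^+ (i - k))).
    rewrite big_nat [leRHS]big_nat; apply: ler_sum => i /andP[ki iN].
    rewrite ler_pdivrMr//.
    have h := increasing_sub Li ki iN.
    apply: le_trans (node_ratio G q_gt0 q_lt1 (_ : (X <= L i)%N)) _; first lia.
    rewrite ler_wpM2r// ler_wpM2l//; apply: ler_wiXn2l; rewrite ?ltW//; lia.
  rewrite -mulr_sumr ler_wpM2l//.
  by have := sum_geom_shift_le q_gt0 q_lt1 N (leqnn k); rewrite subnn expr0 mul1r.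
Qed.

(** ** Perturbation by far away factors *)

Lemma nrm_perturb x a m n (t : nat -> R) f : 4 <= x -> 0 <= a ->
  (forall i, (m <= i < n)%N -> 0 <= t i /\ t i != a) ->
  nrm x ((\prod_(m <= i < n) lfactor a (t i)) * f - f) <=
  (\prod_(m <= i < n) (1 + (x + a) / `|t i - a|) - 1) * nrm x f.
Proof.
move=> x4 a0; elim: n => [|n IH] ht.
  by rewrite !big_geq// mul1r !subrr mul0r nrm0.
have [mn|nm] := leqP m n; last by rewrite !big_geq// mul1r !subrr mul0r nrm0.
have [t0 ta] : 0 <= t n /\ t n != a by apply: ht; rewrite mn leqnn.
have {}IH := IH (fun i hi => ht i (introT andP
  (conj (proj1 (andP hi)) (ltn_trans (proj2 (andP hi)) (ltnSn n))))).
rewrite !big_nat_recr//=.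
set P := \prod_(m <= i < n) lfactor a (t i) in IH *.
set Q := \prod_(m <= i < n) _ in IH *.
set e := (x + a) / `|t n - a|.
have h1 : nrm x (lfactor a (t n) * (P * f) - P * f) <= e * nrm x (P * f).
  exact: nrm_lfactor_sub.
have h2 : nrm x (P * f) <= nrm x (P * f - f) + nrm x f.
  by apply: le_trans (nrmD _ _ _ x4); rewrite subrK.
have e0 : 0 <= e by rewrite divr_ge0// addr_ge0//; lra.
have -> : P * lfactor a (t n) * f - f = (lfactor a (t n) * (P * f) - P * f) + (P * f - f).
  by rewrite addrA subrK -mulrA mulrCA.
apply: le_trans (nrmD _ _ _ x4) _.
have h3 : e * nrm x (P * f) <= e * (Q * nrm x f) by rewrite ler_wpM2l//; lra.
by lra.
Qed.

End Bounds.

(** * Truncation *)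

Section Truncation.
Variables (R : realType) (G : bcd_type) (q : R).
Hypotheses (q_gt0 : 0 < q) (q_lt1 : q < 1).
Notation p := (charp R G).
Notation node := (node G q).
Notation phi := (@phi R G).
Notation nrm := (@nrm R G).
Notation lag := (node_lagrange G q).
Notation gpoly := (gpoly G q).
Notation hden := (hden G q).
Notation hpoly := (hpoly G q).
Notation lratio := (lratio G q).
Notation qconst := (qconst q_gt0 q_lt1).
Notation lag_const := (lag_const q_gt0 q_lt1).
Local Ltac qlra := move: q_gt0 q_lt1; lra.

Let node4 := node_ge4 G q_gt0.
Let nodegt := node_gt0 G q_gt0.
Let node0le := node_ge0 G q_gt0.
Let qge n := qexp_ge0 q_gt0 n.
Let p0gt m := charp_node0_gt0 G q_gt0 m.
Let q1gt : 0 < 1 - q. Proof. by qlra. Qed.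

Lemma qexp_leq a b : (a <= b)%N -> q ^+ b <= q ^+ a.
Proof. by move=> ab; apply: ler_wiXn2l; rewrite ?ltW. Qed.

(** The nodes grow geometrically, so the factors from [m] on are [1] up to
    errors which sum up to the order of [q ^+ (m - r)]. *)
Lemma node_perturb x : 4 <= x -> exists2 C, 0 <= C &
  forall L r m n f, increasing n L -> (r < m)%N ->
  nrm x ((\prod_(m <= i < n) lfactor (node (L r)) (node (L i))) * f - f) <=
  C * q ^+ (m - r) * nrm x f.
Proof.
move=> x4; pose K := (x + 4) * ((1 - q ^+ 1) ^+ 4)^-1.
have K0 : 0 <= K by rewrite mulr_ge0 ?invr_ge0 ?exprn_ge0// ?expr1 ?(ltW q1gt)//; lra.
exists (K / (1 - q) * expR (K / (1 - q))).
  by rewrite mulr_ge0 ?expR_ge0// divr_ge0// ltW.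
move=> L r m n f Li rm.
have gap i : (m <= i < n)%N -> (r < i)%N /\ (i - r <= L i - L r)%N /\ (r <= L r)%N.
  move=> /andP[mi iN]; have ri := leq_trans rm mi; split=> //; split.
    by have := increasing_sub Li (ltnW ri) iN; lia.
  by apply: (increasing_ge Li); apply: ltn_trans iN.
have Lri i : (m <= i < n)%N -> (L r < L i)%N by move=> /gap; lia.
apply: le_trans (nrm_perturb _ _ x4 (node0le (L r)) _) _.
  by move=> i /Lri Lr; rewrite node0le gt_eqF// node_ltn.
rewrite ler_wpM2r ?nrm_ge0//.
apply: le_trans; first apply: (@prod1D_sub1 _ m n
  (fun i => (x + node (L r)) / `|node (L i) - node (L r)|) (K * (q ^+ (m - r) / (1 - q)))).
- by move=> i _; rewrite divr_ge0// addr_ge0//; lra.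
- apply: (@le_trans _ _ (\sum_(m <= i < n) K * q ^+ (i - r))); last first.
    by rewrite -mulr_sumr ler_wpM2l// sum_geom_shift_le// ltnW.
  rewrite big_nat [leRHS]big_nat; apply: ler_sum => i hi.
  have [ri [gi rr]] := gap i hi; have Li' := Lri i hi.
  have -> : (x + node (L r)) / `|node (L i) - node (L r)| =
      (x / node (L i) + node (L r) / node (L i)) * (node (L i) / `|node (L i) - node (L r)|).
    by rewrite -mulrDl mulrA divfK// gt_eqF.
  rewrite /K mulrAC; apply: ler_pM.
  + by rewrite addr_ge0// divr_ge0//; lra.
  + by rewrite divr_ge0.
  + rewrite [leRHS]mulrDl; apply: lerD.
      rewrite ler_wpM2l//; first by lra.
      apply: le_trans (node_inv_le G q_gt0 q_lt1 _) _.
      by apply: qexp_leq; lia.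
    rewrite ler_pdivrMr//; apply: le_trans (node_ratio G q_gt0 q_lt1 (ltnW Li')) _.
    by rewrite ler_wpM2r// ler_wpM2l// qexp_leq.
  + apply: le_trans (node_gap G q_gt0 q_lt1 Li') _.
    by apply: inv4_le => //; rewrite subn_gt0.
- have h : K * (q ^+ (m - r) / (1 - q)) <= K / (1 - q).
    rewrite ler_wpM2l// ler_pdivrMr// mulVf ?gt_eqF//; exact: qexp_le1.
  have h0 : 0 <= K * (q ^+ (m - r) / (1 - q)).
    by rewrite mulr_ge0// divr_ge0// ltW.
  rewrite [leRHS]mulrAC.
  have -> : K / (1 - q) * q ^+ (m - r) = K * (q ^+ (m - r) / (1 - q)) by lra.
  by rewrite ler_wpM2l// ler_expR.
Qed.

(** Division by [hden] is bounded at the nodes below [m], every factor being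
    at least one of the factors of a convergent product. *)
Lemma nrm_hden_lower k j m n f : (k < m)%N -> (j < m)%N ->
  qconst ^+ 4 * nrm (node k) f <= nrm (node k) (hden j m n * f).
Proof.
move=> km jm; rewrite /hden.
have n0 := nrm_ge0 G _ (node4 k).
apply: (@le_trans _ _ ((\prod_(m <= i < n) (1 - q ^+ (i - k)) ^+ 4) * nrm (node k) f)).
  rewrite ler_wpM2r// prodrXl lerXn2r ?nnegrE ?(ltW (qconst_gt0 _ _))//.
    by apply: prodr_ge0 => i _; exact: onem_qexp_ge0.
  exact: qconst_le_right.
elim: n => [|n IH]; first by rewrite !big_geq// !mul1r.
have [mn|nm] := leqP m n; last by rewrite !big_geq// !mul1r.
rewrite !big_nat_recr//= -[X in _ <= nrm _ X]mulrA [X in _ <= nrm _ X]mulrCA.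
apply: le_trans (nrm_lfactor_lower _ _ _ (node4 k) (node0le n)).
rewrite [X in X * _ <= _]mulrC -[leLHS]mulrA; apply: ler_pM => //.
- by rewrite exprn_ge0// onem_qexp_ge0.
- by rewrite mulr_ge0// prodr_ge0// => i _; rewrite exprn_ge0// onem_qexp_ge0.
have kn : (k < n)%N by apply: leq_trans mn.
have jn : (j < n)%N by apply: leq_trans mn.
have h := node_diff G q_gt0 q_lt1 kn.
have hj : 0 < node n - node j by rewrite subr_gt0 node_ltn.
rewrite gtr0_norm// ler_pdivlMr//; apply: le_trans h.
rewrite mulrC ler_wpM2r ?exprn_ge0 ?onem_qexp_ge0//.
by rewrite lerBlDr lerDl.
Qed.

(** ** Weights *)

Section Weights.
Variables (k B : nat).

(** Up to a constant, bound for the norm at [node k] of the term of index [r]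
    of [gpoly]: by duality [p (L r)] grows like [node (L r) ^+ k] at [node k]
    relatively to its value at [node 0]. *)
Definition wgt (L : nat -> nat) r : R := lratio L r * node (L r) ^+ k.

Definition wgt_const : R := node B ^+ k.+2 / q ^+ (k.+2).*2.

Lemma wgt_const_ge0 : 0 <= wgt_const.
Proof. by apply: divr_ge0; [exact: exprn_ge0|exact: qge]. Qed.

(** For [r] above [k.+1], the ratios to the nodes of [L 0], ..., [L k.+1] give
    a power [node (L r) ^- k.+2], which beats [node (L r) ^+ k]. The finitely
    many other terms are absorbed by the constant. *)
Lemma wgt_le N L r : increasing N L -> (r < N)%N -> (k.+1 < N)%N -> (L k.+1 <= B)%N ->
  wgt L r <= wgt_const * q ^+ r.*2.
Proof.
move=> Li rN kN LB; have nB : 1 <= node B by have := node4 B; lra.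
have qq n : q ^+ n != 0 by rewrite expf_neq0// gt_eqF.
have [kr|rk] := leqP k.+2 r.
  apply: (@le_trans _ _ ((\prod_(0 <= i < k.+2) (node B / node (L r))) * node (L r) ^+ k)).
    rewrite ler_wpM2r ?exprn_ge0//.
    apply: le_trans (ratio_le_prefix G q_gt0 q_lt1 Li kr rN) _.
    rewrite big_nat [leRHS]big_nat; apply: ler_prod => i /andP[_ ik].
    rewrite divr_ge0//= ler_wpM2r ?invr_ge0//.
    apply: node_leq => //; apply: leq_trans LB.
    by apply: (increasing_leq Li); lia.
  rewrite prodr_const_nat subn0 expr_div_n -mulrA /wgt_const -mulrA.
  rewrite ler_wpM2l ?exprn_ge0//.
  apply: (@le_trans _ _ (q ^+ r.*2)); last first.
    by rewrite ler_peMl// invf_ge1 ?exprn_gt0// qexp_le1.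
  have -> : (node (L r) ^+ k.+2)^-1 * node (L r) ^+ k = ((node (L r))^-1) ^+ 2.
    rewrite -exprVn -(addn2 k) exprD mulrAC -exprMn mulVf ?gt_eqF//.
    by rewrite expr1n mul1r.
  rewrite -muln2 exprM lerXn2r ?nnegrE ?invr_ge0//.
  apply: le_trans (node_inv_le G q_gt0 q_lt1 _) _.
  by apply: qexp_leq; exact: (increasing_ge Li).
apply: (@le_trans _ _ (node B ^+ k.+2)).
  rewrite -[leRHS]mul1r; apply: ler_pM; rewrite ?ratio_ge0 ?exprn_ge0//.
    apply: le_trans (ratio_le_prefix G q_gt0 q_lt1 Li (leq0n r) rN) _.
    by rewrite big_geq.
  apply: (@le_trans _ _ (node B ^+ k)).
    rewrite lerXn2r ?nnegrE//; apply: node_leq => //; apply: leq_trans LB.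
    by apply: (increasing_leq Li); lia.
  by apply: ler_weXn2l => //; lia.
rewrite /wgt_const -mulrA ler_peMr ?exprn_ge0//.
rewrite mulrC ler_pdivlMr ?exprn_gt0// mul1r qexp_leq//; lia.
Qed.

Lemma phi_wgt (L : nat -> nat) (r j : nat) f : `|phi j f| * ((p (L r)).[node k] / (p (L r)).[node 0]) <=
  nrm (node 0) f * (2 * node (L r) ^+ k).
Proof.
apply: ler_pM => //.
- by rewrite divr_ge0// ltW// charp_gt0.
- apply: le_trans (normr_phi_le _ _ _ (node4 0)) _.
  by rewrite ler_pdivrMr// ler_peMr ?nrm_ge0 ?charp_ge1.
- rewrite charp_dual_div// ler_pdivrMr//.
  apply: le_trans (charp_upper _ _ (node4 _)) _.
  by rewrite ler_peMr ?charp_ge1// mulr_ge0// exprn_ge0.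
Qed.

Definition lag0_const : R := lag_const * expR (node 0 / (1 - q)).

Lemma lag0_const_ge0 : 0 <= lag0_const.
Proof. by rewrite mulr_ge0 ?lag_const_ge0 ?expR_ge0. Qed.

Lemma nrm_lagrange0 N L r : increasing N L -> (r < N)%N ->
  nrm (node 0) (lag N L r) <= lag0_const * lratio L r.
Proof.
move=> Li rN; apply: le_trans (nrm_lagrange G q_gt0 q_lt1 Li (node4 0) rN) _.
rewrite ler_wpM2r ?ratio_ge0// ler_wpM2l ?lag_const_ge0//.
exact: prod_node_le.
Qed.

Lemma sum_wgt_le N L m n : increasing N L -> (n <= N)%N -> (k.+1 < N)%N ->
  (L k.+1 <= B)%N ->
  \sum_(m <= r < n) wgt L r <= wgt_const * (q ^+ m / (1 - q)).
Proof.
move=> Li nN kN LB; apply: (@le_trans _ _ (wgt_const * \sum_(m <= r < n) q ^+ r)).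
  rewrite mulr_sumr big_nat [leRHS]big_nat; apply: ler_sum => r /andP[_ rn].
  apply: le_trans (wgt_le Li (leq_trans rn nN) kN LB) _.
  by rewrite ler_wpM2l ?wgt_const_ge0// qexp_leq//; lia.
by rewrite ler_wpM2l ?wgt_const_ge0// sum_geom_le.
Qed.

Lemma gpoly_term_le N L r j : increasing N L -> (r < N)%N ->
  `|phi j (lag N L r)| * ((p (L r)).[node k] / (p (L r)).[node 0]) <=
  2 * lag0_const * wgt L r.
Proof.
move=> Li rN; apply: le_trans (phi_wgt _ _ _ _) _.
rewrite /wgt; have := nrm_lagrange0 Li rN.
have h : 0 <= 2 * node (L r) ^+ k by rewrite mulr_ge0// exprn_ge0.
by move=> /(ler_wpM2r h) /le_trans; apply; lra.
Qed.

Lemma nrm_gpoly_bound j : exists2 C, 0 <= C & forall N L, increasing N L ->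
  (k.+1 < N)%N -> (L k.+1 <= B)%N -> nrm (node k) (gpoly N L j) <= C.
Proof.
exists ((p j).[node 0] * (2 * lag0_const * (wgt_const * (q ^+ 0 / (1 - q))))).
  rewrite expr0 mulr_ge0 ?(ltW (p0gt j))// mulr_ge0//.
    by rewrite mulr_ge0 ?lag0_const_ge0.
  by rewrite mulr_ge0 ?wgt_const_ge0// divr_ge0// ltW.
move=> N L Li kN LB; apply: le_trans (nrm_gpoly G q_gt0 N L j (node4 k)) _.
rewrite ler_wpM2l ?(ltW (p0gt j))//.
apply: (@le_trans _ _ (2 * lag0_const * \sum_(0 <= r < N) wgt L r)).
  by rewrite mulr_sumr big_mkord; apply: ler_sum => r _; exact: gpoly_term_le.
rewrite ler_wpM2l ?(sum_wgt_le 0 Li)// mulr_ge0// lag0_const_ge0//.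
Qed.

(** The terms with [r < n] lose only Lagrange factors beyond [n], a relative
    error of order [q ^+ (n - r)], and their weights [q ^+ r.*2] more than
    compensate the [r] in the exponent. The terms with [n <= r] form a tail of
    the series of weights. *)
Lemma nrm_gpoly_trunc j : exists2 C, 0 <= C & forall N L n, increasing N L ->
  (k.+1 < n <= N)%N -> (L k.+1 <= B)%N ->
  nrm (node k) (gpoly N L j - gpoly n L j) <= C * q ^+ n.
Proof.
have [D D0 hD] := node_perturb (node4 0).
pose A := 2 * lag0_const.
have A0 : 0 <= A by rewrite mulr_ge0 ?lag0_const_ge0.
exists ((p j).[node 0] * ((D * A * wgt_const + A * wgt_const) / (1 - q))).
  rewrite mulr_ge0 ?(ltW (p0gt j))// divr_ge0 ?(ltW q1gt)//.
  exact: addr_ge0 (mulr_ge0 (mulr_ge0 D0 A0) wgt_const_ge0) (mulr_ge0 A0 wgt_const_ge0).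
move=> N L n Li /andP[kn nN] LB.
have Lin := increasing_le nN Li.
pose T M r := (phi j (lag M L r) / (p (L r)).[node 0]) *: p (L r).
have -> : gpoly N L j - gpoly n L j = (p j).[node 0] *:
   (\sum_(0 <= r < n) (T N r - T n r) + \sum_(n <= r < N) T N r).
  rewrite /gpoly -scalerBr -!(big_mkord xpredT (T _)); congr (_ *: _).
  by rewrite (@big_cat_nat _ _ _ n)//= sumrB addrAC.
rewrite nrmZ (gtr0_norm (p0gt j)) -[leRHS]mulrA ler_wpM2l ?(ltW (p0gt j))//.
apply: le_trans (nrmD _ _ _ (node4 k)) _.
rewrite [leRHS]mulrAC [X in _ <= X / _]mulrDl [leRHS]mulrDl; apply: lerD.
- apply: le_trans (nrm_sum _ _ _ _ (node4 k)) _.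
  apply: (@le_trans _ _ (\sum_(0 <= r < n) D * A * wgt_const * q ^+ n * q ^+ r)); last first.
    rewrite -mulr_sumr; apply: ler_wpM2l.
      exact: mulr_ge0 (mulr_ge0 (mulr_ge0 D0 A0) wgt_const_ge0) (qge n).
    by apply: le_trans (sum_geom_le q_gt0 q_lt1 _ _) _; rewrite expr0 mul1r.
  rewrite big_nat [leRHS]big_nat; apply: ler_sum => r /andP[_ rn].
  rewrite /T -scalerBl -mulrBl -linearB /= nrmZ nrm_charp// normrM normfV (gtr0_norm (p0gt _)).
  rewrite mulrAC -mulrA; apply: le_trans (phi_wgt _ _ _ _) _.
  have -> : lag N L r = (\prod_(n <= i < N) lfactor (node (L r)) (node (L i))) * lag n L r.
    rewrite /node_lagrange (@big_cat_nat _ _ _ n)//= mulrC; congr (_ * _).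
    rewrite big_nat_cond [RHS]big_nat_cond; apply: eq_bigl => i.
    by rewrite andbT; case: ltngtP => //= h; rewrite ?andbF ?andbT//; lia.
  have h1 := hD L r n N (lag n L r) Li rn.
  have h2 := nrm_lagrange0 Lin rn.
  have h3 : 0 <= 2 * node (L r) ^+ k by rewrite mulr_ge0// exprn_ge0.
  apply: le_trans (ler_wpM2r h3 h1) _.
  have h4 : 0 <= D * q ^+ (n - r) by rewrite mulr_ge0.
  apply: le_trans (ler_wpM2r h3 (ler_wpM2l h4 h2)) _.
  have -> : D * q ^+ (n - r) * (lag0_const * lratio L r) * (2 * node (L r) ^+ k) =
    D * A * q ^+ (n - r) * wgt L r by rewrite /wgt /A; lra.
  apply: (@le_trans _ _ (D * A * q ^+ (n - r) * (wgt_const * q ^+ r.*2))).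
    apply: ler_wpM2l; first exact: mulr_ge0 (mulr_ge0 D0 A0) (qge _).
    by apply: (wgt_le Lin) => //; lia.
  rewrite -addnn exprD.
  have <- : q ^+ (n - r) * q ^+ r = q ^+ n by rewrite -exprD subnK// ltnW.
  by lra.
- apply: le_trans (nrm_sum _ _ _ _ (node4 k)) _.
  apply: (@le_trans _ _ (A * \sum_(n <= r < N) wgt L r)).
    rewrite mulr_sumr big_nat [leRHS]big_nat; apply: ler_sum => r /andP[_ rN].
    rewrite /T nrmZ nrm_charp// normrM normfV (gtr0_norm (p0gt _)).
    by rewrite mulrAC -mulrA; exact: gpoly_term_le.
  have -> : A * wgt_const * q ^+ n / (1 - q) = A * (wgt_const * (q ^+ n / (1 - q))) by lra.
  by apply: ler_wpM2l => //; apply: (sum_wgt_le _ Li) => //; lia.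
Qed.

(** ** Bounds for [hpoly] *)

Let qc0 : 0 < qconst ^+ 4. Proof. by rewrite exprn_gt0// qconst_gt0. Qed.

Lemma nrm_hpoly_le N L l j : increasing N L -> (j < l <= N)%N -> (k < l)%N ->
  nrm (node k) (hpoly N L l j) <= (qconst ^+ 4)^-1 * nrm (node k) (gpoly N L j).
Proof.
move=> Li /andP[jl lN] kl; rewrite mulrC ler_pdivlMr// [leLHS]mulrC.
rewrite -(hpolyM G q_gt0 q_lt1 Li jl lN) [X in _ <= nrm _ X]mulrC.
exact: nrm_hden_lower.
Qed.

Lemma nrm_hpoly_bound j : (j <= k)%N -> exists2 C, 0 <= C & forall N L, increasing N L ->
  (k.+1 < N)%N -> (L k.+1 <= B)%N -> nrm (node k) (hpoly N L k.+1 j) <= C.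
Proof.
move=> jk; have [C C0 hC] := nrm_gpoly_bound j.
exists ((qconst ^+ 4)^-1 * C); first by rewrite mulr_ge0// invr_ge0 ltW.
move=> N L Li kN LB; apply: le_trans (nrm_hpoly_le Li _ (leqnn _)) _; first lia.
by apply: ler_wpM2l; [rewrite invr_ge0 ltW|exact: hC].
Qed.

(** Up to the factors beyond [n], which are close to [1], [gpoly N L j] is the
    product of [hpoly N L k.+1 j] with the denominator of [hpoly n L k.+1 j];
    division by the latter is bounded, so the closeness of [gpoly N L j] and
    [gpoly n L j] is inherited by the quotients. *)
Lemma nrm_hpoly_trunc j : (j <= k)%N -> exists2 C, 0 <= C & forall N L n,
  increasing N L -> (k.+1 < n <= N)%N -> (L k.+1 <= B)%N ->
  nrm (node k) (hpoly N L k.+1 j - hpoly n L k.+1 j) <= C * q ^+ n.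
Proof.
move=> jk; have [C C0 hC] := nrm_gpoly_trunc j; have [E E0 hE] := nrm_gpoly_bound j.
have [D D0 hD] := node_perturb (node4 k).
pose V := (qconst ^+ 4)^-1.
have V0 : 0 <= V by rewrite /V invr_ge0 ltW.
exists (V * (D * (q ^+ j)^-1 * (V * E) + C)).
  apply: mulr_ge0 => //; apply: addr_ge0 => //; apply: mulr_ge0; last exact: mulr_ge0.
  by apply: mulr_ge0 => //; rewrite invr_ge0.
move=> N L n Li /andP[kn nN] LB.
have Lin := increasing_le nN Li.
have jn : (j < n)%N by lia.
pose X := hpoly N L k.+1 j * hden j k.+1 n.
have XT : hden j n N * X = gpoly N L j.
  rewrite -(hpolyM G q_gt0 q_lt1 Li (_ : j < k.+1)%N)//; last by lia.
  have -> : hden j k.+1 N = hden j k.+1 n * hden j n N.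
    by rewrite /hden (@big_cat_nat _ _ _ n)//=; lia.
  by rewrite [LHS]mulrC -[LHS]mulrA.
have Xle : nrm (node k) X <= V * E.
  apply: (@le_trans _ _ (V * nrm (node k) (gpoly N L j))); last first.
    by apply: ler_wpM2l => //; apply: hE => //; lia.
  rewrite mulrC ler_pdivlMr// mulrC -XT.
  by apply: nrm_hden_lower => //; lia.
have idi : increasing N id by move=> a b.
have h1 := hD id j n N X idi jn.
have h2 := nrm_hden_lower (k := k) (m := k.+1) n (hpoly N L k.+1 j - hpoly n L k.+1 j)
  (leqnn _) (_ : j < k.+1)%N.
rewrite -[leRHS]mulrA [leRHS]mulrC {1}/V ler_pdivlMr// [leLHS]mulrC.
apply: le_trans (h2 _) _ => //.
have -> : hden j k.+1 n * (hpoly N L k.+1 j - hpoly n L k.+1 j) =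
   (gpoly N L j - gpoly n L j) - (hden j n N * X - X).
  rewrite XT mulrBr [_ * hpoly n _ _ _]mulrC hpolyM//; last lia.
  by rewrite mulrC -/X opprB [RHS]addrC [RHS]addrA subrK.
apply: le_trans (nrmB _ _ _ (node4 k)) _.
rewrite [leRHS]mulrDl [leRHS]addrC; apply: lerD; first by apply: hC => //; rewrite kn.
apply: le_trans h1 _.
have -> : D * (q ^+ j)^-1 * (V * E) * q ^+ n = D * (q ^+ n / q ^+ j) * (V * E) by lra.
have -> : q ^+ n / q ^+ j = q ^+ (n - j).
  by rewrite -{1}(subnK (ltnW jn)) exprD mulfK// expf_neq0// gt_eqF.
by apply: ler_wpM2l => //; apply: mulr_ge0.
Qed.

End Weights.

Lemma nrm_hpoly0_bound k j : (j <= k)%N -> exists2 C, 0 <= C & forall N L,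
  increasing N L -> (k < N)%N -> nrm (node 0) (hpoly N L k.+1 j) <= C.
Proof.
move=> jk; have [C hC] := nrm_gpoly0 G q_gt0 q_lt1 j.
have qc0 : 0 < qconst ^+ 4 by rewrite exprn_gt0// qconst_gt0.
exists ((qconst ^+ 4)^-1 * C).
  apply: mulr_ge0; first by rewrite invr_ge0 ltW.
  by apply: le_trans (hC 0%N id _) => //; exact: nrm_ge0.
move=> N L Li kN; apply: le_trans (nrm_hpoly_le Li _ (ltn0Sn _)) _; first lia.
by apply: ler_wpM2l; [rewrite invr_ge0 ltW|exact: hC].
Qed.

Lemma nrm_hpoly_escape k : exists2 C, 0 <= C & forall N L X, increasing N L ->
  (k.+1 < N)%N -> (X <= L k)%N -> nrm (node 0) (hpoly N L k.+2 k.+1) <= C / node X.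
Proof.
have [C C0 hC] := nrm_gpoly_escape G q_gt0 q_lt1 k.
have qc0 : 0 < qconst ^+ 4 by rewrite exprn_gt0// qconst_gt0.
exists ((qconst ^+ 4)^-1 * C).
  by apply: mulr_ge0 => //; rewrite invr_ge0 ltW.
move=> N L X Li kN XL; apply: le_trans (nrm_hpoly_le Li _ (ltn0Sn _)) _; first lia.
rewrite -[leRHS]mulrA; apply: ler_wpM2l; first by rewrite invr_ge0 ltW.
by apply: hC => //; lia.
Qed.

End Truncation.

(** * Signatures as increasing sequences *)

Section Signatures.

(** Parts numbered from the right and shifted by their index, which makes them
    strictly increasing; this numbering is the one for which stabilization is
    eventual equality of each term. *)
Definition gtL (N : nat) (lam : GT N) (r : nat) : nat :=
  (nth 0%N (val lam) (N - r.+1) + r)%N.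

Lemma gtL_increasing N (lam : GT N) : increasing N (gtL lam).
Proof.
move=> r r' rr rN; rewrite /gtL.
have gtr : transitive geq by move=> a b c h1 h2; apply: leq_trans h2 h1.
have grefl : reflexive geq by move=> a; exact: leqnn.
have := sorted_leq_nth gtr grefl 0%N (valP lam).
move=> /(_ (N - r'.+1)%N (N - r.+1)%N); rewrite !inE size_tuple.
by move=> h; have /= := h _ _ _; lia.
Qed.

Lemma gt_zero_subproof N : sorted geq [tuple of nseq N 0%N].
Proof. by case: N => //= N; elim: N => //= N ->. Qed.

Definition gt_zero N : GT N := exist _ [tuple of nseq N 0%N] (gt_zero_subproof N).

(** The default signature is not reached when [L] is increasing. *)
Definition toGT (N : nat) (L : nat -> nat) : GT N :=
  insubd (gt_zero N) [tuple (L (N - (i : nat).+1) - (N - i.+1))%N | i < N].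

Lemma nth_mktuple_nat N (f : nat -> nat) i : (i < N)%N ->
  nth 0%N [tuple f j | j < N] i = f i.
Proof. by move=> iN; rewrite -(tnth_nth _ _ (Ordinal iN)) tnth_mktuple. Qed.

Lemma val_toGT N L : increasing N L ->
  val (toGT N L) = [tuple (L (N - (i : nat).+1) - (N - i.+1))%N | i < N].
Proof.
move=> Li; rewrite val_insubd ifT//.
apply/(sortedP 0%N) => i; rewrite size_tuple => iN.
rewrite !(nth_mktuple_nat (fun i => L (N - i.+1) - (N - i.+1))%N)//; last exact: ltnW.
have := Li (N - i.+2)%N (N - i.+1)%N; rewrite /geq /=.
by move=> h; have := h _ _; have := increasing_ge Li (_ : N - i.+1 < N)%N; lia.
Qed.

Lemma gtL_toGT N L r : increasing N L -> (r < N)%N -> gtL (toGT N L) r = L r.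
Proof.
move=> Li rN; rewrite /gtL val_toGT//.
rewrite (nth_mktuple_nat (fun i => L (N - i.+1) - (N - i.+1))%N); last lia.
have -> : (N - (N - r.+1).+1 = r)%N by lia.
by rewrite subnK// (increasing_ge Li).
Qed.

Lemma gtL_inj N (lam mu : GT N) : (forall r, (r < N)%N -> gtL lam r = gtL mu r) -> lam = mu.
Proof.
move=> h; apply: val_inj; apply: eq_from_tnth => i.
rewrite !(tnth_nth 0%N).
have iN : (N - i.+1 < N)%N by have := ltn_ord i; lia.
have := h _ iN; rewrite /gtL.
have -> : (N - (N - i.+1).+1 = i)%N by have := ltn_ord i; lia.
by move/addIn.
Qed.

(** Exponents in decreasing order, as in the rows of the alternants. *)
Definition gtl (N : nat) (lam : GT N) (i : nat) : nat := gtL lam (N - i.+1).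

Lemma gtlE N (lam : GT N) (i : 'I_N) : gtl lam i = (tnth (val lam) i + (N - i.+1))%N.
Proof.
rewrite /gtl /gtL (tnth_nth 0%N); congr (nth _ _ _ + _)%N.
by have := ltn_ord i; lia.
Qed.

Lemma gtl_decr N (lam : GT N) i j : (i < j)%N -> (j < N)%N -> (gtl lam j < gtl lam i)%N.
Proof. by move=> ij jN; apply: gtL_increasing; lia. Qed.

Lemma gtl_inj N (lam mu : GT N) : (forall i : 'I_N, gtl lam i = gtl mu i) -> lam = mu.
Proof.
move=> h; apply: gtL_inj => r rN.
have e : (N - r.+1 < N)%N by lia.
have := h (Ordinal e); rewrite /gtl /=.
by have -> : (N - (N - r.+1).+1 = r)%N by lia.
Qed.

Variables (k B : nat).

Definition ffun_of_gt (mu : GT k) (h : forall i : 'I_k, (gtl mu i < B)%N) :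
  {ffun 'I_k -> 'I_B} := [ffun i => Ordinal (h i)].

Lemma ffun_of_gt_decreasing mu h : decreasing (@ffun_of_gt mu h).
Proof. by apply/decreasingP => i j ij; rewrite !ffunE /=; exact: gtl_decr. Qed.

Definition gt_of_ffun (g : {ffun 'I_k -> 'I_B}) : GT k :=
  toGT k (fun r => oapp (fun i : 'I_k => g (rev_ord i) : nat) 0%N (insub r)).

Lemma gtl_gt_of_ffun g (i : 'I_k) : decreasing g -> gtl (gt_of_ffun g) i = g i.
Proof.
move=> /decreasingP gd; rewrite /gtl gtL_toGT.
- have e : (k - i.+1 < k)%N by have := ltn_ord i; lia.
  rewrite (insubT (fun r => r < k)%N e) /=; congr (nat_of_ord (g _)).
  by apply: val_inj => /=; have := ltn_ord i; lia.
- move=> r r' rr rk; have rk' := ltn_trans rr rk.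
  rewrite (insubT (fun r => r < k)%N rk) (insubT (fun r => r < k)%N rk') /=.
  by apply: gd => /=; lia.
- by have := ltn_ord i; lia.
Qed.

(** Range of the summation over signatures in the Cauchy-Binet formula. *)
Definition gtseq : seq (GT k) := [seq gt_of_ffun g | g <- enum (@decreasing k B)].

Lemma mem_gtseq (mu : GT k) : (forall i : 'I_k, (gtl mu i < B)%N) -> mu \in gtseq.
Proof.
move=> h; apply/mapP; exists (ffun_of_gt h).
  by rewrite mem_enum; exact: ffun_of_gt_decreasing.
apply: gtl_inj => i; rewrite gtl_gt_of_ffun ?ffun_of_gt_decreasing//.
by rewrite ffunE.
Qed.

Lemma uniq_gtseq : uniq gtseq.
Proof.
rewrite map_inj_in_uniq ?enum_uniq// => g g'; rewrite !mem_enum => gd gd' e.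
by apply/ffunP => i; apply: val_inj; rewrite /= -!gtl_gt_of_ffun// e.
Qed.

End Signatures.

(** * Determinants *)

Section DetLemmas.
Variable (R : realFieldType).

(** Beyond [k] the columns are unit vectors. *)
Lemma det_corner k N (f : nat -> nat -> R) : (k <= N)%N ->
  (forall j a, (j < N)%N -> (a < N)%N -> (k <= a)%N -> f j a = (j == a)%:R) ->
  \det (\matrix_(j < N, a < N) f j a) = \det (\matrix_(j < k, a < k) f j a).
Proof.
move=> kN; rewrite -(subnKC kN); move: (N - k)%N => m {kN N} h.
pose A := \matrix_(j < k + m, a < k + m) f j a.
rewrite -/A -[A]submxK.
have -> : ursubmx A = 0.
  apply/matrixP => i j; rewrite !mxE /= h ?ltn_add2l//; last by rewrite leq_addr.
    by rewrite ltn_eqF// (leq_trans (ltn_ord i)) ?leq_addr.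
  by apply: leq_trans (ltn_ord i) _; rewrite leq_addr.
have -> : drsubmx A = 1%:M.
  apply/matrixP => i j; rewrite !mxE /= h ?ltn_add2l ?leq_addr//.
  by rewrite eqn_add2l.
rewrite det_lblock det1 mulr1; congr (\det _).
by apply/matrixP => i j; rewrite !mxE.
Qed.

Lemma det_scale_row n (c : nat -> R) (f : nat -> nat -> R) :
  \det (\matrix_(i < n, j < n) (c i * f i j)) =
  (\prod_(i < n) c i) * \det (\matrix_(i < n, j < n) f i j).
Proof.
rewrite /determinant mulr_sumr; apply: eq_bigr => s _.
rewrite mulrCA; congr (_ * _); rewrite -big_split; apply: eq_bigr => i _.
by rewrite !mxE.
Qed.

Lemma det_scale_col n (c : nat -> R) (f : nat -> nat -> R) :
  \det (\matrix_(i < n, j < n) (c j * f i j)) =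
  (\prod_(j < n) c j) * \det (\matrix_(i < n, j < n) f i j).
Proof.
rewrite /determinant mulr_sumr; apply: eq_bigr => s _.
rewrite mulrCA; congr (_ * _); rewrite [X in _ = X * _](reindex_perm s) -big_split.
by apply: eq_bigr => i _; rewrite !mxE.
Qed.

(** Subtracting from each row the next one clears the last column, except in
    the last row. *)
Lemma det_row_diff n (g : nat -> nat -> R) : (forall i, (i <= n)%N -> g i n = 1) ->
  \det (\matrix_(i < n.+1, a < n.+1) g i a) =
  \det (\matrix_(i < n, a < n) (g i a - g i.+1 a)).
Proof.
move=> gn; pose A := \matrix_(i < n.+1, a < n.+1) g i a.
pose U := \matrix_(i < n.+1, j < n.+1)
  (((j == i :> nat)%:R : R) - (j == i.+1 :> nat)%:R).
have detU : \det U = 1.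
  rewrite -det_tr det_trig; last first.
    apply/is_trig_mxP => i j ij; rewrite !mxE.
    by rewrite ltn_eqF// ltn_eqF ?subr0// ltnS ltnW.
  rewrite big1// => i _; rewrite !mxE eqxx ltn_eqF ?subr0//.
pose h i a := if i == n then g i a else g i a - g i.+1 a.
have UA : U *m A = \matrix_(i < n.+1, a < n.+1) h i a.
  apply/matrixP => i a; rewrite !mxE.
  under eq_bigr do rewrite !mxE mulrBl.
  rewrite sumrB (bigD1 i)//= eqxx mul1r big1 ?addr0; last first.
    by move=> j; rewrite -val_eqE /= => /negPf ->; rewrite mul0r.
  rewrite /h; case: eqP => [iN|/eqP iN].
    rewrite big1 ?subr0// => j _; rewrite iN ltn_eqF ?mul0r//.
  have iN' : (i.+1 < n.+1)%N by have := ltn_ord i; lia.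
  rewrite (bigD1 (Ordinal iN'))//= eqxx mul1r big1 ?addr0// => j.
  by rewrite -val_eqE /= => /negPf ->; rewrite mul0r.
rewrite -[LHS]mul1r -detU -det_mulmx UA (expand_det_col _ ord_max).
rewrite (bigD1 ord_max)//= big1 ?addr0; last first.
  move=> i; rewrite -val_eqE /= => iN; rewrite !mxE /h (negPf iN).
  by rewrite !gn ?subrr ?mul0r//; have := ltn_ord i; lia.
rewrite !mxE /h /= eqxx gn// mul1r /cofactor -signr_odd addnn odd_double mul1r.
have lb (i : 'I_n) : bump n i = i by rewrite /bump leqNgt ltn_ord.
congr (\det _); apply/matrixP => i j; rewrite !mxE /= !lb.
by rewrite ltn_eqF.
Qed.

(** The determinant is [0] or [1]: the first column is zero, or it is a unit
    vector and the first row and column can be removed, or the first two rows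
    consist of ones. *)
Lemma det_staircase k (m f : nat -> nat) :
  (forall i j, (i < j)%N -> (j < k)%N -> (m j < m i)%N) ->
  (forall i j, (i < j)%N -> (j < k)%N -> (f j < f i)%N) ->
  0 <= \det (\matrix_(i < k, b < k) ((m b <= f i)%N%:R : R)).
Proof.
elim: k m f => [|k IH] m f md fd; first by rewrite det_mx00.
have [mf|fm] := leqP (m 0%N) (f 0%N); last first.
  rewrite (expand_det_col _ ord0) big1// => i _; rewrite !mxE /=.
  suff -> : (m 0%N <= f i)%N = false by rewrite mul0r.
  apply: negbTE; rewrite -ltnNge; apply: leq_ltn_trans fm.
  case: i => [[|i] ik] //=; apply: ltnW; exact: fd.
case: k => [|k] in IH md fd *.
  by rewrite det_mx11 mxE ler0n.
have [mf1|fm1] := leqP (m 0%N) (f 1%N).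
  have e : ord0 != inord 1 :> 'I_k.+2 by rewrite -val_eqE /= inordK.
  rewrite (determinant_alternate e)// => b; rewrite !mxE /= inordK//.
  have mb : (m b <= m 0%N)%N.
    case: b => [[|b] bk] //=; apply: ltnW; exact: md.
  by rewrite !(leq_trans mb).
rewrite (expand_det_col _ ord0) (bigD1 ord0)//= big1 ?addr0; last first.
  move=> i i0; rewrite !mxE /=.
  suff -> : (m 0%N <= f i)%N = false by rewrite mul0r.
  apply: negbTE; rewrite -ltnNge; apply: leq_ltn_trans fm1.
  case: i i0 => [[|[|i]] ik] //= _; apply: ltnW; exact: fd.
rewrite !mxE /= mf mul1r /cofactor expr0 mul1r.
have := IH (fun i => m i.+1) (fun i => f i.+1).
set M := \matrix_(i, j) _; set M' := row' _ _.
have -> : M' = M by apply/matrixP => i j; rewrite !mxE /= /bump !leq0n !add1n.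
by apply=> i j ij jk; [apply: md|apply: fd].
Qed.

End DetLemmas.

(** * Alternants *)

Section Alternants.
Variables (R : realType) (G : bcd_type).
Notation p := (charp R G).
Notation phi := (@phi R G).

Definition vdm (N : nat) (y : nat -> R) : R :=
  \prod_(0 <= j < N) \prod_(0 <= i < j) (y i - y j).

(** Numerator of the character, in the variables [z + 2 + z^-1]. *)
Definition alt (N : nat) (lam : GT N) (y : nat -> R) : R :=
  \det (\matrix_(i < N, a < N) (p (gtl lam i)).[y a]).

(** Coefficient of [alt mu] in the determinant of the values of [F], by
    [det_horner_expand]. *)
Definition cdet (k : nat) (F : nat -> {poly R}) (mu : GT k) : R :=
  \det (\matrix_(i < k, b < k) phi (gtl mu b) (F i)).

Lemma vdmS N y : vdm N.+1 y = vdm N y * \prod_(0 <= i < N) (y i - y N).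
Proof. by rewrite /vdm big_nat_recr. Qed.

Lemma eq_vdm N y y' : (forall a, (a < N)%N -> y a = y' a) -> vdm N y = vdm N y'.
Proof.
move=> h; rewrite /vdm !big_nat; apply: eq_bigr => j /andP[_ jN].
rewrite !big_nat; apply: eq_bigr => i /andP[_ ij].
by rewrite !h//; exact: ltn_trans jN.
Qed.

Lemma eq_alt N (lam : GT N) y y' : (forall a, (a < N)%N -> y a = y' a) ->
  alt lam y = alt lam y'.
Proof. by move=> h; congr (\det _); apply/matrixP => i a; rewrite !mxE h. Qed.

Lemma vdm_neq0P N y : (forall i j, (i < j)%N -> (j < N)%N -> y i != y j) -> vdm N y != 0.
Proof.
move=> h; rewrite /vdm big_nat prodf_seq_neq0; apply/allP => j _.
apply/implyP => /andP[_ jN]; rewrite big_nat prodf_seq_neq0; apply/allP => i _.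
by apply/implyP => /andP[_ ij]; rewrite subr_eq0 h.
Qed.

(** Two coordinates coincide as soon as the Vandermonde product vanishes. *)
Lemma alt_vdm0 N (lam : GT N) y : vdm N y = 0 -> alt lam y = 0.
Proof.
move=> v0; have [i [j [ij jN yij]]] : exists i j, [/\ (i < j)%N, (j < N)%N & y i = y j].
  apply: contrapT => h; move/eqP: v0; apply/negP; apply: vdm_neq0P => i j ij jN.
  by apply/eqP => yij; apply: h; exists i, j.
have iN := ltn_trans ij jN.
rewrite /alt -det_tr (@determinant_alternate _ _ _ (Ordinal iN) (Ordinal jN))//.
  by rewrite -val_eqE /= ltn_eqF.
by move=> b; rewrite !mxE /= yij.
Qed.

Lemma det_horner_expand k B (F : nat -> {poly R}) (y : nat -> R) :
  (forall i, (i < k)%N -> (size (F i) <= B)%N) ->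
  \det (\matrix_(i < k, a < k) (F i).[y a]) =
  \sum_(mu <- gtseq k B) cdet F mu * alt mu y.
Proof.
move=> hs.
have -> : \matrix_(i < k, a < k) (F i).[y a] =
   (\matrix_(i < k, m < B) phi m (F i)) *m (\matrix_(m < B, a < k) (p m).[y a]).
  apply/matrixP => i a; rewrite !mxE (horner_expand G _ (hs i (ltn_ord i))).
  by apply: eq_bigr => m _; rewrite !mxE.
rewrite cauchy_binet /gtseq big_map big_enum_cond /=.
apply: eq_big => [g|g gd]; first by rewrite ?unfold_in ?andbT.
rewrite /cdet /alt; congr (_ * _); congr (determinant _).
  by apply/matrixP => i b; rewrite !mxE gtl_gt_of_ffun.
by apply/matrixP => i b; rewrite !mxE gtl_gt_of_ffun.
Qed.

Lemma cdet_out k B (F : nat -> {poly R}) (mu : GT k) :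
  (forall i, (i < k)%N -> (size (F i) <= B)%N) -> mu \notin gtseq k B -> cdet F mu = 0.
Proof.
move=> hs mu_notin.
have [b Bb] : exists b : 'I_k, (B <= gtl mu b)%N.
  apply: contrapT => h; move/negP: mu_notin; apply; apply: mem_gtseq => i.
  by rewrite ltnNge; apply/negP => Bi; apply: h; exists i.
rewrite /cdet (expand_det_col _ b) big1// => i _; rewrite !mxE.
by rewrite phi_size ?mul0r// (leq_trans (hs i (ltn_ord i))).
Qed.

End Alternants.

(** * Branching *)

Section Branching.
Variables (R : realType) (G : bcd_type).
Notation p := (charp R G).
Notation phi := (@phi R G).
Notation alt := (@alt R G).
Notation cdet := (@cdet R G).
Notation dwt := (cd_weight R G).

Section OneStep.
Variables (N : nat) (lam : GT N.+1) (v : R).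
Hypothesis v4 : 4 <= v.
Let pv m : 0 < (p m).[v]. Proof. exact: charp_gt0. Qed.

Definition step_weight (l : nat) : R := ((p l.+1).[v] * (p l).[v])^-1.

Lemma step_weight_gt0 l : 0 < step_weight l.
Proof. by rewrite invr_gt0 mulr_gt0. Qed.

(** Quotient by ['X - v] of the difference of two consecutive normalized
    polynomials, expanded by the Christoffel-Darboux formula. *)
Definition step_poly (i : nat) : {poly R} :=
  \sum_(gtl lam i.+1 <= l < gtl lam i)
    step_weight l *: \sum_(m < l.+1) (dwt m * (p m).[v]) *: p m.

Lemma step_polyE i x : (i < N)%N ->
  (p (gtl lam i)).[x] / (p (gtl lam i)).[v] -
  (p (gtl lam i.+1)).[x] / (p (gtl lam i.+1)).[v] = (x - v) * (step_poly i).[x].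
Proof.
move=> iN.
have ll : (gtl lam i.+1 <= gtl lam i)%N by apply: ltnW; exact: gtl_decr.
rewrite -(@telescope_sumr_eq _ _ _ (fun l => (p l).[x] / (p l).[v])
  (fun l => (p l.+1).[x] / (p l.+1).[v] - (p l).[x] / (p l).[v]) ll)//.
rewrite horner_sum mulr_sumr; apply: eq_bigr => l _.
have h : \sum_(m < l.+1) dwt m * ((p m).[x] * (p m).[v]) =
    (\sum_(m < l.+1) (dwt m * (p m).[v]) *: p m).[x].
  rewrite horner_sum; apply: eq_bigr => m _; rewrite hornerZ; lra.
rewrite hornerZ -h mulrCA -christoffel_darboux /step_weight.
have n0 := lt0r_neq0 (pv l); have n1 := lt0r_neq0 (pv l.+1).
rewrite invfM mulrBr; congr (_ - _).
  by rewrite mulrACA mulVf// mulr1 mulrC.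
by rewrite [X in _ = _ * X]mulrC mulrACA mulVf// mul1r mulrC.
Qed.

Lemma phi_step_poly m i : phi m (step_poly i) = dwt m * (p m).[v] *
  \sum_(gtl lam i.+1 <= l < gtl lam i) step_weight l * (m <= l)%N%:R.
Proof.
rewrite linear_sum /= mulr_sumr; apply: eq_bigr => l _.
rewrite phiZ (phi_sum_charp G _ (fun m => dwt m * (p m).[v])) ltnS.
by case: ifP => _; rewrite /= ?mulr0 ?mulr1 ?mulr0n ?mulr1n // mulrC.
Qed.

Let A : 'M[R]_(N, gtl lam 0) := \matrix_(i < N, l < gtl lam 0)
  (step_weight l * ((gtl lam i.+1 <= l) && (l < gtl lam i))%N%:R).

(** Expansion of the rows over the intervals [gtl lam i.+1 <= l < gtl lam i],
    which are disjoint: what remains are determinants covered by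
    [det_staircase]. *)
Lemma step_det (mu : GT N) :
  cdet step_poly mu = (\prod_(b < N) (dwt (gtl mu b) * (p (gtl mu b)).[v])) *
    \sum_(f : {ffun 'I_N -> 'I_(gtl lam 0)}) (\prod_i A i (f i)) *
      \det (\matrix_(i < N, b < N) ((gtl mu b <= f i)%N%:R : R)).
Proof.
rewrite /cdet.
have -> : \matrix_(i < N, b < N) phi (gtl mu b) (step_poly i) =
   \matrix_(i < N, b < N) ((dwt (gtl mu b) * (p (gtl mu b)).[v]) *
     \sum_(gtl lam i.+1 <= l < gtl lam i) step_weight l * (gtl mu b <= l)%N%:R).
  by apply/matrixP => i b; rewrite !mxE phi_step_poly.
rewrite (det_scale_col N (fun b => dwt (gtl mu b) * (p (gtl mu b)).[v])
  (fun i b => \sum_(gtl lam i.+1 <= l < gtl lam i) step_weight l * (gtl mu b <= l)%N%:R)).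
congr (_ * _).
pose C := \matrix_(l < gtl lam 0, b < N) ((gtl mu b <= l)%N%:R : R).
have -> : \matrix_(i < N, b < N) (\sum_(gtl lam i.+1 <= l < gtl lam i)
    step_weight l * (gtl mu b <= l)%N%:R) = A *m C.
  apply/matrixP => i b; rewrite !mxE.
  under [RHS]eq_bigr do rewrite !mxE mulrAC.
  rewrite -(big_mkord xpredT (fun l => step_weight l * (gtl mu b <= l)%N%:R *
    ((gtl lam i.+1 <= l) && (l < gtl lam i))%N%:R)).
  have l1 : (gtl lam i.+1 <= gtl lam i)%N.
    by apply: ltnW; apply: gtl_decr => //; rewrite ltnS.
  have l0 : (gtl lam i <= gtl lam 0)%N.
    case: i {l1} => [[|i] iN] //=; apply: ltnW; apply: gtl_decr => //; exact: ltnW.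
  rewrite [RHS](@big_cat_nat _ _ _ (gtl lam i.+1))//=; last exact: leq_trans l1 l0.
  rewrite [X in _ = X + _]big_nat [X in _ = X + _]big1 ?add0r; last first.
    by move=> l /andP[_ ll]; rewrite [(gtl lam i.+1 <= l)%N]leqNgt ll mulr0.
  rewrite [RHS](@big_cat_nat _ _ _ (gtl lam i))//= [X in _ = _ + X]big_nat.
  rewrite [X in _ = _ + X]big1 ?addr0; last first.
    by move=> l /andP[ll _]; rewrite [(l < _)%N]ltnNge ll andbF mulr0.
  rewrite [LHS]big_nat [RHS]big_nat; apply: eq_bigr => l /andP[ll lu].
  by rewrite ll lu mulr1.
rewrite det_mulmx_rowsub; apply: eq_bigr => f _; congr (_ * \det _).
by apply/matrixP => i b; rewrite !mxE.
Qed.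

Lemma step_entry_ge0 i l : 0 <= A i l.
Proof. by rewrite mxE mulr_ge0// ltW// step_weight_gt0. Qed.

Lemma step_term_ge0 (mu : GT N) (f : {ffun 'I_N -> 'I_(gtl lam 0)}) :
  0 <= (\prod_i A i (f i)) * \det (\matrix_(i < N, b < N) ((gtl mu b <= f i)%N%:R : R)).
Proof.
have [/forallP hf|] := boolP [forall i : 'I_N, (gtl lam i.+1 <= f i) && (f i < gtl lam i)]%N; last first.
  rewrite negb_forall => /existsP [i hi].
  by rewrite (bigD1 i)//= mxE (negPf hi) mulr0 !mul0r.
apply: mulr_ge0; first by apply: prodr_ge0 => i _; exact: step_entry_ge0.
pose fn i := oapp (fun i : 'I_N => f i : nat) 0%N (insub i).
have fnE (i : 'I_N) : fn i = f i by rewrite /fn valK.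
have -> : \matrix_(i < N, b < N) ((gtl mu b <= f i)%N%:R : R) =
    \matrix_(i < N, b < N) ((gtl mu b <= fn i)%N%:R : R).
  by apply/matrixP => i b; rewrite !mxE fnE.
apply: (det_staircase R (m := gtl mu)) => [i j ij jN|i j ij jN]; first exact: gtl_decr.
have iN := ltn_trans ij jN.
rewrite (fnE (Ordinal iN)) (fnE (Ordinal jN)).
have /andP[h1 _] := hf (Ordinal iN); have /andP[_ h2] := hf (Ordinal jN).
apply: leq_trans h2 (leq_trans _ h1) => /=.
move: ij; rewrite leq_eqVlt => /orP[/eqP->//|ij].
by apply: ltnW; apply: gtl_decr => //; exact: leqW.
Qed.

Lemma step_coef_gt0 m : 0 < dwt m * (p m).[v].
Proof. by rewrite mulr_gt0 ?cd_weight_gt0. Qed.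

Lemma cdet_step_ge0 (mu : GT N) : 0 <= cdet step_poly mu.
Proof.
rewrite step_det mulr_ge0//.
  by apply: prodr_ge0 => b _; rewrite ltW// step_coef_gt0.
by apply: sumr_ge0 => f _; exact: step_term_ge0.
Qed.

(** A signature with positive coefficient, so that strict positivity
    propagates along the branching rule. *)
Definition step_witness : GT N := toGT N (fun r => (gtL lam r.+1).-1).

Lemma gtl_step_witness i : (i < N)%N -> gtl step_witness i = (gtl lam i).-1.
Proof.
move=> iN; rewrite /gtl gtL_toGT; last lia.
  by congr (gtL _ _).-1; lia.
move=> r r' rr rN; have := gtL_increasing lam (r := r.+1) (r' := r'.+1) rr rN.
have := increasing_ge (gtL_increasing lam) (_ : r.+1 < N.+1)%N.
by move=> /(_ (ltn_trans rr rN)); lia.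
Qed.

Lemma cdet_step_gt0 : 0 < cdet step_poly step_witness.
Proof.
rewrite step_det mulr_gt0//.
  by apply: prodr_gt0 => b _; exact: step_coef_gt0.
have lpos i : (i < N)%N -> (0 < gtl lam i)%N.
  by move=> iN; have := gtl_decr lam (ltnSn i) (iN : i.+1 < N.+1)%N; lia.
have f0P (i : 'I_N) : ((gtl lam i).-1 < gtl lam 0)%N.
  have := lpos i (ltn_ord i); case: i => [[|i] iN] /=; first lia.
  by have := gtl_decr lam (ltn0Sn i) (ltnW iN : i.+1 < N.+1)%N; lia.
pose f0 := [ffun i => Ordinal (f0P i)].
rewrite (bigD1 f0)//= ltr_pwDl//; last by apply: sumr_ge0 => f _; exact: step_term_ge0.
apply: mulr_gt0.
  apply: prodr_gt0 => i _; rewrite mxE mulr_gt0 ?step_weight_gt0// ffunE /=.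
  have h := gtl_decr lam (ltnSn i) (ltn_ord i : i.+1 < N.+1)%N.
  by rewrite (_ : _ && _) ?ltr01//; apply/andP; split; lia.
rewrite -det_tr det_trig.
  rewrite prodr_gt0// => i _; rewrite !mxE ffunE /= gtl_step_witness//.
  by rewrite leqnn.
apply/is_trig_mxP => i j ij; rewrite !mxE ffunE /= gtl_step_witness//.
have h := gtl_decr lam ij (ltnW (ltn_ord j) : j < N.+1)%N.
by rewrite (_ : (_ <= _)%N = false)//; apply/negbTE; have := lpos _ (ltn_ord j); lia.
Qed.

(** Normalized by their value at [v], the rows of the alternant agree at the
    last point; their successive differences are divisible by [y a - v]. *)
Lemma alt_branch (y : nat -> R) B : y N = v ->
  (forall i, (i < N)%N -> (size (step_poly i) <= B)%N) ->
  alt lam y = (\prod_(i < N.+1) (p (gtl lam i)).[v]) * (\prod_(0 <= a < N) (y a - v)) *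
    \sum_(mu <- gtseq N B) cdet step_poly mu * alt mu y.
Proof.
move=> yN hs.
pose g i a := (p (gtl lam i)).[y a] / (p (gtl lam i)).[v].
rewrite -(det_horner_expand G y hs) -mulrA.
have -> : alt lam y = \det (\matrix_(i < N.+1, a < N.+1) ((p (gtl lam i)).[v] * g i a)).
  congr (\det _); apply/matrixP => i a; rewrite !mxE /g.
  by rewrite mulrC divfK// gt_eqF.
rewrite (det_scale_row _ (fun i => (p (gtl lam i)).[v]) g); congr (_ * _).
rewrite det_row_diff; last by move=> i _; rewrite /g yN divff// gt_eqF.
rewrite big_mkord -(det_scale_col _ (fun a => y a - v) (fun i a => (step_poly i).[y a])).
by congr (\det _); apply/matrixP => i a; rewrite !mxE /g step_polyE.
Qed.

End OneStep.

End Branching.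

(** * Transition probabilities as determinants *)

Section Levels.
Variables (R : realType) (G : bcd_type) (q : R).
Hypotheses (q_gt0 : 0 < q) (q_lt1 : q < 1).
Notation p := (charp R G).
Notation node := (node G q).
Notation phi := (@phi R G).
Notation gpoly := (gpoly G q).
Notation hpoly := (hpoly G q).
Notation alt := (@alt R G).
Notation cdet := (@cdet R G).

Let node4 := node_ge4 G q_gt0.

Lemma vdm_node_neq0 N : vdm N node != 0.
Proof. by apply: vdm_neq0P => i j ij jN; rewrite lt_eqF// node_ltn. Qed.

Definition schur (N : nat) (lam : GT N) (y : nat -> R) : R := alt lam y / vdm N y.

Lemma schurE N (lam : GT N) y : schur lam y = alt lam y / vdm N y.
Proof. by []. Qed.

Lemma exists_size_bound (F : nat -> {poly R}) k :
  exists B, forall i, (i < k)%N -> (size (F i) <= B)%N.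
Proof.
exists (\max_(i < k) size (F i)) => i ik.
exact: (leq_bigmax (Ordinal ik)).
Qed.

Lemma schur_branch N (lam : GT N.+1) (y : nat -> R) B : 4 <= y N -> vdm N.+1 y != 0 ->
  (forall i, (i < N)%N -> (size (step_poly G lam (y N) i) <= B)%N) ->
  schur lam y = (\prod_(i < N.+1) (p (gtl lam i)).[y N]) *
    \sum_(mu <- gtseq N B) cdet (step_poly G lam (y N)) mu * schur mu y.
Proof.
move=> y4 v0 hs; rewrite /schur (alt_branch y4 (erefl _) hs).
move: v0; rewrite vdmS mulf_eq0 negb_or => /andP[v0 t0].
rewrite -!mulrA; congr (_ * _).
rewrite invfM mulrCA [X in _ * X = _]mulrCA divff// mulr1.
rewrite mulr_suml; apply: eq_bigr => mu _; by rewrite mulrA.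
Qed.

Lemma schur_node_gt0 N (lam : GT N) : 0 < schur lam node.
Proof.
elim: N lam => [|N IH] lam.
  by rewrite /schur /alt det_mx00 /vdm big_geq// divr1.
have [B hB] := exists_size_bound (step_poly G lam (node N)) N.
rewrite (schur_branch (node4 N) (vdm_node_neq0 _) hB) mulr_gt0//.
  by apply: prodr_gt0 => i _; exact: charp_gt0.
have ge0 (mu : GT N) : 0 <= cdet (step_poly G lam (node N)) mu * schur mu node.
  by apply: mulr_ge0; [exact: (cdet_step_ge0 G lam (node4 N) mu)|exact: ltW].
have wgt0 := cdet_step_gt0 G lam (node4 N).
have win : step_witness lam \in gtseq N B.
  apply: contraT => h; move: wgt0; rewrite (cdet_out G hB h) ltxx//.
rewrite (big_rem _ win)/= ltr_pwDl//; first by rewrite mulr_gt0.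
by apply: sumr_ge0.
Qed.

Lemma alt_node_neq0 N (lam : GT N) : alt lam node != 0.
Proof.
have := schur_node_gt0 lam; rewrite /schur => /lt0r_neq0.
by rewrite mulf_eq0 negb_or => /andP[].
Qed.

(** By [gpoly_interp] the matrix of the alternant factors through the values
    of the dual basis, which are unit vectors at the nodes. *)
Lemma alt_corner N k (lam : GT N) y : (k <= N)%N ->
  (forall a, (k <= a)%N -> (a < N)%N -> y a = node a) ->
  alt lam y = alt lam node * \det (\matrix_(j < k, a < k) (gpoly N (gtL lam) j).[y a]).
Proof.
move=> kN yE.
have Li := gtL_increasing lam.
rewrite -(det_corner (f := fun j a => (gpoly N (gtL lam) j).[y a]) kN); last first.
  by move=> j a jN aN ka; rewrite yE// gpoly_node// eq_sym.
rewrite -det_mulmx; congr (\det _); apply/matrixP => i a; rewrite !mxE.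
rewrite -(gpoly_interp G q_gt0 q_lt1 (y a) Li (_ : N - i.+1 < N)%N); last first.
  by have := ltn_ord i; lia.
by apply: eq_bigr => j _; rewrite !mxE.
Qed.

Definition tailprod (N k : nat) (y : nat -> R) : R :=
  \prod_(a < k) \prod_(k <= i < N) (y a - node i).

Lemma tailprod_node_neq0 N k : tailprod N k node != 0.
Proof.
rewrite /tailprod prodf_seq_neq0; apply/allP => a _ /=.
rewrite big_nat prodf_seq_neq0; apply/allP => i _; apply/implyP => /andP[ki _].
rewrite subr_eq0; apply/eqP => /(node_inj q_gt0 q_lt1) e.
by have := ltn_ord a; lia.
Qed.

Lemma det_gpoly_hpoly N k L (y : nat -> R) : increasing N L -> (k <= N)%N ->
  \det (\matrix_(j < k, a < k) (gpoly N L j).[y a]) =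
  tailprod N k y / tailprod N k node *
  \det (\matrix_(j < k, a < k) (hpoly N L k j).[y a]).
Proof.
move=> Li kN.
pose c a := \prod_(k <= i < N) (y a - node i).
pose d j := (\prod_(k <= i < N) (node j - node i))^-1.
have -> : \matrix_(j < k, a < k) (gpoly N L j).[y a] =
    \matrix_(j < k, a < k) (c a * (d j * (hpoly N L k j).[y a])).
  apply/matrixP => j a; rewrite !mxE -(hpolyM G q_gt0 q_lt1 Li (ltn_ord j) kN) hornerM.
  rewrite mulrCA mulrA mulrC; congr (_ * _).
  rewrite horner_prod /c /d -prodfV -big_split /=; apply: eq_bigr => i _.
  by rewrite horner_lfactor -opprB -[in LHS](opprB (node j)) invrN mulrNN mulrC.
rewrite (det_scale_col _ c (fun j a => d j * (hpoly N L k j).[y a])).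
rewrite (det_scale_row _ d (fun j a => (hpoly N L k j).[y a])) mulrA.
congr (_ * _ * _); rewrite /tailprod /d -prodfV//.
Qed.

Lemma vdm_tail N k y : (k <= N)%N ->
  (forall a, (k <= a)%N -> (a < N)%N -> y a = node a) ->
  vdm N y * (vdm k node * tailprod N k node) = vdm N node * (vdm k y * tailprod N k y).
Proof.
move=> kN; rewrite -(subnKC kN); move: (N - k)%N => m {N kN}.
elim: m => [|m IH] yE.
  rewrite addn0 /tailprod !big1 => [|a _|a _]; rewrite ?big_geq//; lra.
have tS z : tailprod (k + m.+1) k z = tailprod (k + m) k z * \prod_(a < k) (z a - node (k + m)).
  rewrite /tailprod -big_split; apply: eq_bigr => a _.
  by rewrite addnS big_nat_recr ?leq_addr.
have vS z : (forall a, (k <= a)%N -> (a < k + m.+1)%N -> z a = node a) ->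
    vdm (k + m.+1) z = vdm (k + m) z * (\prod_(a < k) (z a - node (k + m)) *
    \prod_(k <= a < k + m) (node a - node (k + m))).
  move=> zE; rewrite addnS vdmS; congr (_ * _).
  rewrite (@big_cat_nat _ _ _ k)//= ?leq_addr// big_mkord; congr (_ * _).
    by apply: eq_bigr => a _; rewrite (zE (k + m)%N)// ?leq_addr// addnS.
  rewrite big_nat [RHS]big_nat; apply: eq_bigr => a /andP[ka ak].
  by rewrite !zE ?leq_addr//; lia.
have {}IH := IH (fun a h1 h2 => yE a h1 (leq_trans h2 (leq_add (leqnn k) (leqnSn m)))).
rewrite !tS (vS y yE) (vS node (fun _ _ _ => erefl)).
set P := \prod_(a < k) _; set P0 := \prod_(a < k) _; set Q := \prod_(k <= a < _) _.
move/(congr1 (fun x => x * (P * Q * P0))): IH; lra.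
Qed.

(** The matrix [Lambda^N_k], by [iter_trans]. *)
Definition trans (N k : nat) (lam : GT N) (mu : GT k) : R :=
  alt mu node * cdet (hpoly N (gtL lam) k) mu.

(** Generating function of a row of [trans]. By [alt_free] it determines the
    row. *)
Lemma schur_expand N k (lam : GT N) y B : (k <= N)%N ->
  (forall a, (k <= a)%N -> (a < N)%N -> y a = node a) -> vdm N y != 0 ->
  (forall j, (j < k)%N -> (size (hpoly N (gtL lam) k j) <= B)%N) ->
  schur lam y / schur lam node =
  \sum_(mu <- gtseq k B) trans lam mu * (schur mu y / schur mu node).
Proof.
move=> kN yE v0 hs; have Li := gtL_increasing lam.
have vk0 : vdm k y != 0.
  move: v0; rewrite -(subnKC kN); move: (N - k)%N => m.
  elim: m => [|m IH]; first by rewrite addn0.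
  by rewrite addnS vdmS mulf_eq0 negb_or => /andP[/IH].
have a0 := alt_node_neq0 lam; have vN0 := vdm_node_neq0 N.
have t0 := tailprod_node_neq0 N k; have vk := vdm_node_neq0 k.
transitivity (\det (\matrix_(j < k, a < k) (hpoly N (gtL lam) k j).[y a]) *
    (vdm k node / vdm k y)).
  rewrite /schur (alt_corner lam kN yE) det_gpoly_hpoly//.
  set D := \det _; set T := tailprod N k y; set T0 := tailprod N k node in t0 *.
  have := vdm_tail kN yE; rewrite -/T -/T0.
  move: (vdm N y) v0 (vdm N node) vN0 (vdm k node) vk (vdm k y) vk0 => a a0' b b0 c cn0 d d0 e.
  set A := alt lam node in a0 *.
  transitivity (D * (T * b / (T0 * a))).
    rewrite !invfM !invrK.
    transitivity ((A * A^-1) * (D * (T * b * (T0^-1 * a^-1)))); first lra.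
    by rewrite divff// mul1r.
  congr (_ * _); apply/eqP; rewrite eqr_div ?mulf_neq0//.
  by apply/eqP; move: e; lra.
rewrite (det_horner_expand G y hs) mulr_suml; apply: eq_bigr => mu _.
rewrite /trans /schur invf_div.
rewrite (_ : alt mu node * _ * _ =
  cdet (hpoly N (gtL lam) k) mu * (alt mu y * (vdm k node / vdm k y)) * (alt mu node / alt mu node)); last lra.
by rewrite divff ?alt_node_neq0// mulr1 mulrA.
Qed.

Lemma trans_out N k (lam : GT N) (mu : GT k) B :
  (forall j, (j < k)%N -> (size (hpoly N (gtL lam) k j) <= B)%N) ->
  mu \notin gtseq k B -> trans lam mu = 0.
Proof. by move=> hs h; rewrite /trans (cdet_out G hs h) mulr0. Qed.

(** Inverting the matrix of the values of the polynomials at the nodes of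
    index at least [M] recovers the coefficients. These nodes leave room for
    completing a point by smaller nodes without repetition. *)
Lemma alt_free M k (s : seq (GT k)) (d : GT k -> R) : uniq s ->
  (forall y : nat -> R, (forall a, exists2 n, (M <= n)%N & y a = node n) ->
     \sum_(mu <- s) d mu * alt mu y = 0) ->
  forall nu, nu \in s -> d nu = 0.
Proof.
move=> us h nu nus.
pose B := (\max_(mu <- s) \max_(i < k) (gtl mu i).+1)%N.
have ltB mu (i : 'I_k) : mu \in s -> (gtl mu i < B)%N.
  move=> mus; apply: (@leq_trans (\max_(i < k) (gtl mu i).+1)%N).
    exact: (leq_bigmax i).
  exact: (@leq_bigmax_seq _ s xpredT (fun mu => \max_(i < k) (gtl mu i).+1)%N mu mus isT).
pose L t := (M + t)%N.
have Li : increasing B L by move=> r r' rr _; rewrite ltn_add2l.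
pose Q := \matrix_(i < k, t < B) phi (gtl nu i) (node_lagrange G q B L t).
pose P (mu : GT k) := \matrix_(t < B, b < k) (p (gtl mu b)).[node (L t)].
have QP mu : mu \in s -> Q *m P mu = \matrix_(i < k, b < k) (gtl nu i == gtl mu b)%:R.
  move=> mus; apply/matrixP => i b; rewrite !mxE.
  rewrite -(node_lagrange_biorth2 G q_gt0 q_lt1 (Ordinal (ltB nu i nus)) (Ordinal (ltB mu b mus)) Li).
  by apply: eq_bigr => t _; rewrite !mxE.
have dQP mu : mu \in s -> \det (Q *m P mu) = (mu == nu)%:R.
  move=> mus; rewrite QP//; have [->|munu] := eqVneq mu nu.
    rewrite (_ : \matrix_(i, b) _ = 1%:M) ?det1//; apply/matrixP => i b; rewrite !mxE.
    have [->|ib] := eqVneq i b; first by rewrite eqxx.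
    congr (_%:R); apply/eqP; rewrite eqb0; move: ib; rewrite -val_eqE /=.
    case: (ltngtP i b) => // hib _.
      by rewrite gtn_eqF// gtl_decr.
    by rewrite ltn_eqF// gtl_decr.
  rewrite /determinant big1// => sg _.
  suff [i hi] : exists i : 'I_k, gtl nu i != gtl mu (sg i).
    by rewrite (bigD1 i)//= mxE (negPf hi) mul0r mulr0.
  apply: contrapT => hn; move/eqP: munu; apply.
  have e (i : 'I_k) : gtl nu i = gtl mu (sg i).
    by apply/eqP; apply: contrapT => hi; apply: hn; exists i; apply/negP.
  pose gn := ffun_of_gt (fun i => ltB nu i nus).
  pose gm := ffun_of_gt (fun i => ltB mu i mus).
  have [gg _] : gn = gm /\ 1%g = sg.
    apply: decreasing_perm_inj; try exact: ffun_of_gt_decreasing.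
    by apply/ffunP => i; rewrite !ffunE perm1; apply: val_inj => /=.
  apply: gtl_inj => i; move/ffunP: gg => /(_ i); rewrite !ffunE => /(congr1 val) /= //.
have : \sum_(mu <- s) d mu * \det (Q *m P mu) = 0.
  under eq_bigr => mu _ do rewrite det_mulmx_rowsub mulr_sumr.
  rewrite exchange_big big1//= => f _.
  pose y (a : nat) : R := oapp (fun a : 'I_k => node (L (f a))) (node M) (insub a).
  have hy a : exists2 n, (M <= n)%N & y a = node n.
    rewrite /y; case: insubP => [i _ _|_] /=; last by exists M.
    by exists (L (f i)) => //; rewrite leq_addr.
  have := h y hy => /(congr1 (fun x => (\prod_i Q i (f i)) * x)); rewrite mulr0 mulr_sumr => e.
  rewrite -[RHS]e; apply: eq_bigr => mu _; rewrite mulrCA; congr (_ * (_ * _)).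
  rewrite -det_tr; congr (\det _); apply/matrixP => i a; rewrite !mxE.
  by rewrite /y valK.
rewrite (big_rem _ nus) /= dQP// eqxx mulr1 big_seq big1 ?addr0// => mu mus.
rewrite dQP ?(mem_rem mus)//.
case: eqP => [e|]; last by rewrite mulr0.
by move: mus; rewrite e mem_rem_uniqF.
Qed.

End Levels.

(** * Laurent polynomials *)

Lemma sum_uniq_incl (V : zmodType) (T : eqType) (s t : seq T) (F : T -> V) :
  uniq s -> uniq t -> {subset s <= t} -> (forall x, x \notin s -> F x = 0) ->
  \sum_(x <- s) F x = \sum_(x <- t) F x.
Proof.
move=> us ut st F0; rewrite [RHS](bigID (mem s)) /= [X in _ + X]big1 ?addr0//.
rewrite -[RHS]big_filter; apply: perm_big; apply: uniq_perm => //; first exact: filter_uniq.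
by move=> x; rewrite mem_filter /=; case: (boolP (x \in s)) => // /st ->.
Qed.

Section LaurentRep.
Variables (R : realType) (N : nat).
Implicit Types (f g : N.-tuple R -> R) (z : N.-tuple R).

Definition nonzero z := forall j, tnth z j != 0.

Definition monomial (e : {ffun 'I_N -> int}) z : R := \prod_(j < N) tnth z j ^ e j.

(** The functions which are Laurent polynomials at the points with nonzero
    coordinates; closure under the ring operations is easier to show than for
    the coefficient families themselves. *)
Definition lrep f := exists s : seq ({ffun 'I_N -> int} * R),
  forall z, nonzero z -> f z = \sum_(x <- s) x.2 * monomial x.1 z.

Lemma eq_lrep f g : (forall z, nonzero z -> f z = g z) -> lrep f -> lrep g.
Proof. by move=> fg [s hs]; exists s => z z0; rewrite -fg// hs. Qed.

Lemma lrep_const c : lrep (fun=> c).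
Proof.
exists [:: ([ffun=> 0], c)] => z z0; rewrite big_seq1 /monomial /= big1 ?mulr1//.
by move=> j _; rewrite ffunE expr0z.
Qed.

Lemma lrep_var j (m : int) : lrep (fun z => tnth z j ^ m).
Proof.
exists [:: ([ffun i => if i == j then m else 0], 1)] => z z0.
rewrite big_seq1 mul1r /monomial /= (bigD1 j)//= big1 ?mulr1.
  by rewrite ffunE eqxx.
by move=> i ij; rewrite ffunE (negPf ij) expr0z.
Qed.

Lemma lrepD f g : lrep f -> lrep g -> lrep (fun z => f z + g z).
Proof.
by move=> [s hs] [t ht]; exists (s ++ t) => z z0; rewrite big_cat hs// ht.
Qed.

Lemma monomialD (d e : {ffun 'I_N -> int}) z : nonzero z ->
  monomial [ffun i => d i + e i] z = monomial d z * monomial e z.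
Proof.
move=> z0; rewrite /monomial -big_split; apply: eq_bigr => j _.
by rewrite ffunE expfzDr.
Qed.

Lemma lrepM f g : lrep f -> lrep g -> lrep (fun z => f z * g z).
Proof.
move=> [s hs] [t ht].
pose mul2 (x y : {ffun 'I_N -> int} * R) := ([ffun i => x.1 i + y.1 i], x.2 * y.2).
exists [seq mul2 x y | x <- s, y <- t] => z z0.
rewrite hs// ht// mulr_suml big_allpairs_dep; apply: eq_bigr => x _.
rewrite mulr_sumr; apply: eq_bigr => y _ /=.
by rewrite monomialD// mulrACA.
Qed.

Lemma lrep_sum (I : Type) (r : seq I) (P : pred I) (F : I -> N.-tuple R -> R) :
  (forall i, lrep (F i)) -> lrep (fun z => \sum_(i <- r | P i) F i z).
Proof.
move=> h; elim: r => [|i r IH].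
  by apply: eq_lrep (lrep_const 0) => z _; rewrite big_nil.
case Pi: (P i); last by apply: eq_lrep IH => z _; rewrite big_cons Pi.
by apply: eq_lrep (lrepD (h i) IH) => z _; rewrite big_cons Pi.
Qed.

Lemma lrep_prod (I : Type) (r : seq I) (P : pred I) (F : I -> N.-tuple R -> R) :
  (forall i, lrep (F i)) -> lrep (fun z => \prod_(i <- r | P i) F i z).
Proof.
move=> h; elim: r => [|i r IH].
  by apply: eq_lrep (lrep_const 1) => z _; rewrite big_nil.
case Pi: (P i); last by apply: eq_lrep IH => z _; rewrite big_cons Pi.
by apply: eq_lrep (lrepM (h i) IH) => z _; rewrite big_cons Pi.
Qed.

Lemma lrepX f n : lrep f -> lrep (fun z => f z ^+ n).
Proof.
move=> h; elim: n => [|n IH]; first exact: lrep_const.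
by apply: eq_lrep (lrepM h IH) => z _; rewrite exprS.
Qed.

Lemma lrep_det n (F : 'I_n -> 'I_n -> N.-tuple R -> R) :
  (forall i j, lrep (F i j)) -> lrep (fun z => \det (\matrix_(i, j) F i j z)).
Proof.
move=> h.
apply: (eq_lrep (f := fun z => \sum_(s : 'S_n) (-1) ^+ s * \prod_i F i (s i) z)).
  move=> z _; apply: eq_bigr => s _; congr (_ * _).
  by apply: eq_bigr => i _; rewrite mxE.
by apply: lrep_sum => s; apply: lrepM; [exact: lrep_const|exact: lrep_prod].
Qed.

Lemma lrep_leval (P : laurent R N) : lrep (leval P).
Proof.
exists [seq (a, P a) | a <- finsupp P] => z _.
by rewrite big_map.
Qed.

Lemma lrepP f : lrep f -> exists P : laurent R N, forall z, nonzero z -> leval P z = f z.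
Proof.
move=> [s hs]; pose u := undup [seq x.1 | x <- s].
pose c a := \sum_(x <- s | x.1 == a) x.2.
pose P : laurent R N := [fsfun a in [fset b in u]%fset => c a].
have PE a : P a = c a.
  rewrite fsfunE; case: ifPn => //; rewrite !inE mem_undup => au.
  rewrite /c big_seq_cond big1// => x /andP[xs /eqP xa].
  by move/negP: au; case; apply/mapP; exists x.
exists P => z z0; rewrite hs// /leval.
rewrite (@sum_uniq_incl _ _ _ u) ?fset_uniq//; last 3 first.
- exact: undup_uniq.
- move=> a; rewrite mem_finsupp PE mem_undup => ca; apply: contraR ca => au.
  rewrite /c big_seq_cond big1// => x /andP[xs /eqP xa].
  by move/negP: au; case; apply/mapP; exists x.
- by move=> a; rewrite mem_finsupp negbK => /eqP ->; rewrite mul0r.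
transitivity (\sum_(a <- u) \sum_(x <- s) (if x.1 == a then x.2 * monomial x.1 z else 0)).
  apply: eq_bigr => a _; rewrite PE /c mulr_suml big_mkcond; apply: eq_bigr => x _.
  by case: eqP => [<-|].
rewrite exchange_big big_seq [RHS]big_seq; apply: eq_bigr => x xs.
rewrite (bigD1_seq x.1) ?undup_uniq//=; last first.
  by rewrite mem_undup; apply/mapP; exists x.
rewrite eqxx big1 ?addr0// => a ax.
by rewrite eq_sym (negPf ax).
Qed.

Variables (pt : nat -> nat -> R).
Hypothesis pt0 : forall j t, pt j t != 0.
Hypothesis pt_inj : forall j, injective (pt j).

Definition product_point z := exists t : 'I_N -> nat, forall j, tnth z j = pt j (t j).

(** Inverting Vandermonde matrices coordinatewise recovers the coefficients
    from the values on a product of infinite sets. *)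
Lemma laurent_uniq (P Q : laurent R N) :
  (forall z, product_point z -> leval P z = leval Q z) -> P = Q.
Proof.
move=> PQ; pose S := (finsupp P ++ finsupp Q).
pose M := (\max_(a <- S) \max_(j < N) `|a j|)%N.
(* The exponents lie between [- M] and [M]. *)
pose K := (M + M).+1.
pose V (j : 'I_N) : 'M[R]_K := \matrix_(t < K, n < K) (pt j t ^+ n * pt j t ^- M).
have VU j : V j \in unitmx.
  have -> : V j = diag_mx (\row_t (pt j t ^- M)) *m
      (Vandermonde K (\row_(t < K) pt j t))^T.
    apply/matrixP => t n; rewrite mul_diag_mx !mxE mulrC//.
  rewrite unitmx_mul unitmx_tr; apply/andP; split.
    rewrite unitmxE det_diag unitfE prodf_seq_neq0; apply/allP => t _ /=.
    by rewrite mxE invr_eq0 expf_neq0.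
  rewrite unitmxE det_Vandermonde unitfE prodf_seq_neq0; apply/allP => a _ /=.
  rewrite prodf_seq_neq0; apply/allP => b _; apply/implyP => ab.
  rewrite !mxE subr_eq0; apply/eqP => /(@pt_inj j) e.
  by move: ab; rewrite e ltnn.
pose W j := invmx (V j).
have WV j (m n : 'I_K) : \sum_(t < K) W j m t * V j t n = (m == n)%:R.
  have := mulVmx (VU j) => /matrixP /(_ m n); rewrite !mxE => <-.
  by apply: eq_bigr.
have MaxS a j : a \in S -> (`|a j| <= M)%N.
  move=> aS; apply: (@leq_trans (\max_(j < N) `|a j|)%N).
    exact: (leq_bigmax j).
  exact: (@leq_bigmax_seq _ S xpredT (fun a : {ffun 'I_N -> int} => \max_(j < N) `|a j|)%N a aS isT).
have idxP a j : a \in S -> (absz (a j + M%:Z)%R < K)%N.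
  by move=> /(MaxS _ j); rewrite /K; lia.
have VE j (t : 'I_K) a (aS : a \in S) : V j t (Ordinal (idxP a j aS)) = pt j t ^ a j.
  rewrite mxE /=.
  have -> : a j = (absz (a j + M%:Z)%R)%:Z - M%:Z by have := MaxS _ j aS; lia.
  rewrite [in RHS]expfzDr// exprnN; congr (_ ^+ _ * _).
  by have := MaxS _ j aS; lia.
pose zf (f : {ffun 'I_N -> 'I_K}) : N.-tuple R := [tuple pt j (f j) | j < N].
have key (T : laurent R N) e : {subset finsupp T <= S} -> e \in S ->
    (\sum_(f : {ffun 'I_N -> 'I_K})
    (\prod_j W j (inord (absz (e j + M%:Z)%R)) (f j)) * leval T (zf f)) = T e.
  move=> TS eS.
  transitivity (\sum_(a <- finsupp T) T a * (a == e)%:R).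
    under eq_bigr => f _ do rewrite /leval mulr_sumr.
    rewrite exchange_big big_seq [RHS]big_seq; apply: eq_bigr => a aT /=.
    have aS := TS a aT.
    transitivity (T a * \prod_j \sum_(t < K) W j (inord (absz (e j + M%:Z)%R)) t * V j t (Ordinal (idxP a j aS))).
      rewrite bigA_distr_bigA mulr_sumr; apply: eq_bigr => f _.
      rewrite mulrCA; congr (_ * _); rewrite big_split /=; congr (_ * _).
      by apply: eq_bigr => j _; rewrite VE tnth_mktuple.
    congr (_ * _); under eq_bigr => j _ do rewrite WV.
    have [ae|ae] := eqVneq a e.
      rewrite big1// => j _; rewrite (_ : _ == _)//; apply/eqP/val_inj.
      by rewrite /= inordK ?ae// idxP.
    have [j aej] : exists j, a j != e j.
      apply: contrapT => h; move/eqP: ae; apply; apply/ffunP => j; apply/eqP.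
      by apply: contrapT => hj; apply: h; exists j; apply/negP.
    rewrite (bigD1 j)//= (_ : _ == _ = false) ?mul0r//; apply/eqP => /(congr1 val) /=.
    rewrite inordK ?idxP// => h; move/eqP: aej; apply.
    move: h (MaxS _ j aS) (MaxS _ j eS); move: (a j) (e j) => x y. lia.
  have [eT|eT] := boolP (e \in finsupp T).
    rewrite (big_rem _ eT) /= eqxx mulr1 big_seq big1 ?addr0// => a aT.
    case: eqP => [ae|]; last by rewrite mulr0.
    by move: aT; rewrite ae mem_rem_uniqF ?fset_uniq.
  rewrite big_seq big1; first by rewrite fsfun_dflt.
  by move=> a aT; case: eqP => [ae|]; rewrite ?mulr0//; move: eT; rewrite -ae aT.
apply/fsfunP => e.
have [eS|eS] := boolP (e \in S); last first.
  by move: eS; rewrite mem_cat negb_or => /andP[eP eQ]; rewrite !fsfun_dflt.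
rewrite -(key P e)//; last by move=> a aP; rewrite mem_cat aP.
rewrite -(key Q e)//; last by move=> a aP; rewrite mem_cat aP orbT.
apply: eq_bigr => f _; congr (_ * _); apply: PQ.
by exists (fun j : 'I_N => nat_of_ord (f j)) => j; rewrite tnth_mktuple.
Qed.

Lemma lrep_uniq f g : lrep f -> lrep g ->
  (forall z, product_point z -> f z = g z) -> forall z, nonzero z -> f z = g z.
Proof.
move=> /lrepP [P hP] /lrepP [Q hQ] fg z z0; rewrite -hP// -hQ//.
suff -> : P = Q by [].
apply: laurent_uniq => w hw; have w0 : nonzero w.
  by case: hw => t ht j; rewrite ht.
by rewrite hP// hQ// fg.
Qed.

End LaurentRep.

(** * Division of the alternants by the Vandermonde product *)

Section Newton.
Variables (R : realType).
Implicit Types (f : {poly R}) (c x : R) (y : nat -> R).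

Definition divX (n : nat) f c : {poly R} :=
  \sum_(m < n) f`_m *: \sum_(i < m) c ^+ (m.-1 - i) *: 'X^i.

Lemma divX_horner n f c x : (size f <= n)%N ->
  f.[x] = f.[c] + (divX n f c).[x] * (x - c).
Proof.
move=> sn; rewrite !(horner_coef_wide _ sn) horner_sum mulr_suml -big_split /=.
apply: eq_bigr => m _; rewrite hornerZ horner_sum.
have : x ^+ m - c ^+ m = (\sum_(i < m) (c ^+ (m.-1 - i) *: 'X^i).[x]) * (x - c).
  rewrite -opprB subrXX -mulNr opprB mulrC; congr (_ * _); apply: eq_bigr => i _.
  by rewrite hornerZ hornerXn.
move=> h; rewrite -mulrA -h; lra.
Qed.

Lemma size_divX n f c : (size (divX n f c) <= n)%N.
Proof.
apply: leq_trans (size_sum _ _ _) _; apply/bigmax_leqP => m _.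
apply: leq_trans (size_scale_leq _ _) _.
apply: leq_trans (size_sum _ _ _) _; apply/bigmax_leqP => i _.
apply: leq_trans (size_scale_leq _ _) _.
by rewrite size_polyXn; apply: leq_trans (ltn_ord i) (ltnW (ltn_ord m)).
Qed.

Lemma coef_divX n f c i :
  (divX n f c)`_i = \sum_(m < n) f`_m * (if (i < m)%N then c ^+ (m.-1 - i) else 0).
Proof.
rewrite coef_sum; apply: eq_bigr => m _; rewrite coefZ coef_sum; congr (_ * _).
case: ifP => im.
  rewrite (bigD1 (Ordinal im))//= coefZ coefXn eqxx mulr1 big1 ?addr0// => j.
  by rewrite -val_eqE /= eq_sym coefZ coefXn => /negPf ->; rewrite mulr0.
rewrite big1// => j _; rewrite coefZ coefXn.
by rewrite gtn_eqF ?mulr0//; apply: leq_trans (ltn_ord j) _; rewrite leqNgt im.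
Qed.

Fixpoint newton_rest (n : nat) f y (j : nat) : {poly R} :=
  if j is j'.+1 then divX n (newton_rest n f y j') (y j') else f.

(** Divided differences, with alternating signs. *)
Definition newton_coef n f y j : R := (-1) ^+ j * (newton_rest n f y j).[y j].

Lemma size_newton_rest n f y j : (size f <= n)%N -> (size (newton_rest n f y j) <= n)%N.
Proof. by case: j => //= j _; exact: size_divX. Qed.

Lemma newton_horner n f y J x : (size f <= n)%N ->
  f.[x] = \sum_(j < J) newton_coef n f y j * \prod_(i < j) (y i - x)
    + (newton_rest n f y J).[x] * \prod_(i < J) (x - y i).
Proof.
move=> sn; elim: J => [|J IH]; first by rewrite !big_ord0 mulr1 add0r.
rewrite big_ord_recr /= [in RHS]big_ord_recr /= IH -addrA; congr (_ + _).
rewrite (divX_horner (y J) x (size_newton_rest y J sn)) mulrDl /newton_coef.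
congr (_ + _); last by rewrite mulrAC mulrA.
have -> : \prod_(i < J) (x - y i) = (-1) ^+ J * \prod_(i < J) (y i - x).
  rewrite -[X in _ ^+ X]card_ord -prodrN; apply: eq_bigr => i _; by rewrite opprB.
by rewrite mulrCA mulrA.
Qed.

(** Newton interpolation at [y] factors the matrix of values through a
    triangular matrix, with determinant the Vandermonde product; the other
    factor is polynomial in [y], which is how characters are seen to be
    Laurent polynomials. *)
Lemma newton_det N n (F : nat -> {poly R}) y :
  (forall i, (i < N)%N -> (size (F i) <= n)%N) ->
  \det (\matrix_(i < N, a < N) (F i).[y a]) =
  \det (\matrix_(i < N, j < N) newton_coef n (F i) y j) * vdm N y.
Proof.
move=> sn.
pose T := \matrix_(j < N, a < N) \prod_(i < j) (y i - y a).
have -> : \matrix_(i < N, a < N) (F i).[y a] =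
    (\matrix_(i < N, j < N) newton_coef n (F i) y j) *m T.
  apply/matrixP => i a; rewrite !mxE (newton_horner y N (y a) (sn i (ltn_ord i))).
  rewrite [X in _ + _ * X](bigD1 a)//= subrr mul0r mulr0 addr0.
  by apply: eq_bigr => j _; rewrite !mxE.
rewrite det_mulmx; congr (_ * _); rewrite -det_tr det_trig.
  by rewrite /vdm big_mkord; apply: eq_bigr => a _; rewrite !mxE big_mkord.
apply/is_trig_mxP => i j ij; rewrite !mxE.
by rewrite (bigD1 (Ordinal ij))//= subrr mul0r.
Qed.

End Newton.

(** * Characters *)

Section Characters.
Variables (R : realType) (G : bcd_type).
Notation p := (charp R G).
Notation alt := (@alt R G).

Definition svals (N : nat) (z : N.-tuple R) (a : nat) : R := symval (nth 1 z a).

Definition lrep_poly N (F : N.-tuple R -> {poly R}) := forall i, lrep (fun z => (F z)`_i).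

Lemma lrep_svals N (a : 'I_N) : lrep (fun z : N.-tuple R => svals z a).
Proof.
have h : lrep (fun z : N.-tuple R => tnth z a ^ 1 + 2 + tnth z a ^ (-1)).
  apply: lrepD; last exact: lrep_var.
  by apply: lrepD; [exact: lrep_var|exact: lrep_const].
apply: eq_lrep h => z z0.
by rewrite /svals /symval -(tnth_nth 1).
Qed.

Lemma lrep_newton_rest N n (f : {poly R}) j : (j <= N)%N ->
  lrep_poly (fun z : N.-tuple R => newton_rest n f (svals z) j).
Proof.
elim: j => [|j IH] jN i; first exact: (lrep_const N f`_i).
have hs : lrep (fun z : N.-tuple R => svals z j).
  exact: (lrep_svals (Ordinal jN)).
apply: (eq_lrep (f := fun z => \sum_(m < n) (newton_rest n f (svals z) j)`_m *
   (if (i < m)%N then svals z j ^+ (m.-1 - i) else 0))).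
  by move=> z _; rewrite /= coef_divX.
apply: lrep_sum => m; apply: lrepM; first exact: (IH (ltnW jN)).
by case: (i < m)%N; [exact: lrepX|exact: lrep_const].
Qed.

Definition schur_poly N (lam : GT N) (y : nat -> R) : R :=
  \det (\matrix_(i < N, j < N)
    newton_coef (\max_(i < N) size (p (gtl lam i))) (p (gtl lam i)) y j).

Lemma lrep_schur_poly N (lam : GT N) :
  lrep (fun z : N.-tuple R => schur_poly lam (svals z)).
Proof.
apply: lrep_det => i j; rewrite /newton_coef; set n := (\max_(_ < _) _)%N.
apply: lrepM; first exact: lrep_const.
apply: (eq_lrep (f := fun z : N.-tuple R =>
    \sum_(m < n) (newton_rest n (p (gtl lam i)) (svals z) j)`_m * svals z j ^+ m)).
  move=> z _; rewrite -horner_coef_wide// size_newton_rest//.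
  exact: (leq_bigmax i).
apply: lrep_sum => m; apply: lrepM; first by apply: lrep_newton_rest; exact: ltnW.
by apply: lrepX; exact: lrep_svals.
Qed.

Lemma schur_polyE N (lam : GT N) y : alt lam y = schur_poly lam y * vdm N y.
Proof.
by apply: (newton_det (F := fun i => p (gtl lam i))) => i iN; exact: (leq_bigmax (Ordinal iN)).
Qed.

Lemma schur_poly_schur N (lam : GT N) y : vdm N y != 0 ->
  schur_poly lam y = schur G lam y.
Proof. by move=> v0; rewrite /schur schur_polyE mulfK. Qed.

Lemma symm_vandermondeE N (z : N.-tuple R) : symm_vandermonde z = vdm N (svals z).
Proof.
rewrite /symm_vandermonde (exchange_big_dep xpredT)//= /vdm big_mkord.
apply: eq_bigr => j _; rewrite big_mkord.
rewrite (big_ord_widen N (fun i => svals z i - svals z j) (ltnW (ltn_ord j))).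
apply: eq_bigr => i _; rewrite /svals /symval -!(tnth_nth 1); lra.
Qed.

Lemma det_char_entry N (lam : GT N) (z : N.-tuple R) :
  (forall j, 0 < tnth z j /\ tnth z j != 1) ->
  \det (\matrix_(i < N, j < N) char_entry G (tnth (val lam) i + (N - i.+1)) (tnth z j))
  = alt lam (svals z).
Proof.
move=> hz; congr (\det _); apply/matrixP => i j; rewrite !mxE.
have [z0 z1] := hz j.
by rewrite char_entryE// -gtlE /svals -(tnth_nth 1).
Qed.

Section Points.
Variables (q : R).
Hypotheses (q_gt0 : 0 < q) (q_lt1 : q < 1).
Notation node := (node G q).

(** The residue of the index modulo [N.+1] separates the coordinates, also
    from [qnode N]: at the points of the product of these sets the Vandermonde
    product does not vanish, even after adding the coordinate [qnode N]. *)
Definition grid_pt (N : nat) (j t : nat) : R := qnode G q (N.+1 + j + t * N.+1).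

Lemma grid_pt_gt0 N j t : 0 < grid_pt N j t. Proof. exact: qnode_gt0. Qed.
Lemma grid_pt_neq0 N j t : grid_pt N j t != 0. Proof. by rewrite gt_eqF// grid_pt_gt0. Qed.

Lemma grid_pt_neq1 N j t : grid_pt N j t != 1.
Proof.
rewrite lt_eqF//; apply: le_lt_trans (qnode_le_exp G q_gt0 q_lt1 _) _.
by apply: qexp_lt1.
Qed.

Lemma qnode_inj : injective (qnode G q).
Proof. by move=> a b e; apply: (node_inj (G := G) q_gt0 q_lt1); rewrite -[LHS]/(symval (qnode G q a)) e. Qed.

Lemma grid_pt_inj N j : injective (grid_pt N j).
Proof.
move=> t t' /qnode_inj /addnI /eqP; rewrite eqn_pmul2r// => /eqP//.
Qed.

Lemma grid_vdm N (t : nat -> nat) (y : nat -> R) :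
  (forall j, (j < N)%N -> y j = symval (grid_pt N j (t j))) -> y N = node N ->
  vdm N.+1 y != 0.
Proof.
move=> yE yN; apply: vdm_neq0P => i j ij; rewrite ltnS leq_eqVlt => /orP[/eqP jN|jN].
  rewrite jN yN yE -?jN//; apply/eqP => /(node_inj q_gt0 q_lt1); lia.
have iN := ltn_trans ij jN; rewrite !yE//; apply/eqP => /(node_inj q_gt0 q_lt1).
move=> /(congr1 (modn^~ N.+1)); rewrite ![(_ + _ * N.+1)%N]addnC !modnMDl => /eqP.
rewrite eqn_modDl !modn_small ?ltnS ?(ltnW iN) ?(ltnW jN)//.
by rewrite ltn_eqF.
Qed.

End Points.

End Characters.

(** * The transition matrices *)

Section Graph.
Variables (R : realType) (G : bcd_type) (q : R).
Hypotheses (q_gt0 : 0 < q) (q_lt1 : q < 1).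
Notation node := (node G q).
Notation alt := (@alt R G).
Notation schur := (@schur R G).
Notation chi := (@chi R G).
Notation trans := (@trans R G q).
Notation cot := (cotransition q G).

Lemma grid_nonzero N (z : N.-tuple R) : product_point (grid_pt G q N) z -> nonzero z.
Proof. by move=> [t ht] j; rewrite ht grid_pt_neq0. Qed.

Lemma grid_svals N (z : N.-tuple R) : product_point (grid_pt G q N) z ->
  exists t : nat -> nat, forall j, (j < N)%N -> svals z j = symval (grid_pt G q N j (t j)).
Proof.
move=> [t ht]; exists (fun j => oapp t 0%N (insub j)) => j jN.
rewrite /svals -[j]/(nat_of_ord (Ordinal jN)) -(tnth_nth 1) ht.
by rewrite valK.
Qed.

Lemma grid_vdm_neq0 N (z : N.-tuple R) : product_point (grid_pt G q N) z ->
  vdm N (svals z) != 0.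
Proof.
move=> /grid_svals [t ht].
pose y a := if a == N then node N else svals z a.
have : vdm N.+1 y != 0.
  apply: (grid_vdm (G := G) q_gt0 q_lt1 (t := t)); last by rewrite /y eqxx.
  by move=> j jN; rewrite /y ltn_eqF// ht.
rewrite vdmS mulf_eq0 negb_or => /andP[v0 _].
by rewrite (eq_vdm (y' := y))// => a aN; rewrite /y ltn_eqF.
Qed.

Definition chi_spec N (lam : GT N) : set (laurent R N) :=
  [set P : laurent R N | forall z : N.-tuple R,
    (forall j, 0 < tnth z j /\ tnth z j != 1) -> symm_vandermonde z != 0 ->
    leval P z = (symm_vandermonde z)^-1 *
      \det (\matrix_(i < N, j < N)
              char_entry G (tnth (val lam) i + (N - i.+1)) (tnth z j))].

Lemma chi_spec_unique N (lam : GT N) (P Q : laurent R N) :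
  chi_spec lam P -> chi_spec lam Q -> P = Q.
Proof.
move=> hP hQ.
apply: (laurent_uniq (grid_pt_neq0 G q_gt0 N) (fun j => @grid_pt_inj _ G _ q_gt0 q_lt1 N j)).
move=> z zg.
have z01 j : 0 < tnth z j /\ tnth z j != 1.
  by case: zg => t ->; rewrite grid_pt_gt0// grid_pt_neq1.
have v0 : symm_vandermonde z != 0 by rewrite symm_vandermondeE grid_vdm_neq0.
by rewrite hP// hQ.
Qed.

Lemma leval_chi N (lam : GT N) (z : N.-tuple R) : nonzero z ->
  leval (chi lam) z = schur_poly G lam (svals z).
Proof.
have [P hP] := lrepP (lrep_schur_poly R G lam).
have specP : chi_spec lam P.
  move=> w w01; rewrite symm_vandermondeE => v0.
  rewrite hP; last by move=> j; rewrite gt_eqF//; case: (w01 j).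
  by rewrite schur_poly_schur// det_char_entry// schurE mulrC.
have spec : chi_spec lam (chi lam) := xgetPex [fsfun] (ex_intro (chi_spec lam) P specP).
by move=> z0; rewrite -hP//; congr (leval _ z); apply: (chi_spec_unique spec specP).
Qed.

Lemma svals_qpoint N a : (a < N)%N -> svals (qpoint q G N) a = node a.
Proof.
move=> aN; rewrite /svals -[a]/(nat_of_ord (Ordinal aN)) -(tnth_nth 1).
by rewrite tnth_mktuple.
Qed.

Lemma qpoint_nonzero N : nonzero (qpoint q G N).
Proof. by move=> j; rewrite tnth_mktuple gt_eqF// powR_gt0. Qed.

Lemma eq_schur N (lam : GT N) y y' : (forall a, (a < N)%N -> y a = y' a) ->
  schur lam y = schur lam y'.
Proof. by move=> h; rewrite !schurE (eq_alt _ _ h) (eq_vdm h). Qed.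

Lemma leval_chi_generic N (lam : GT N) z : nonzero z -> vdm N (svals z) != 0 ->
  leval (chi lam) z = schur lam (svals z).
Proof. by move=> z0 v0; rewrite leval_chi// schur_poly_schur. Qed.

Lemma leval_chi_qpoint N (lam : GT N) : leval (chi lam) (qpoint q G N) = schur lam node.
Proof.
have e a : (a < N)%N -> svals (qpoint q G N) a = node a by exact: svals_qpoint.
rewrite leval_chi_generic ?(eq_schur _ e)//; first exact: qpoint_nonzero.
by rewrite (eq_vdm e) vdm_node_neq0.
Qed.

(** ** One step *)

Lemma svals_rcons N (x : N.-tuple R) t a : (a <= N)%N ->
  svals [tuple of rcons x t] a = if a == N then symval t else svals x a.
Proof.
move=> aN; rewrite /svals nth_rcons size_tuple.
by case: ltngtP aN => // ->.
Qed.

Lemma nonzero_rcons N (x : N.-tuple R) t : nonzero x -> t != 0 ->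
  nonzero [tuple of rcons x t].
Proof.
move=> x0 t0 j; rewrite (tnth_nth 1) nth_rcons size_tuple.
case: ltnP => jN; last by case: (nat_of_ord j == N); rewrite ?oner_neq0.
by rewrite -[nat_of_ord j]/(nat_of_ord (Ordinal jN)) -tnth_nth.
Qed.

Lemma lrep_rcons N (P : laurent R N.+1) t : t != 0 ->
  lrep (fun x : N.-tuple R => leval P [tuple of rcons x t]).
Proof.
move=> t0; apply: lrep_sum => a; apply: lrepM; first exact: lrep_const.
apply: (eq_lrep (f := fun x : N.-tuple R =>
  (\prod_(j < N) tnth x j ^ a (widen_ord (leqnSn N) j)) * t ^ a ord_max)).
  move=> x _; rewrite big_ord_recr /=; congr (_ * _).
    apply: eq_bigr => j _; rewrite !(tnth_nth 1) /= nth_rcons size_tuple.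
    by rewrite ltn_ord.
  by rewrite (tnth_nth 1) /= nth_rcons size_tuple ltnn eqxx.
apply: lrepM; last exact: lrep_const.
by apply: lrep_prod => j; exact: lrep_var.
Qed.

(** Coefficient of the branching rule at [node N], normalized as the
    transition probabilities are. *)
Definition step_coef N (lam : GT N.+1) (mu : GT N) : R :=
  (\prod_(i < N.+1) (charp R G (gtl lam i)).[node N]) *
  cdet G (step_poly G lam (node N)) mu * schur mu node / schur lam node.

Lemma step_coef_ge0 N (lam : GT N.+1) mu : 0 <= step_coef lam mu.
Proof.
have s0 := schur_node_gt0 G q_gt0 q_lt1.
apply: divr_ge0; last by rewrite ltW.
apply: mulr_ge0; last by rewrite ltW.
apply: mulr_ge0; last by apply: cdet_step_ge0; exact: node_ge4.
by apply: prodr_ge0 => i _; rewrite ltW// charp_gt0// node_ge4.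
Qed.

Definition cot_spec N (lam : GT N.+1) : set {fsfun GT N -> R with 0} :=
  [set c : {fsfun GT N -> R with 0} | forall x : N.-tuple R, (forall j, tnth x j != 0) ->
  leval (chi lam) [tuple of rcons x (q `^ (N%:R + epsilon R G))]
    / leval (chi lam) (qpoint q G N.+1)
  = \sum_(mu <- finsupp c)
      c mu * (leval (chi mu) x / leval (chi mu) (qpoint q G N))].

Lemma step_coef_spec N (lam : GT N.+1) :
  exists2 c : {fsfun GT N -> R with 0}, (forall mu, c mu = step_coef lam mu) & cot_spec lam c.
Proof.
have [B hB] := exists_size_bound (step_poly G lam (node N)) N.
have out mu : mu \notin gtseq N B -> step_coef lam mu = 0.
  by move=> h; rewrite /step_coef (cdet_out G hB h) mulr0 !mul0r.
pose c : {fsfun GT N -> R with 0} :=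
  [fsfun mu in [fset mu in gtseq N B]%fset => step_coef lam mu].
have cE mu : c mu = step_coef lam mu.
  by rewrite fsfunE !inE; case: ifPn => // /out ->.
exists c => // x x0.
have t0 : qnode G q N != 0 by rewrite gt_eqF// qnode_gt0.
pose f := fun x : N.-tuple R => leval (chi lam) [tuple of rcons x (qnode G q N)]
    / leval (chi lam) (qpoint q G N.+1).
pose g := fun x : N.-tuple R => \sum_(mu <- finsupp c)
      c mu * (leval (chi mu) x / leval (chi mu) (qpoint q G N)).
have rf : lrep f by apply: lrepM; [exact: lrep_rcons|exact: lrep_const].
have rg : lrep g.
  apply: lrep_sum => mu; apply: lrepM; first exact: lrep_const.
  by apply: lrepM; [exact: lrep_leval|exact: lrep_const].
apply: (lrep_uniq (grid_pt_neq0 G q_gt0 N)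
  (fun j => @grid_pt_inj _ G _ q_gt0 q_lt1 N j) rf rg) x0 => {}x xg.
have x0 := grid_nonzero xg; rewrite /f /g.
set y := svals [tuple of rcons x (qnode G q N)].
have yN : y N = node N by rewrite /y svals_rcons// eqxx.
have yx a : (a < N)%N -> y a = svals x a.
  by move=> aN; rewrite /y svals_rcons 1?ltnW// ltn_eqF.
have vy : vdm N.+1 y != 0.
  have [t ht] := grid_svals xg; apply: (grid_vdm (G := G) q_gt0 q_lt1 (t := t) (y := y)) => // j jN.
  by rewrite yx// ht.
rewrite leval_chi_generic//; last exact: nonzero_rcons.
have := @schur_branch R G N lam y B; rewrite yN => br.
rewrite leval_chi_qpoint -/y (br (node_ge4 G q_gt0 N) vy hB) {br}.
rewrite mulr_sumr mulr_suml.
rewrite [RHS](@sum_uniq_incl _ _ _ (gtseq N B)) ?fset_uniq ?uniq_gtseq//; last 2 first.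
- move=> mu; rewrite mem_finsupp cE; apply: contraR => /out ->//.
- by move=> mu; rewrite mem_finsupp negbK => /eqP ->; rewrite mul0r.
apply: eq_bigr => mu _; rewrite cE leval_chi_qpoint leval_chi_generic ?grid_vdm_neq0//.
rewrite -(eq_schur _ yx) /step_coef.
have s0 := lt0r_neq0 (schur_node_gt0 G q_gt0 q_lt1 mu).
set A := \prod_(i < _) _; set C := cdet _ _ _.
transitivity (A * C * schur mu y / schur lam node * (schur mu node / schur mu node)).
  by rewrite divff// mulr1; lra.
lra.
Qed.

Lemma cot_spec_schur N (lam : GT N.+1) (c : {fsfun GT N -> R with 0}) (y : nat -> R) :
  cot_spec lam c ->
  (forall a, (a < N)%N -> exists n, y a = node n) -> y N = node N -> vdm N.+1 y != 0 ->
  \sum_(mu <- finsupp c) c mu * (schur mu y / schur mu node) =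
  schur lam y / schur lam node.
Proof.
move=> hc yn yN v0.
have [n hn] := choice (fun a : 'I_N => yn a (ltn_ord a)).
pose x := [tuple qnode G q (n a) | a < N].
have x0 : nonzero x by move=> j; rewrite tnth_mktuple gt_eqF// qnode_gt0.
have xy a : (a < N)%N -> svals x a = y a.
  move=> aN; rewrite /svals -[a]/(nat_of_ord (Ordinal aN)) -(tnth_nth 1).
  by rewrite tnth_mktuple hn.
have vN : vdm N y != 0 by move: v0; rewrite vdmS mulf_eq0 negb_or => /andP[].
have := hc _ x0; rewrite -/(qnode G q N).
have t0 : qnode G q N != 0 by rewrite gt_eqF// qnode_gt0.
have e a : (a < N.+1)%N -> svals [tuple of rcons x (qnode G q N)] a = y a.
  move=> aN; rewrite svals_rcons//; case: eqP => [->|/eqP aN']; first by rewrite yN.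
  by rewrite xy// ltn_neqAle aN'.
rewrite leval_chi_generic; [|exact: nonzero_rcons|by rewrite (eq_vdm e)].
rewrite leval_chi_qpoint (eq_schur _ e) => ->.
apply: eq_bigr => mu _; congr (_ * _).
by rewrite leval_chi_qpoint leval_chi_generic ?(eq_vdm xy)// (eq_schur _ xy).
Qed.

Definition with_tail k (y : nat -> R) a := if (a < k)%N then y a else node a.

Lemma with_tail_neq0 k N y : (k <= N)%N -> vdm k y != 0 ->
  (forall a, exists2 n, (N <= n)%N & y a = node n) -> vdm N (with_tail k y) != 0.
Proof.
move=> kN v0 yn.
suff h m : (k + m <= N)%N -> vdm (k + m) (with_tail k y) != 0.
  by have := h (N - k)%N; rewrite subnKC//; apply.
elim: m => [_|m IH kmN].
  rewrite addn0 (eq_vdm (y' := y))// => a ak; by rewrite /with_tail ak.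
rewrite addnS vdmS mulf_neq0 ?IH//; first by rewrite ltnW// -addnS.
rewrite big_nat prodf_seq_neq0; apply/allP => i _; apply/implyP => /andP[_ ik].
rewrite {2}/with_tail ltnNge leq_addr /= subr_eq0 /with_tail; rewrite addnS in kmN.
case: ifP => _; last by rewrite lt_eqF// node_ltn.
have [n Nn ->] := yn i; apply/eqP => /(node_inj q_gt0 q_lt1) e.
by move: kmN; rewrite -e ltnNge Nn.
Qed.

(** The difference of the two expansions is a combination of alternants which
    vanishes at all the points allowed in [alt_free]; where the Vandermonde
    product vanishes the alternants do as well. *)
Lemma schur_free M k (c c' : GT k -> R) (s s' : seq (GT k)) :
  uniq s -> uniq s' ->
  (forall mu, mu \notin s -> c mu = 0) -> (forall mu, mu \notin s' -> c' mu = 0) ->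
  (forall y : nat -> R, (forall a, exists2 n, (M <= n)%N & y a = node n) -> vdm k y != 0 ->
    \sum_(mu <- s) c mu * (schur mu y / schur mu node) =
    \sum_(mu <- s') c' mu * (schur mu y / schur mu node)) ->
  c =1 c'.
Proof.
move=> us us' c0 c0' h mu.
pose t := undup (s ++ s').
have s0 nu : schur nu node != 0 by rewrite gt_eqF// schur_node_gt0.
have ts : {subset s <= t} by move=> x xs; rewrite mem_undup mem_cat xs.
have ts' : {subset s' <= t} by move=> x xs; rewrite mem_undup mem_cat xs orbT.
have [mut|mut] := boolP (mu \in t); last first.
  by move: mut; rewrite mem_undup mem_cat negb_or => /andP[/c0 -> /c0' ->].
suff : (c mu - c' mu) / schur mu node = 0.
  by move/eqP; rewrite mulf_eq0 invr_eq0 (negPf (s0 _ mu)) orbF subr_eq0 => /eqP.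
apply: (@alt_free R G q q_gt0 q_lt1 M k t (fun mu => (c mu - c' mu) / schur mu node)) mut.
  exact: undup_uniq.
move=> y yn; have [v0|v0] := eqVneq (vdm k y) 0.
  by rewrite big1// => nu _; rewrite alt_vdm0// mulr0.
have := h y yn v0.
rewrite (@sum_uniq_incl _ _ _ t) ?undup_uniq//; last first.
  by move=> x /c0 ->; rewrite mul0r.
rewrite [in RHS](@sum_uniq_incl _ _ _ t) ?undup_uniq//; last first.
  by move=> x /c0' ->; rewrite mul0r.
move/eqP; rewrite -subr_eq0 -sumrB => /eqP /(congr1 (fun x => x * vdm k y)).
rewrite mul0r mulr_suml => e; rewrite -[RHS]e; apply: eq_bigr => nu _.
rewrite -mulrBl; set S0 := schur nu node; rewrite !schurE.
transitivity ((c nu - c' nu) / S0 * alt nu y * ((vdm k y)^-1 * vdm k y)); last lra.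
by rewrite mulVf// mulr1.
Qed.

Lemma cot_specP N (lam : GT N.+1) : cot_spec lam (cot lam).
Proof.
have [c _ hc] := step_coef_spec lam.
exact: (xgetPex [fsfun] (ex_intro (cot_spec lam) c hc)).
Qed.

Lemma eq_schur_tail k (mu : GT k) y : schur mu (with_tail k y) = schur mu y.
Proof. by apply: eq_schur => a ak; rewrite /with_tail ak. Qed.

Lemma cotE N (lam : GT N.+1) mu : cot lam mu = step_coef lam mu.
Proof.
have [c cE hc] := step_coef_spec lam; rewrite -cE.
apply: (@schur_free N.+1 _ _ _ (finsupp (cot lam)) (finsupp c)).
- exact: fset_uniq.
- exact: fset_uniq.
- by move=> nu h; rewrite fsfun_dflt.
- by move=> nu h; rewrite fsfun_dflt.
move=> y yn v0; have vt := with_tail_neq0 (leqnSn N) v0 yn.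
have ya a : (a < N)%N -> exists n, with_tail N y a = node n.
  by move=> aN; rewrite /with_tail aN; have [n _ ->] := yn a; exists n.
have yN : with_tail N y N = node N by rewrite /with_tail ltnn.
have := cot_spec_schur (cot_specP lam) ya yN vt.
rewrite -(cot_spec_schur hc ya yN vt).
by under eq_bigr do rewrite eq_schur_tail; under [in RHS]eq_bigr do rewrite eq_schur_tail.
Qed.

Lemma cot_ge0 N (lam : GT N.+1) mu : 0 <= cot lam mu.
Proof. by rewrite cotE step_coef_ge0. Qed.

(** ** Many steps *)

Notation citer := (cotransition_iter q G).

Lemma iter_ge0 m k (lam : GT (m + k)) (mu : GT k) : 0 <= citer lam mu.
Proof.
elim: m lam => [|m IH] lam /=; first by rewrite ler0n.
by apply: sumr_ge0 => nu _; rewrite mulr_ge0 ?cot_ge0.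
Qed.

Lemma iter_schur m k (lam : GT (m + k)) : exists s : seq (GT k),
  [/\ uniq s, (forall mu, mu \notin s -> citer lam mu = 0) &
  forall y : nat -> R, (forall a, (a < k)%N -> exists n, y a = node n) ->
   (forall a, (k <= a)%N -> y a = node a) -> vdm (m + k) y != 0 ->
   \sum_(mu <- s) citer lam mu * (schur mu y / schur mu node) =
   schur lam y / schur lam node].
Proof.
elim: m lam => [|m IH] lam.
  exists [:: lam]; split=> // [mu|y _ _ _] /=.
    by rewrite inE eq_sym => /negPf ->.
  by rewrite big_seq1 eqxx mul1r.
have [S hS] := choice IH.
pose D := finsupp (cot lam).
pose s := undup (flatten [seq S nu | nu <- D]).
have sub nu : nu \in D -> {subset S nu <= s}.
  move=> nuD x xS; rewrite mem_undup; apply/flattenP; exists (S nu) => //.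
  by apply/mapP; exists nu.
exists s; split; first exact: undup_uniq.
  move=> mu mus /=; rewrite big_seq big1// => nu nuD.
  have [_ h0 _] := hS nu; rewrite h0 ?mulr0//.
  by apply: contra mus; exact: sub.
move=> y yn yt v0.
have v0' : vdm (m + k) y != 0.
  by move: v0; rewrite addSn vdmS mulf_eq0 negb_or => /andP[].
rewrite -(cot_spec_schur (cot_specP lam) (y := y))//; last 2 first.
- move=> a amk; case: (ltnP a k) => [/yn//|/yt ->]; by exists a.
- by apply: yt; rewrite leq_addl.
transitivity (\sum_(mu <- s) \sum_(nu <- D)
    cot lam nu * (citer nu mu * (schur mu y / schur mu node))).
  by apply: eq_bigr => mu _; rewrite /= mulr_suml; apply: eq_bigr => nu _; rewrite -mulrA.
rewrite exchange_big /= big_seq [RHS]big_seq; apply: eq_bigr => nu nuD.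
have [us h0 hy] := hS nu.
rewrite -mulr_sumr -hy//; congr (_ * _); symmetry; apply: sum_uniq_incl => //.
- exact: undup_uniq.
- exact: sub.
- by move=> mu /h0 ->; rewrite mul0r.
Qed.

Lemma trans_support N k (lam : GT N) : exists s : seq (GT k),
  [/\ uniq s, (forall mu, mu \notin s -> trans lam mu = 0) &
  (k <= N)%N -> forall y : nat -> R,
   (forall a, (k <= a)%N -> (a < N)%N -> y a = node a) -> vdm N y != 0 ->
   \sum_(mu <- s) trans lam mu * (schur mu y / schur mu node) =
   schur lam y / schur lam node].
Proof.
have [B hB] := exists_size_bound (hpoly G q N (gtL lam) k) k.
exists (gtseq k B); split; first exact: uniq_gtseq.
  by move=> mu; exact: trans_out.
by move=> kN y yt v0; rewrite (schur_expand q_gt0 q_lt1 kN yt v0 hB).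
Qed.

(** Both sides have the generating function of [schur_expand]. *)
Lemma iter_trans m k (lam : GT (m + k)) (mu : GT k) : citer lam mu = trans lam mu.
Proof.
have [s [us s0 hs]] := iter_schur lam; have [t [ut t0 ht]] := trans_support k lam.
apply: (@schur_free (m + k) _ _ _ s t us ut s0 t0) => y yn v0.
have kN : (k <= m + k)%N by rewrite leq_addl.
have vt := with_tail_neq0 kN v0 yn.
have yt a : (k <= a)%N -> with_tail k y a = node a by rewrite /with_tail ltnNge => ->.
have ya a : (a < k)%N -> exists n, with_tail k y a = node n.
  by move=> ak; rewrite /with_tail ak; have [n _ ->] := yn a; exists n.
have e1 := hs _ ya yt vt.
have e2 := ht kN _ (fun a ka _ => yt a ka) vt.
rewrite (eq_bigr (fun mu => citer lam mu * (schur mu (with_tail k y) / schur mu node))); last first.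
  by move=> nu _; rewrite eq_schur_tail.
by rewrite e1 -e2; apply: eq_bigr => nu _; rewrite eq_schur_tail.
Qed.

Lemma trans_ge0 N k (lam : GT N) (mu : GT k) : (k <= N)%N -> 0 <= trans lam mu.
Proof.
move=> kN; move: lam; rewrite -(subnK kN) => lam.
by rewrite -iter_trans iter_ge0.
Qed.

(** The generating function at the nodes themselves. *)
Lemma trans_sum1 N k (lam : GT N) : (k <= N)%N -> exists s : seq (GT k),
  [/\ uniq s, (forall mu, mu \notin s -> trans lam mu = 0) &
  \sum_(mu <- s) trans lam mu = 1].
Proof.
move=> kN; have [s [us s0 hs]] := trans_support k lam; exists s; split=> //.
have n0 l (nu : GT l) : schur nu node != 0 by rewrite gt_eqF// schur_node_gt0.
have := hs kN node (fun _ _ _ => erefl) (vdm_node_neq0 G q_gt0 q_lt1 N).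
rewrite divff// => <-; apply: eq_bigr => mu _; by rewrite divff// mulr1.
Qed.

(** The expansion at level [k.+1], followed by one step, has the generating
    function of the expansion at level [k]. *)
Lemma trans_comp N k (lam : GT N) : (k < N)%N -> exists s : seq (GT k.+1),
  [/\ uniq s, (forall nu, nu \notin s -> trans lam nu = 0) &
  forall mu : GT k, trans lam mu = \sum_(nu <- s) trans lam nu * cot nu mu].
Proof.
move=> kN; have [s [us s0 hs]] := trans_support k.+1 lam; exists s; split=> //.
have [t [ut t0 ht]] := trans_support k lam.
pose c mu := \sum_(nu <- s) trans lam nu * cot nu mu.
pose u := undup (flatten [seq enum_fset (finsupp (cot nu)) | nu <- s]).
have sub nu : nu \in s -> {subset finsupp (cot nu) <= u}.
  move=> nus x xS; rewrite mem_undup; apply/flattenP; exists (enum_fset (finsupp (cot nu))) => //.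
  by apply/mapP; exists nu.
apply: (@schur_free N k _ c t u) => //.
- exact: undup_uniq.
- move=> mu muu; rewrite /c big_seq big1// => nu nus.
  rewrite [cot nu mu]fsfun_dflt ?mulr0//; apply: contra muu; exact: sub.
move=> y yn v0; have vt := with_tail_neq0 (ltnW kN) v0 yn.
have yt a : (k <= a)%N -> with_tail k y a = node a by rewrite /with_tail ltnNge => ->.
have vk : vdm k.+1 (with_tail k y) != 0.
  by apply: with_tail_neq0 => // a; have [n Nn ->] := yn a; exists n => //; exact: leq_trans Nn.
transitivity (schur lam (with_tail k y) / schur lam node).
  rewrite -(ht (ltnW kN) _ (fun a ka _ => yt a ka) vt).
  by apply: eq_bigr => nu _; rewrite eq_schur_tail.
rewrite -(hs kN _ (fun a ka _ => yt a (ltnW ka)) vt).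
transitivity (\sum_(mu <- u) \sum_(nu <- s)
    trans lam nu * (cot nu mu * (schur mu y / schur mu node))); last first.
  by apply: eq_bigr => mu _; rewrite /c mulr_suml; apply: eq_bigr => nu _; rewrite mulrA.
rewrite exchange_big /= big_seq [RHS]big_seq; apply: eq_bigr => nu nus.
rewrite -mulr_sumr; congr (_ * _).
rewrite -(cot_spec_schur (cot_specP nu) (y := with_tail k y))//; last 2 first.
- by move=> a ak; rewrite /with_tail ak; have [n _ ->] := yn a; exists n.
- exact: yt.
rewrite [LHS](@sum_uniq_incl _ _ _ u) ?fset_uniq ?undup_uniq//; last 2 first.
- exact: sub.
- by move=> mu h; rewrite [cot nu mu]fsfun_dflt ?mul0r.
by apply: eq_bigr => mu _; rewrite eq_schur_tail.
Qed.

Lemma cot_le1 N (lam : GT N.+1) mu : cot lam mu <= 1.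
Proof.
have e : cot lam mu = trans lam mu.
  rewrite -(@iter_trans 1 N lam mu) /=.
  have [muD|muD] := boolP (mu \in finsupp (cot lam)).
    rewrite (big_rem _ muD) /= eqxx mulr1 big_seq big1 ?addr0// => nu nuD.
    case: eqP => [e|]; last by rewrite mulr0.
    by move: nuD; rewrite e mem_rem_uniqF ?fset_uniq.
  rewrite [LHS]fsfun_dflt// big_seq big1// => nu nuD.
  by case: eqP => [e|]; rewrite ?mulr0//; move: muD; rewrite -e nuD.
have [s [us s0 hs]] := trans_sum1 lam (leqnSn N).
rewrite e; have [mus|/s0 ->//] := boolP (mu \in s).
rewrite -hs (big_rem _ mus) /= lerDl; apply: sumr_ge0 => nu _.
by apply: trans_ge0.
Qed.

End Graph.

(** * Dependence of the laws on the exponents *)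

Section ProductDifference.
Variables (R : realFieldType) (I : finType).
Implicit Types (a b c : I -> R).

Lemma normr_prodB a b (r : seq I) :
  `|\prod_(i <- r) a i - \prod_(i <- r) b i| <=
  \prod_(i <- r) (`|b i| + `|a i - b i|) - \prod_(i <- r) `|b i|.
Proof.
elim: r => [|i r IH]; first by rewrite !big_nil !subrr normr0.
rewrite !big_cons.
set A := \prod_(j <- r) a j in IH *; set B := \prod_(j <- r) b j in IH *.
set C := \prod_(j <- r) (_ + _) in IH *; set D := \prod_(j <- r) `|b j| in IH *.
have AC : `|A| <= C.
  rewrite /A /C normr_prod; apply: ler_prod => j _; rewrite normr_ge0 /=.
  by rewrite -{1}(subrK (b j) (a j)) addrC ler_normD.
have -> : a i * A - b i * B = (a i - b i) * A + b i * (A - B) by lra.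
apply: le_trans (ler_normD _ _) _; rewrite !normrM.
have h1 : `|a i - b i| * `|A| <= `|a i - b i| * C by rewrite ler_wpM2l.
have h2 : `|b i| * `|A - B| <= `|b i| * (C - D) by rewrite ler_wpM2l.
lra.
Qed.

Lemma prodD_sub_le a b (r : seq I) (C d : R) :
  (forall i, 0 <= a i <= C) -> (forall i, 0 <= b i <= d) ->
  \prod_(i <- r) (a i + b i) - \prod_(i <- r) a i <= (C + d) ^+ size r - C ^+ size r.
Proof.
move=> ha hb; elim: r => [|i r IH]; first by rewrite !big_nil !expr0 !subrr.
have /andP[a0 aC] := ha i; have /andP[b0 bd] := hb i.
rewrite !big_cons /= !exprS.
set A := \prod_(j <- r) (_ + _) in IH *; set B := \prod_(j <- r) a j in IH *.
set X := (C + d) ^+ _ in IH *; set Y := C ^+ _ in IH *.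
have AX : A <= X.
  rewrite /A /X.
  have : \prod_(j <- r) (a j + b j) <= \prod_(j <- r) (C + d).
    apply: ler_prod => j _; have /andP[? ?] := ha j; have /andP[? ?] := hb j.
    by rewrite addr_ge0// lerD.
  by rewrite big_const_seq count_predT iter_mulr_1.
have AB : 0 <= A - B.
  rewrite subr_ge0; apply: ler_prod => j _; have /andP[? ?] := ha j; have /andP[? ?] := hb j.
  by apply/andP; split=> //; rewrite lerDl.
have A0 : 0 <= A.
  by apply: prodr_ge0 => j _; have /andP[? ?] := ha j; have /andP[? ?] := hb j; rewrite addr_ge0.
have h1 : a i * (A - B) <= C * (X - Y).
  by apply: ler_pM.
have h2 : b i * A <= d * X by apply: ler_pM.
lra.
Qed.

Lemma expD_sub_le (C d E : R) k : 0 <= C -> 0 <= d -> d <= E ->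
  (C + d) ^+ k - C ^+ k <= d * (k%:R * (C + E + 1) ^+ k).
Proof.
move=> C0 d0 dE; rewrite subrXX addrAC subrr add0r ler_wpM2l//.
have h : \sum_(i < k) (C + d) ^+ (k.-1 - i) * C ^+ i <= \sum_(i < k) (C + E + 1) ^+ k.
  apply: ler_sum => i _.
  apply: (@le_trans _ _ ((C + E + 1) ^+ (k.-1 - i) * (C + E + 1) ^+ i)).
    apply: ler_pM; rewrite ?exprn_ge0//; first lra.
      by rewrite lerXn2r ?nnegrE//; lra.
    by rewrite lerXn2r ?nnegrE//; lra.
  rewrite -exprD; apply: ler_weXn2l; first lra.
  by have := ltn_ord i; lia.
by apply: le_trans h _; rewrite sumr_const card_ord mulr_natl.
Qed.

End ProductDifference.

Section Stability.
Variables (R : realType) (G : bcd_type) (q : R).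
Hypotheses (q_gt0 : 0 < q) (q_lt1 : q < 1).
Notation p := (charp R G).
Notation node := (node G q).
Notation phi := (@phi R G).
Notation nrm := (@nrm R G).
Notation alt := (@alt R G).
Notation cdet := (@cdet R G).

Let node4 := node_ge4 G q_gt0.

Lemma normr_det_le n (A : 'M[R]_n) (b : 'I_n -> R) : (forall i j, `|A i j| <= b i) ->
  `|\det A| <= n`!%:R * \prod_i b i.
Proof.
move=> hA; rewrite /determinant; apply: le_trans (ler_norm_sum _ _ _) _.
apply: (@le_trans _ _ (\sum_(s : 'S_n) \prod_i b i)).
  apply: ler_sum => s _; rewrite normrM normrX normrN1 expr1n mul1r normr_prod.
  by apply: ler_prod => i _; rewrite normr_ge0 hA.
by rewrite sumr_const card_Sn mulr_natl.
Qed.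

Lemma normr_alt_le k (mu : GT k.+1) :
  `|alt mu node| <= k.+1`!%:R * \prod_(b < k.+1) (p (gtl mu b)).[node k].
Proof.
apply: normr_det_le => i j; rewrite mxE gtr0_norm ?charp_gt0//.
apply: charp_monotone => //; apply: node_leq => //.
by rewrite -ltnS.
Qed.

(** The factor [alt mu node] is compensated by the norms at [node k], so that
    closeness of the dual bases gives closeness in total variation. *)
Lemma sum_cdet_sub_le k (h h' : nat -> {poly R}) (C d : R) (s : seq (GT k.+1)) :
  uniq s ->
  (forall j, (j <= k)%N -> nrm (node k) (h' j) <= C) ->
  (forall j, (j <= k)%N -> nrm (node k) (h j - h' j) <= d) ->
  \sum_(mu <- s) `|alt mu node * cdet h mu - alt mu node * cdet h' mu| <=
  (k.+1`!%:R) ^+ 2 * ((C + d) ^+ k.+1 - C ^+ k.+1).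
Proof.
move=> us hC hd.
have [B1 hB1] := exists_size_bound h k.+1.
have [B2 hB2] := exists_size_bound h' k.+1.
have [B3 hB3] := exists_size_bound (fun j => h j - h' j) k.+1.
pose B0 := maxn B1 (maxn B2 B3).
pose B := maxn B0 (\max_(mu <- s) \max_(i < k.+1) (gtl mu i).+1)%N.
have sB : {subset s <= gtseq k.+1 B}.
  move=> mu mus; apply: mem_gtseq => i.
  apply: leq_trans (leq_maxr _ _).
  apply: (@leq_trans (\max_(i < k.+1) (gtl mu i).+1)%N); first exact: (leq_bigmax i).
  exact: (@leq_bigmax_seq _ s xpredT (fun mu => \max_(i < k.+1) (gtl mu i).+1)%N mu mus isT).
have BB0 : (B0 <= B)%N by rewrite leq_maxl.
have B1B : (B1 <= B)%N by apply: leq_trans BB0; rewrite leq_max leqnn.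
have B2B : (B2 <= B)%N by apply: leq_trans BB0; rewrite !leq_max leqnn orbT.
have B3B : (B3 <= B)%N by apply: leq_trans BB0; rewrite !leq_max leqnn !orbT.
pose K := k.+1.
pose X (f : {ffun 'I_K -> 'I_B}) := K`!%:R * \prod_(b < K) (p (f b)).[node k] *
  `|\det (\matrix_(i < K, b < K) phi (f b) (h i)) - \det (\matrix_(i < K, b < K) phi (f b) (h' i))|.
have pk m : 0 < (p m).[node k] by rewrite charp_gt0.
have X0 f : 0 <= X f.
  by rewrite mulr_ge0// mulr_ge0// prodr_ge0// => b _; rewrite ltW.
apply: (@le_trans _ _ (\sum_(mu <- gtseq K B) `|alt mu node * cdet h mu - alt mu node * cdet h' mu|)).
  rewrite [leRHS](bigID (mem s)) /= -[leLHS]addr0; apply: lerD; last exact: sumr_ge0.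
  rewrite -[leRHS]big_filter le_eqVlt; apply/orP; left; apply/eqP/perm_big/uniq_perm => //.
    by rewrite filter_uniq// uniq_gtseq.
  by move=> mu; rewrite mem_filter /=; case: (boolP (mu \in s)) => // /sB ->.
apply: (@le_trans _ _ (\sum_(f : {ffun 'I_K -> 'I_B}) X f)).
  rewrite /gtseq big_map big_enum_cond /=.
  rewrite [leRHS](bigID (@decreasing K B)) /= -[leLHS]addr0; apply: lerD; last exact: sumr_ge0.
  rewrite (eq_bigl (@decreasing K B)); last by move=> g; rewrite ?unfold_in ?andbT.
  apply: ler_sum => g gd; rewrite -mulrBr normrM /X.
  apply: ler_pM => //.
    apply: le_trans (normr_alt_le _) _; rewrite ler_wpM2l//.
    rewrite le_eqVlt; apply/orP; left; apply/eqP; apply: eq_bigr => b _.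
    by rewrite gtl_gt_of_ffun.
  rewrite /cdet; set M1 := \matrix_(_, _) _; set M2 := \matrix_(_, _) _.
  set M3 := \matrix_(_, _) _; set M4 := \matrix_(_, _) _.
  have -> : M1 = M3 by apply/matrixP => i b; rewrite !mxE gtl_gt_of_ffun.
  by have -> : M2 = M4 by apply/matrixP => i b; rewrite !mxE gtl_gt_of_ffun.
pose u (j : 'I_K) (m : 'I_B) := `|phi m (h' j)| * (p m).[node k].
pose v (j : 'I_K) (m : 'I_B) := `|phi m (h j - h' j)| * (p m).[node k].
(* Expanding both determinants, the weights [(p (f b)).[node k]] are shared
   among the factors; summing over all [f] then turns products of coefficients
   into products of norms. *)
pose Y (f : {ffun 'I_K -> 'I_B}) := \prod_j (u j (f j) + v j (f j)) - \prod_j u j (f j).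
have XY f : X f <= K`!%:R * \sum_(s : 'S_K) Y [ffun j => f (s j)].
  rewrite /X -mulrA ler_wpM2l//.
  rewrite /determinant -sumrB.
  apply: le_trans (_ : _ <= (\prod_(b < K) (p (f b)).[node k]) * \sum_(s0 : 'S_K)
     `|\prod_i phi (f (s0 i)) (h i) - \prod_i phi (f (s0 i)) (h' i)|) _.
    rewrite ler_wpM2l//; first by apply: prodr_ge0 => b _; rewrite ltW.
    apply: le_trans (ler_norm_sum _ _ _) _; apply: ler_sum => s0 _.
    rewrite -mulrBr normrM normrX normrN1 expr1n mul1r.
    under eq_bigr do rewrite mxE.
    by under [X in _ - X]eq_bigr do rewrite mxE.
  rewrite mulr_sumr; apply: ler_sum => s0 _.
  rewrite (reindex_perm s0) /=.
  apply: le_trans (ler_wpM2l _ (normr_prodB _ _ _)) _.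
    by apply: prodr_ge0 => b _; rewrite ltW.
  rewrite mulrBr -!big_split /= /Y le_eqVlt; apply/orP; left; apply/eqP.
  congr (_ - _); apply: eq_bigr => j _; rewrite ffunE /u /v.
    by rewrite -linearB /=; lra.
  by rewrite mulrC.
apply: le_trans (ler_sum _ (fun f _ => XY f)) _.
rewrite -mulr_sumr expr2 -mulrA ler_wpM2l// exchange_big /=.
have -> : K`!%:R * ((C + d) ^+ k.+1 - C ^+ k.+1) =
    \sum_(s0 : 'S_K) ((C + d) ^+ k.+1 - C ^+ k.+1).
  by rewrite sumr_const card_Sn mulr_natl.
apply: ler_sum => s0 _.
have inj : injective (fun f : {ffun 'I_K -> 'I_B} => [ffun j => f ((s0^-1)%g j)]).
  move=> f g /ffunP e; apply/ffunP => j.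
  by have := e (s0 j); rewrite !ffunE permK.
rewrite (reindex_inj inj) /=.
under eq_bigr => f _.
  rewrite (_ : [ffun j => _] = f); last by apply/ffunP => j; rewrite !ffunE permK.
  over.
rewrite /Y sumrB -(bigA_distr_bigA (fun j m => u j m + v j m)) -(bigA_distr_bigA u) /=.
have nu j : \sum_m u j m = nrm (node k) (h' j).
  by rewrite (@nrmE _ _ B) ?(leq_trans (hB2 j (ltn_ord j)))//.
have nv j : \sum_m v j m = nrm (node k) (h j - h' j).
  by rewrite (@nrmE _ _ B) ?(leq_trans (hB3 j (ltn_ord j)))//.
rewrite [X in X - _ <= _](eq_bigr (fun j : 'I_K => nrm (node k) (h' j) +
  nrm (node k) (h j - h' j))); last by move=> j _; rewrite big_split /= nu nv.
rewrite [X in _ - X <= _](eq_bigr (fun j : 'I_K => nrm (node k) (h' j))); last first.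
  by move=> j _; exact: nu.
have := @prodD_sub_le _ _ (fun j : 'I_K => nrm (node k) (h' j))
  (fun j => nrm (node k) (h j - h' j)) (enum 'I_K) C d.
rewrite !big_enum size_enum_ord; apply=> j.
- by rewrite nrm_ge0//= hC// -ltnS.
- by rewrite nrm_ge0//= hd// -ltnS.
Qed.

End Stability.

Section Estimates.
Variables (R : realType) (G : bcd_type) (q : R).
Hypotheses (q_gt0 : 0 < q) (q_lt1 : q < 1).
Notation p := (charp R G).
Notation node := (node G q).
Notation phi := (@phi R G).
Notation nrm := (@nrm R G).
Notation alt := (@alt R G).
Notation cdet := (@cdet R G).
Notation hpoly := (hpoly G q).
Notation gpoly := (gpoly G q).
Notation hden := (hden G q).
Notation trans := (@trans R G q).
Notation lag := (node_lagrange G q).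

Let node4 := node_ge4 G q_gt0.
Let nodegt := node_gt0 G q_gt0.
Let node0le := node_ge0 G q_gt0.
Let qge n := qexp_ge0 q_gt0 n.

(** The same as [trans], for exponents which need not come from a signature of
    size [N], so that [N] can be lowered. *)
Definition transL (N k : nat) (L : nat -> nat) (mu : GT k) : R :=
  alt mu node * cdet (hpoly N L k) mu.

Lemma transLE N k (lam : GT N) (mu : GT k) : trans lam mu = transL N (gtL lam) mu.
Proof. by []. Qed.

Lemma eq_hpoly N L L' k j : (forall r, (r < N)%N -> L r = L' r) ->
  hpoly N L k j = hpoly N L' k j.
Proof.
move=> h; congr (_ %/ _); rewrite !gpolyE; congr (_ *: _).
apply: eq_bigr => r _; rewrite -!h//; congr ((phi _ _ / _) *: _).
rewrite /node_lagrange big_nat_cond [RHS]big_nat_cond; apply: eq_bigr => i.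
by move=> /andP[/andP[_ iN] _]; rewrite !h.
Qed.

Lemma eq_transL N k L L' (mu : GT k) : (forall r, (r < N)%N -> L r = L' r) ->
  transL N L mu = transL N L' mu.
Proof.
move=> h; congr (_ * \det _); apply/matrixP => i b; rewrite !mxE.
by rewrite (eq_hpoly _ _ h).
Qed.

Lemma bounded_family (P : nat -> R -> Prop) k :
  (forall j C C', C <= C' -> P j C -> P j C') ->
  (forall j, (j <= k)%N -> exists2 C, 0 <= C & P j C) ->
  exists2 C, 0 <= C & forall j, (j <= k)%N -> P j C.
Proof.
move=> Pm; elim: k => [|k IH] h.
  have [C C0 hC] := h 0%N isT; exists C => // j.
  by rewrite leqn0 => /eqP ->.
have [C C0 hC] := IH (fun j jk => h j (leqW jk)).
have [D D0 hD] := h k.+1 (leqnn _).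
exists (C + D); first by rewrite addr_ge0.
move=> j; rewrite leq_eqVlt => /orP[/eqP ->|jk].
  by apply: Pm hD; rewrite lerDr.
by apply: Pm (hC j jk); rewrite lerDl.
Qed.

(** [nrm_hpoly_trunc] compares the dual bases for [L] and for its [n] smallest
    elements, and [sum_cdet_sub_le] turns this into total variation. *)
Lemma transL_trunc k B : exists2 C, 0 <= C & forall N L n (s : seq (GT k.+1)),
  increasing N L -> (k.+1 < n <= N)%N -> (L k.+1 <= B)%N -> uniq s ->
  \sum_(mu <- s) `|transL N L mu - transL n L mu| <= C * q ^+ n.
Proof.
have [C C0 hC] := @bounded_family (fun j C => forall N L, increasing N L ->
    (k.+1 < N)%N -> (L k.+1 <= B)%N -> nrm (node k) (hpoly N L k.+1 j) <= C) k
  (fun j C C' CC h N L Li kN LB => le_trans (h N L Li kN LB) CC)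
  (fun j jk => nrm_hpoly_bound G q_gt0 q_lt1 B jk).
have [D D0 hD] := @bounded_family (fun j C => forall N L n, increasing N L ->
    (k.+1 < n <= N)%N -> (L k.+1 <= B)%N ->
    nrm (node k) (hpoly N L k.+1 j - hpoly n L k.+1 j) <= C * q ^+ n) k
  (fun j C C' CC h N L n Li kN LB => le_trans (h N L n Li kN LB) (ler_wpM2r (qge n) CC))
  (fun j jk => nrm_hpoly_trunc G q_gt0 q_lt1 B jk).
pose K := (k.+1`!%:R : R) ^+ 2.
have K0 : 0 <= K by rewrite exprn_ge0.
exists (K * (D * (k.+1%:R * (C + D + 1) ^+ k.+1))).
  by rewrite !mulr_ge0// exprn_ge0//; lra.
move=> N L n s Li /andP[kn nN] LB us.
have Lin := increasing_le nN Li.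
apply: le_trans.
  apply: (@sum_cdet_sub_le R G q q_gt0 q_lt1 k (hpoly N L k.+1) (hpoly n L k.+1) C (D * q ^+ n)) => //.
    by move=> j jk; exact: hC.
  by move=> j jk; apply: hD => //; rewrite kn.
rewrite -/K -[leRHS]mulrA ler_wpM2l//.
apply: le_trans (expD_sub_le (E := D) _ C0 _ _) _.
- by rewrite mulr_ge0.
- by rewrite -[leRHS]mulr1 ler_wpM2l// qexp_le1.
by rewrite mulrAC.
Qed.

(** One row of the determinant is small by [nrm_hpoly_escape] and the other
    ones are bounded. *)
Lemma transL_escape k (mu : GT k.+2) : exists2 C, 0 <= C & forall N L X,
  increasing N L -> (k.+1 < N)%N -> (X <= L k)%N -> `|transL N L mu| <= C / node X.
Proof.
have [C C0 hC] := @bounded_family (fun j C => forall N L, increasing N L ->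
    (k.+1 < N)%N -> nrm (node 0) (hpoly N L k.+2 j) <= C) k.+1
  (fun j C C' CC h N L Li kN => le_trans (h N L Li kN) CC)
  (fun j jk => nrm_hpoly0_bound G q_gt0 q_lt1 jk).
have [D D0 hD] := nrm_hpoly_escape G q_gt0 q_lt1 k.
exists (`|alt mu node| * (k.+2`!%:R * (C ^+ k.+1 * D))).
  by rewrite !mulr_ge0// exprn_ge0.
move=> N L X Li kN XL; rewrite /transL normrM -mulrA ler_wpM2l//.
have phile m f : `|phi m f| <= nrm (node 0) f.
  apply: le_trans (normr_phi_le _ _ _ (node4 0)) _.
  rewrite ler_pdivrMr ?charp_gt0// ler_peMr ?charp_ge1 ?nrm_ge0//.
apply: le_trans (normr_det_le (b := fun j : 'I_k.+2 => if j == k.+1 :> nat then D / node X else C) _) _.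
  move=> i j; rewrite mxE; apply: le_trans (phile _ _) _.
  case: eqP => [->|/eqP ik]; first exact: hD.
  by apply: hC => //; rewrite -ltnS.
rewrite -mulrA ler_wpM2l// big_ord_recr /= eqxx mulrA.
rewrite ler_wpM2r ?invr_ge0// ler_wpM2r//.
rewrite (eq_bigr (fun=> C)); last by move=> j _; rewrite ltn_eqF.
by rewrite prodr_const card_ord.
Qed.

(** ** Recovering the exponents from the first level *)

(** As the diagonal of [mulX_coef] is at most [2], multiplication by a factor
    [t - 'X] with [4 <= t] preserves the alternation of the signs of the
    coefficients. So nothing cancels, and the coefficient of index [0] is
    multiplied by at least [t - 2]. *)
Lemma phi_prod_alternating (r : seq nat) (t : nat -> R) : (forall i, 4 <= t i) ->
  (forall m, 0 <= (-1) ^+ m * phi m (\prod_(i <- r) ((t i)%:P - 'X))) /\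
  (\prod_(i <- r) (t i - 2)) / charp_lead R G <= phi 0 (\prod_(i <- r) ((t i)%:P - 'X)).
Proof.
move=> t4; have c0 := charp_lead_gt0 R G.
have d0 : charp_shift R G <= 2 by rewrite /charp_shift; case: (G); lra.
elim: r => [|i r [IH1 IH2]].
  rewrite !big_nil; split; last by rewrite phi_1.
  by case=> [|m]; rewrite phi_1 ?mul0r ?mulr0// expr0 mul1r mul1r invr_ge0 ltW.
rewrite !big_cons; set f := \prod_(j <- r) (_ - 'X) in IH1 IH2 *.
set T := \prod_(j <- r) _ in IH2 *.
have t4i := t4 i; set a := t i in t4i *.
have phiE m : phi m ((a%:P - 'X) * f) = a * phi m f - mulX_coef G (phi^~ f) m.
  by rewrite mulrBl linearB /= mul_polyC phiZ phi_mulX.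
have p0 : 0 <= phi 0 f by have := IH1 0%N; rewrite expr0 mul1r.
have p1 : phi 1 f <= 0 by have := IH1 1%N; rewrite expr1 mulN1r; lra.
split; last first.
  rewrite phiE /= -mulrA.
  have h : (a - 2) * (T / charp_lead R G) <= (a - 2) * phi 0 f.
    by rewrite ler_wpM2l//; lra.
  have : charp_shift R G * phi 0 f <= 2 * phi 0 f by rewrite ler_wpM2r.
  lra.
move=> m; rewrite phiE; case: m => [|[|m]] /=.
- rewrite expr0 mul1r.
  have : charp_shift R G * phi 0 f <= 4 * phi 0 f by rewrite ler_wpM2r//; lra.
  have : 4 * phi 0 f <= a * phi 0 f by rewrite ler_wpM2r.
  lra.
- have p2 : 0 <= phi 2 f by have := IH1 2%N; rewrite expr2 mulN1r opprK mul1r.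
  rewrite expr1 mulN1r.
  have : 0 <= charp_lead R G * phi 0 f by rewrite mulr_ge0// ltW.
  have : 0 <= (a - 2) * (- phi 1 f) by rewrite mulr_ge0//; lra.
  lra.
- have h1 := IH1 m.+1; have h2 := IH1 m.+2; have h3 := IH1 m.+3.
  move: h1 h2 h3; rewrite !exprS.
  set e := (-1) ^+ m => h1 h2 h3.
  have : 0 <= (a - 2) * (-1 * (-1 * e) * phi m.+2 f) by rewrite mulr_ge0//; lra.
  lra.
Qed.

(** In [phi_prod_alternating], normalized factors are at least [2 / node (L
    r)] for the indices below [r], of which there are at most [L r], and at
    least [1] above. *)
Lemma phi0_lagrange N L r : increasing N L -> (r < N)%N ->
  (2 / node (L r)) ^+ L r / charp_lead R G <= `|phi 0 (lag N L r)|.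
Proof.
move=> Li rN; set a := node (L r).
have -> : lag N L r = (\prod_(i <- index_iota 0 N | i != r) (node (L i) - a)^-1) *:
    \prod_(i <- [seq i <- index_iota 0 N | i != r]) ((node (L i))%:P - 'X).
  by rewrite big_filter -scaler_prod.
rewrite phiZ normrM normr_prod.
have [_ h] := phi_prod_alternating [seq i <- index_iota 0 N | i != r] (fun i => node4 (L i)).
set f := \prod_(i <- [seq _ <- _ | _]) _ in h *.
set T := \prod_(i <- [seq _ <- _ | _]) _ in h.
have c0 := charp_lead_gt0 R G.
have T0 : 0 <= T by apply: prodr_ge0 => i _; have := node4 (L i); lra.
have f0 : 0 <= phi 0 f by apply: le_trans h; rewrite divr_ge0// ltW.
apply: (@le_trans _ _ (\prod_(i <- index_iota 0 N | i != r) `|(node (L i) - a)^-1| * (T / charp_lead R G))); last first.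
  by rewrite ler_wpM2l ?prodr_ge0// (ger0_norm f0).
rewrite mulrA ler_wpM2r ?invr_ge0 ?(ltW c0)//.
rewrite /T big_filter -big_split /=.
have a4 : 4 <= a := node4 _.
apply: (@le_trans _ _ (\prod_(0 <= i < r) (2 / a))).
  rewrite prodr_const_nat subn0; apply: ler_wiXn2l.
  - by rewrite divr_ge0//; lra.
  - by rewrite ler_pdivrMr; lra.
  - exact: (increasing_ge Li).
rewrite (@big_cat_nat _ _ _ r 0 N)//=; last exact: ltnW.
rewrite -[leLHS]mulr1; apply: ler_pM => //.
- by apply: prodr_ge0 => i _; rewrite divr_ge0//; lra.
- rewrite [leRHS]big_mkcond big_nat [leRHS]big_nat; apply: ler_prod => i /andP[_ ir].
  rewrite ltn_eqF//=.
  have la : node (L i) < a by apply: node_ltn => //; exact: Li.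
  have t4 := node4 (L i).
  apply/andP; split; first by rewrite divr_ge0//; lra.
  rewrite normfV [leRHS]mulrC; apply: ler_pM; rewrite ?invr_ge0//; [lra|lra|].
  have -> : `|node (L i) - a| = a - node (L i) by rewrite ltr0_norm ?subr_lt0// opprB.
  by rewrite lef_pV2 ?posrE; lra.
- rewrite big_nat_cond; apply: (big_ind (fun x => 1 <= x)) => //.
    by move=> x y x1 y1; rewrite -[1]mulr1 ler_pM.
  move=> i /andP[/andP[ri iN] ir].
  have ri' : (r < i)%N by rewrite ltn_neqAle eq_sym ir.
  have la : a < node (L i) by apply: node_ltn => //; exact: Li.
  rewrite gtr0_norm ?invr_gt0 ?subr_gt0// mulrC ler_pdivlMr ?subr_gt0//; lra.
Qed.

Lemma phi_gpoly0 N L m : phi m (gpoly N L 0) = (p 0).[node 0] *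
  \sum_(r < N) phi 0 (lag N L r) / (p (L r)).[node 0] * (m == L r)%:R.
Proof.
rewrite gpolyE phiZ linear_sum; congr (_ * _); apply: eq_bigr => r _.
by rewrite /= phiZ phi_charp.
Qed.

Definition occurs (N : nat) (L : nat -> nat) m := exists2 r, (r < N)%N & L r = m.

(** As [gpoly N L 0] is a combination of the [p (L r)], its coefficient of
    index [m] sees only whether [m] is an exponent; it is then controlled by
    [phi0_lagrange]. *)
Lemma phi_gpoly0_gap m : exists2 d, 0 < d & forall N L, increasing N L ->
  (occurs N L m -> d <= `|phi m (gpoly N L 0)|) /\
  (~ occurs N L m -> phi m (gpoly N L 0) = 0).
Proof.
have c0 := charp_lead_gt0 R G.
have pm : 0 < (p m).[node 0] by rewrite charp_gt0.
have cp : 0 < (p 0).[node 0] by rewrite charp_gt0.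
have gE := phi_gpoly0; move: (p 0).[node 0] cp gE => c cp gE.
exists (c * ((2 / node m) ^+ m / charp_lead R G / (p m).[node 0])).
  by rewrite mulr_gt0// divr_gt0// divr_gt0// exprn_gt0// divr_gt0.
move=> N L Li; split=> [[r rN Lr]|no]; rewrite gE; last first.
  rewrite big1 ?mulr0// => r _; case: eqP => [mL|]; last by rewrite mulr0.
  by case: no; exists r.
rewrite (bigD1 (Ordinal rN))//= big1 ?addr0; last first.
  move=> i ir; case: eqP => [mL|]; last by rewrite mulr0.
  move/eqP: ir; case; apply: val_inj => /=; apply: (increasing_inj Li) => //.
  by rewrite -mL.
rewrite Lr eqxx mulr1 !normrM (gtr0_norm cp).
rewrite ler_wpM2l ?(ltW cp)// normfV (gtr0_norm pm).
rewrite ler_wpM2r ?invr_ge0 ?(ltW pm)//.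
by have := phi0_lagrange Li rN; rewrite Lr.
Qed.

(** The two polynomials differ by the factors of [hden] beyond [n], which are
    close to [1]. This matters because the coefficients of [hpoly N L 1 0] are
    the law at level 1, by [trans_level1]. *)
Lemma gpoly0_approx : exists2 C, 0 <= C & forall N L n m, increasing N L ->
  (0 < n <= N)%N ->
  `|phi m (gpoly N L 0) - phi m (hpoly N L 1 0 * hden 0 1 n)| <= C * q ^+ n.
Proof.
have [C hC] := nrm_gpoly0 G q_gt0 q_lt1 0.
have [D D0 hD] := node_perturb G q_gt0 q_lt1 (node4 0).
have qc0 : 0 < qconst q_gt0 q_lt1 ^+ 4 by rewrite exprn_gt0// qconst_gt0.
have C0 : 0 <= C by apply: le_trans (hC 0%N id _) => //; exact: nrm_ge0.
exists (D * (C / qconst q_gt0 q_lt1 ^+ 4)).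
  by rewrite mulr_ge0// divr_ge0// ltW.
move=> N L n m Li /andP[n0 nN].
pose f := hpoly N L 1 0 * hden 0 1 n.
have N0 : (0 < N)%N := leq_trans n0 nN.
have fE : hden 0 n N * f = gpoly N L 0.
  rewrite -(hpolyM G q_gt0 q_lt1 Li (ltn0Sn 0) N0) /f mulrCA; congr (_ * _).
  by rewrite mulrC !hden_prod [RHS](@big_cat_nat _ _ _ n).
have nf : nrm (node 0) f <= C / qconst q_gt0 q_lt1 ^+ 4.
  rewrite ler_pdivlMr// mulrC; apply: le_trans (hC N L Li); rewrite -fE.
  exact: nrm_hden_lower.
have idi : increasing N id by move=> a b.
have h := hD id 0%N n N f idi n0.
rewrite -fE -linearB /= subn0 in h *.
apply: le_trans (normr_phi_le _ _ _ (node4 0)) _.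
rewrite ler_pdivrMr ?charp_gt0//.
apply: (@le_trans _ _ (D * (C / qconst q_gt0 q_lt1 ^+ 4) * q ^+ n)).
  apply: le_trans h _; rewrite [leRHS]mulrAC; apply: ler_wpM2l => //.
  exact: mulr_ge0.
rewrite ler_peMr ?charp_ge1// !mulr_ge0// invr_ge0 ltW//.
Qed.

End Estimates.

(** * Limits of probability measures with finite support *)

Lemma near_inftyP (P : nat -> Prop) :
  (\forall n \near \oo, P n) <-> exists N0, forall n, (N0 <= n)%N -> P n.
Proof.
split=> [[N _ h]|[N h]]; first by exists N => n; exact: h.
by exists N => // n; exact: h.
Qed.

Lemma cvg_nat_eventually (u : nat -> nat) l :
  u @ \oo --> l <-> exists N0, forall n, (N0 <= n)%N -> u n = l.
Proof.
rewrite -near_inftyP; split=> [h|h].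
  have : nbhs l [set l] by rewrite nbhs_principalE; apply/principal_filterP.
  by move=> /h.
move=> U /nbhs_singleton Ul; rewrite /nbhs /=.
by apply: filterS h => n /= ->.
Qed.

Section L1.
Variable R : realType.

Lemma cvg_real_eventually (u : nat -> R) (l : R) : u @ \oo --> l <->
  forall e : R, 0 < e -> exists N0, forall n, (N0 <= n)%N -> `|l - u n| <= e.
Proof.
rewrite cvgrPdist_le; split=> h e e0; first by have /near_inftyP := h e e0.
by apply/near_inftyP; exact: h.
Qed.

Lemma cauchy_real_cvg (u : nat -> R) :
  (forall e : R, 0 < e -> exists N0, forall n m, (N0 <= n)%N -> (N0 <= m)%N -> `|u n - u m| <= e) ->
  exists l : R, u @ \oo --> l.
Proof.
move=> h; suff : cvg (u @ \oo) by move=> c; exists (lim (u @ \oo)).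
apply/cauchy_cvgP/cauchy_exP => e e0.
have [N0 hN] := h (e / 2) ltac:(lra).
exists (u N0); rewrite /fmap /= ; apply/near_inftyP; exists N0 => n Nn /=.
by rewrite /ball /=; apply: (le_lt_trans (hN _ _ (leqnn _) Nn)); lra.
Qed.

Lemma esum_eq_sup (T : choiceType) (a : T -> R) (v : R) :
  (forall s, uniq s -> \sum_(x <- s) a x <= v) ->
  (forall e : R, 0 < e -> exists2 s, uniq s & v - e <= \sum_(x <- s) a x) ->
  \esum_(x in [set: T]) (a x)%:E = v%:E.
Proof.
move=> hle hge; apply/eqP; rewrite eq_le; apply/andP; split.
  apply: ge_ereal_sup => _ [A [fA _] <-].
  rewrite fsbig_finite//= sumEFin lee_fin; apply: hle; exact: fset_uniq.
apply/lee_addgt0Pr => e e0; have [s us hs] := hge e e0.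
have : ((v - e)%:E <= \esum_(x in [set: T]) (a x)%:E)%E.
  apply: (@le_trans _ _ (\sum_(x <- s) a x)%:E); first by rewrite lee_fin.
  apply: ereal_sup_ubound; exists [set` s]; first by split; [exact: finite_seq|].
  by rewrite -sumEFin; apply/esym/fsbig_seq.
by rewrite EFinB leeBlDr.
Qed.

Lemma sum_le_support (T : eqType) (s t : seq T) (F : T -> R) : uniq s -> uniq t ->
  (forall x, 0 <= F x) -> (forall x, x \notin t -> F x = 0) ->
  \sum_(x <- s) F x <= \sum_(x <- t) F x.
Proof.
move=> us ut F0 Ft.
have -> : \sum_(x <- t) F x = \sum_(x <- undup (t ++ s)) F x.
  apply: sum_uniq_incl => //; first exact: undup_uniq.
  by move=> x xt; rewrite mem_undup mem_cat xt.
rewrite [leRHS](bigID (mem s)) /= -[leLHS]addr0; apply: lerD; last exact: sumr_ge0.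
rewrite -[leRHS]big_filter; rewrite le_eqVlt; apply/orP; left; apply/eqP/perm_big.
apply: uniq_perm => //; first by rewrite filter_uniq// undup_uniq.
by move=> x; rewrite mem_filter mem_undup mem_cat /=; case: (x \in s); rewrite ?orbT.
Qed.

Section Limit.
Variables (T : choiceType) (p : nat -> T -> R).
Hypothesis p_ge0 : forall n x, 0 <= p n x.
Hypothesis p_cauchy : forall e : R, 0 < e -> exists N0, forall n m, (N0 <= n)%N -> (N0 <= m)%N ->
  forall s, uniq s -> \sum_(x <- s) `|p n x - p m x| <= e.

Variable P : T -> R.
Hypothesis p_cvg : forall x, p n x @[n --> \oo] --> P x.

Lemma l1_limit_ge0 x : 0 <= P x.
Proof.
have h : \forall n \near \oo, 0 <= p n x.
  by apply/near_inftyP; exists 0%N => n _; exact: p_ge0.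
exact: (cvgr_to_ge (@p_cvg x) h).
Qed.

Lemma l1_limit_close (e : R) : 0 < e -> exists N0, forall n, (N0 <= n)%N ->
  forall s, uniq s -> \sum_(x <- s) `|P x - p n x| <= e.
Proof.
move=> e0; have [N0 hN] := p_cauchy e0; exists N0 => n Nn s us.
have c : \sum_(x <- s) `|p m x - p n x| @[m --> \oo] --> \sum_(x <- s) `|P x - p n x|.
  apply: cvg_big => [|x _]; first exact: add_continuous; apply: cvg_norm; apply: cvgB; first exact: p_cvg.
  exact: cvg_cst.
have h : \forall m \near \oo, \sum_(x <- s) `|p m x - p n x| <= e.
  by apply/near_inftyP; exists N0 => m Nm; exact: hN.
exact: (cvgr_to_le c h).
Qed.

(** Total variation convergence loses no mass, so bounded functions may be
    integrated to the limit. *)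
Lemma l1_limit_esum (c : T -> R) (w : nat -> R) (v : R) : (forall x, 0 <= c x <= 1) ->
  (forall n, exists s : seq T, [/\ uniq s, forall x, x \notin s -> p n x = 0 &
     w n = \sum_(x <- s) p n x * c x]) ->
  w @ \oo --> v -> \esum_(x in [set: T]) (P x * c x)%:E = v%:E.
Proof.
move=> c01 hw wv.
have close (e : R) : 0 < e -> exists2 n, `|v - w n| <= e &
    forall s, uniq s -> `|\sum_(x <- s) P x * c x - \sum_(x <- s) p n x * c x| <= e.
  move=> e0; have [N1 h1] := l1_limit_close e0.
  have [N2 h2] := (cvg_real_eventually _ _).1 wv e e0.
  exists (maxn N1 N2); first by apply: h2; exact: leq_maxr.
  move=> s us; rewrite -sumrB; apply: le_trans (ler_norm_sum _ _ _) _.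
  apply: le_trans (h1 _ (leq_maxl _ _) s us); apply: ler_sum => x _.
  have /andP[c0 c1] := c01 x.
  by rewrite -mulrBl normrM (ger0_norm c0); exact: ler_piMr.
have e2 (e : R) : 0 < e -> 0 < e / 2 by move=> ?; lra.
apply: esum_eq_sup => [s us|e e0].
  apply/ler_addgt0Pr => e e0; have [n nv hn] := close _ (e2 _ e0).
  have [t [ut t0 wE]] := hw n.
  have le : \sum_(x <- s) p n x * c x <= w n.
    rewrite wE; apply: sum_le_support => // x; last by move=> /t0 ->; rewrite mul0r.
    by apply: mulr_ge0 (p_ge0 n x) _; have /andP[] := c01 x.
  by move: (hn s us) nv le; rewrite !ler_norml; lra.
have [n nv hn] := close _ (e2 _ e0); have [t [ut t0 wE]] := hw n.
by exists t => //; move: (hn t ut) nv; rewrite -wE !ler_norml; lra.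
Qed.
End Limit.
End L1.

(** * Stabilizing sequences and the measures they define *)

(** Increasing exponents of the signatures with smallest parts [y]. *)
Definition shifted (y : nat -> nat) r := (y r + r)%N.

Lemma shifted_increasing N y : frakY y -> increasing N (shifted y).
Proof.
move=> yY r r' rr rN; have h : (y r <= y r')%N by apply: yY; exact: ltnW.
by rewrite /shifted; lia.
Qed.

Lemma stabilizes_gtL lam y : stabilizes lam y -> forall n, exists N0,
  forall N, (N0 <= N)%N -> forall r, (r < n)%N -> gtL (lam N) r = shifted y r.
Proof.
move=> st; elim=> [|n [N0 IH]]; first by exists 0%N.
have [N1 h] := (cvg_nat_eventually _ _).1 (st n).
exists (maxn N0 N1) => N; rewrite geq_max => /andP[Nn Nm] r.
rewrite ltnS leq_eqVlt => /orP[/eqP ->|rn]; last exact: IH.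
by rewrite /gtL (h N Nm).
Qed.

Lemma stabilizes_toGT y : frakY y -> stabilizes (fun N => toGT N (shifted y)) y.
Proof.
move=> yY i; apply/cvg_nat_eventually; exists i.+1 => N iN.
have := gtL_toGT (@shifted_increasing N _ yY) iN.
by rewrite /gtL /shifted => /eqP; rewrite eqn_add2r => /eqP.
Qed.

Section Stabilizing.
Variables (R : realType) (G : bcd_type) (q : R).
Hypotheses (q_gt0 : 0 < q) (q_lt1 : q < 1).
Notation cot := (cotransition q G).
Notation citer := (cotransition_iter q G).
Notation trans := (@trans R G q).

Lemma qexp_small (C e : R) : 0 <= C -> 0 < e ->
  exists n0, forall n, (n0 <= n)%N -> C * q ^+ n <= e.
Proof.
move=> C0 e0; have c : q ^+ n @[n --> \oo] --> (0 : R).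
  by apply: cvg_expr; rewrite ger0_norm// ltW.
have C1 : 0 < C + 1 by lra.
have [n0 h] := (cvg_real_eventually _ _).1 c (e / (C + 1)) ltac:(exact: divr_gt0).
exists n0 => n /h; rewrite sub0r normrN ger0_norm ?qexp_ge0// ler_pdivlMr// => he.
apply: le_trans he; rewrite mulrC; apply: ler_wpM2l; last by lra.
exact: qexp_ge0.
Qed.

(** Both laws are compared with the law of the [n] smallest exponents, which
    are eventually those given by [y]. *)
Lemma trans_cauchy y k (lam lam' : forall N, GT N) (e : R) : frakY y ->
  stabilizes lam y -> stabilizes lam' y -> 0 < e ->
  exists N0, forall N M, (N0 <= N)%N -> (N0 <= M)%N -> forall s : seq (GT k.+1), uniq s ->
    \sum_(mu <- s) `|trans (lam N) mu - trans (lam' M) mu| <= e.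
Proof.
move=> yY st st' e0.
have [C C0 hC] := transL_trunc G q_gt0 q_lt1 k (shifted y k.+1).
have [n0 hn0] := qexp_small C0 (ltac:(lra) : 0 < e / 2).
pose n := maxn n0 k.+2.
have Cn : C * q ^+ n <= e / 2 by apply: hn0; exact: leq_maxl.
have kn : (k.+1 < n)%N by exact: leq_maxr.
have [N0 h0] := stabilizes_gtL st n; have [N1 h1] := stabilizes_gtL st' n.
have close (l : forall N, GT N) N : (forall r, (r < n)%N -> gtL (l N) r = shifted y r) ->
    (n <= N)%N -> forall s : seq (GT k.+1), uniq s ->
    \sum_(mu <- s) `|trans (l N) mu - transL G q n (shifted y) mu| <= e / 2.
  move=> hl nN s us; apply: le_trans Cn.
  have := hC N (gtL (l N)) n s; rewrite kn nN => /(_ (gtL_increasing _) isT).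
  rewrite hl// => /(_ (leqnn _) us); apply: le_trans; apply: ler_sum => mu _.
  by rewrite transLE (eq_transL _ _ mu hl).
exists (n + N0 + N1)%N => N M lN lM s us.
have [nN nM NN MM] : [/\ (n <= N)%N, (n <= M)%N, (N0 <= N)%N & (N1 <= M)%N].
  by split; [apply: leq_trans lN|apply: leq_trans lM|apply: leq_trans lN|apply: leq_trans lM]; lia.
have := close lam N (h0 N NN) nN s us; have := close lam' M (h1 M MM) nM s us.
move=> hb ha; apply: (@le_trans _ _ (\sum_(mu <- s)
   (`|trans (lam N) mu - transL G q n (shifted y) mu| +
    `|trans (lam' M) mu - transL G q n (shifted y) mu|))); last first.
  by rewrite big_split /=; lra.
apply: ler_sum => mu _; rewrite [X in _ <= _ + X]distrC; exact: ler_distD.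
Qed.

Section Law.
Variables (y : nat -> nat) (yY : frakY y).

Lemma stabilizing_limit n (mu : GT n.+1) : exists l : R, forall lam : forall N, GT N,
  stabilizes lam y -> citer (lam (m + n.+1)%N) mu @[m --> \oo] --> l.
Proof.
pose lam0 N := toGT N (shifted y).
have st0 : stabilizes lam0 y by exact: stabilizes_toGT.
have ca lam (st : stabilizes lam y) (e : R) : 0 < e -> exists N0, forall m m',
    (N0 <= m)%N -> (N0 <= m')%N ->
    `|citer (lam (m + n.+1)%N) mu - citer (lam0 (m' + n.+1)%N) mu| <= e.
  move=> e0; have [N0 h] := @trans_cauchy y n lam lam0 e yY st st0 e0.
  exists N0 => m m' Nm Nm'; rewrite !iter_trans//.
  have := h (m + n.+1)%N (m' + n.+1)%N _ _ [:: mu] isT; rewrite big_seq1; apply; lia.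
have [l hl] := cauchy_real_cvg (ca lam0 st0).
exists l => lam st; apply/cvg_real_eventually => e e0.
have e2 : 0 < e / 2 by lra.
have [N0 h0] := ca lam st _ e2.
have [N1 h1] := (cvg_real_eventually _ _).1 hl _ e2.
exists N0 => m Nm.
have := h0 m (maxn N0 N1) Nm (leq_maxl _ _); have := h1 _ (leq_maxr N0 N1).
by rewrite !ler_norml; lra.
Qed.

Lemma boundary_measure_cvg lam n (mu : GT n.+1) : stabilizes lam y ->
  citer (lam (m + n.+1)%N) mu @[m --> \oo] --> boundary_measure q G y mu.
Proof. exact: (xgetPex 0 (stabilizing_limit mu)). Qed.

(** Total mass and coherence pass to the limit by [l1_limit_esum], applied to
    the constant [1] and to a column of the cotransition matrix. *)
Lemma boundary_measure_coherent : coherent_system q G (boundary_measure q G y).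
Proof.
pose lam N := toGT N (shifted y).
have st : stabilizes lam y by exact: stabilizes_toGT.
pose p n m (mu : GT n.+1) := citer (lam (m + n.+1)%N) mu.
have p0 n m mu : 0 <= p n m mu by rewrite /p iter_trans// trans_ge0// leq_addl.
have pc n (e : R) : 0 < e -> exists N0, forall m m', (N0 <= m)%N -> (N0 <= m')%N ->
    forall s, uniq s -> \sum_(x <- s) `|p n m x - p n m' x| <= e.
  move=> e0; have [N0 h] := @trans_cauchy y n lam lam e yY st st e0.
  exists N0 => m m' Nm Nm' s us; apply: le_trans (h (m + n.+1)%N (m' + n.+1)%N _ _ s us).
  - by apply: ler_sum => mu _; rewrite /p !iter_trans.
  - by lia.
  - by lia.
have pl n mu : p n m mu @[m --> \oo] --> boundary_measure q G y mu.
  exact: boundary_measure_cvg.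
split=> [n|n mu].
  split=> [mu|]; first exact: l1_limit_ge0 (p0 n) _ (@pl n) mu.
  under eq_esum do rewrite -[boundary_measure q G y _]mulr1.
  apply: (@l1_limit_esum _ _ (p n) (p0 n) (pc n) _ (@pl n) (fun=> 1) (fun=> 1)).
  - by move=> x; rewrite ler01 lexx.
  - move=> m; have [s [us s0 s1]] := trans_sum1 G q_gt0 q_lt1 (lam (m + n.+1)%N) (leq_addl m n.+1).
    exists s; split=> // [x /s0|]; first by rewrite /p iter_trans.
    by rewrite -[LHS]s1; apply: eq_bigr => x _; rewrite /p iter_trans// mulr1.
  - exact: cvg_cst.
apply: (@l1_limit_esum _ _ (p n.+1) (p0 n.+1) (pc n.+1) _ (@pl n.+1)
  (fun nu => cot nu mu) (fun m => p n m.+1 mu)).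
- by move=> x; rewrite cot_ge0// cot_le1.
- move=> m; have := @trans_comp _ G _ q_gt0 q_lt1 (m + n.+2)%N n.+1 (lam (m + n.+2)%N).
  case=> [|s [us s0 hs]]; first by lia.
  exists s; split=> // [x /s0|]; first by rewrite /p iter_trans.
  rewrite /p iter_trans// addSnnS hs.
  by apply: eq_bigr => x _; rewrite iter_trans.
by have := @pl n mu; rewrite -(cvg_shiftS (fun m => p n m mu)).
Qed.

End Law.
End Stabilizing.

(** * Recovering the exponents from a boundary point *)

(** An increasing sequence is determined by its set of values; only the values
    up to [B] are compared. *)
Lemma increasing_eq_occurs (N N' : nat) (L L' : nat -> nat) B :
  increasing N L -> increasing N' L' ->
  (forall m, (m <= B)%N -> occurs N L m <-> occurs N' L' m) ->
  forall r, (r < N)%N -> (r < N')%N -> (L r <= B)%N -> (L' r <= B)%N -> L r = L' r.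
Proof.
move=> Li Li' oc; elim/ltn_ind => r IH rN rN' LB LB'.
have IH' s : (s < r)%N -> L s = L' s.
  move=> sr; apply: IH => //; try by apply: ltn_trans sr _.
    by apply: leq_trans LB; apply: ltnW; exact: Li.
  by apply: leq_trans LB'; apply: ltnW; exact: Li'.
apply/eqP; rewrite eqn_leq; apply/andP; split.
  have [s sN Ls] := (oc _ LB').2 (ex_intro2 _ _ r rN' erefl).
  rewrite -Ls; have [sr|] := ltnP s r; last first.
    by rewrite leq_eqVlt => /orP[/eqP ->//|rs]; apply: ltnW; exact: Li.
  by have := Li' s r sr rN'; rewrite -IH'// Ls ltnn.
have [s sN Ls] := (oc _ LB).1 (ex_intro2 _ _ r rN erefl).
rewrite -Ls; have [sr|] := ltnP s r; last first.
  by rewrite leq_eqVlt => /orP[/eqP ->//|rs]; apply: ltnW; exact: Li'.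
by have := Li s r sr rN; rewrite IH'// Ls ltnn.
Qed.

Lemma eventually_all (P : nat -> nat -> Prop) B :
  (forall m, exists N0, forall N, (N0 <= N)%N -> P m N) ->
  exists N0, forall N, (N0 <= N)%N -> forall m, (m <= B)%N -> P m N.
Proof.
move=> h; elim: B => [|B [N0 IH]].
  by have [N0 h0] := h 0%N; exists N0 => N /h0 p0 m; rewrite leqn0 => /eqP ->.
have [N1 h1] := h B.+1; exists (maxn N0 N1) => N; rewrite geq_max => /andP[NN NM] m.
by rewrite leq_eqVlt => /orP[/eqP ->|]; [exact: h1|exact: IH].
Qed.

Section Boundary.
Variables (R : realType) (G : bcd_type) (q : R).
Hypotheses (q_gt0 : 0 < q) (q_lt1 : q < 1).
Notation citer := (cotransition_iter q G).
Notation trans := (@trans R G q).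
Notation node := (node G q).
Notation p := (charp R G).
Notation phi := (@phi R G).
Notation hpoly := (hpoly G q).
Notation gpoly := (gpoly G q).
Notation hden := (hden G q).

(** By [phi_mulX], the coefficients of [F i * Q] are finite combinations,
    which do not depend on [i], of those of [F i]. *)
Lemma cvg_phi_mul (Q : {poly R}) (a : nat -> R) : exists b : nat -> R,
  forall F : nat -> {poly R}, (forall n, phi n (F i) @[i --> \oo] --> a n) ->
  forall n, phi n (F i * Q) @[i --> \oo] --> b n.
Proof.
elim/poly_ind: Q => [|Q c [b hb]].
  exists (fun=> 0) => F _ n; rewrite [X in X @ _ --> _](_ : _ = fun=> 0); first exact: cvg_cst.
  by apply/funext => i; rewrite mulr0 linear0.
exists (fun n => mulX_coef G b n + c * a n) => F Fa n.
rewrite [X in X @ _ --> _](_ : _ =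
    fun i => mulX_coef G (phi^~ (F i * Q)) n + c * phi n (F i)); last first.
  apply/funext => i; rewrite mulrDr linearD /= mulrA [_ * 'X]mulrC phi_mulX.
  by rewrite [_ * c%:P]mulrC mul_polyC phiZ.
apply: cvgD; last by apply: cvgM (Fa n); exact: cvg_cst.
have bQ := hb F Fa; case: n => [|[|n]] /=.
- by apply: cvgD; [apply: cvgM; [exact: cvg_cst|]|]; exact: bQ.
- by do 2?apply: cvgD; try exact: bQ; apply: cvgM; [exact: cvg_cst|exact: bQ|exact: cvg_cst|exact: bQ].
- by do 2?apply: cvgD; try exact: bQ; apply: cvgM; [exact: cvg_cst|exact: bQ].
Qed.

Lemma trans_level1 N (lam : GT N) m : trans lam (toGT 1 (fun=> m)) =
  (p m).[node 0] * phi m (hpoly N (gtL lam) 1 0).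
Proof.
have E : gtl (toGT 1 (fun=> m)) 0 = m.
  by rewrite /gtl gtL_toGT// => r r' rr; rewrite ltnS leqn0 => /eqP r0; rewrite r0 in rr.
have -> : trans lam (toGT 1 (fun=> m)) =
    \det (\matrix_(i < 1, a < 1) (p (gtl (toGT 1 (fun=> m)) i)).[node a]) *
    \det (\matrix_(i < 1, b < 1) phi (gtl (toGT 1 (fun=> m)) b) (hpoly N (gtL lam) 1 i)).
  by [].
by rewrite !det_mx11 !mxE /= E.
Qed.

(** Up to a uniformly small error, the coefficients of [gpoly N L 0] are those
    of a fixed multiple of [hpoly N L 1 0], hence converge with the law at
    level 1; and by [phi_gpoly0_gap] they cannot be close to zero without
    vanishing. So the limit law knows which exponents occur. *)
Lemma occurs_stable (M : GT 1 -> R) : exists S : set nat, forall lam : forall N, GT N,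
  (forall mu, citer (lam (i + 1)%N) mu @[i --> \oo] --> M mu) ->
  forall m, exists N0, forall N, (N0 <= N)%N -> occurs N (gtL (lam N)) m <-> S m.
Proof.
have [C C0 hC] := gpoly0_approx G q_gt0 q_lt1.
suff h m : exists b : Prop, forall lam : forall N, GT N,
    (forall mu, citer (lam (i + 1)%N) mu @[i --> \oo] --> M mu) ->
    exists N0, forall N, (N0 <= N)%N -> occurs N (gtL (lam N)) m <-> b.
  have [S hS] := choice h; exists S => lam hl m; exact: hS.
have [d d0 gap] := phi_gpoly0_gap G q_gt0 q_lt1 m.
have [n0 hn0] := qexp_small q_gt0 q_lt1 C0 (ltac:(lra) : 0 < d / 8).
pose n := n0.+1; have Cn : C * q ^+ n <= d / 8 by apply: hn0; exact: leqnSn.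
have [b hb] := cvg_phi_mul (hden 0 1 n)
  (fun l => ((p l).[node 0])^-1 * M (toGT 1 (fun=> l))).
exists (d / 2 <= `|b m|) => lam hl.
pose F i := hpoly (i + 1) (gtL (lam (i + 1)%N)) 1 0.
have Fa l : phi l (F i) @[i --> \oo] --> ((p l).[node 0])^-1 * M (toGT 1 (fun=> l)).
  rewrite [X in X @ _ --> _](_ : _ = fun i =>
      ((p l).[node 0])^-1 * citer (lam (i + 1)%N) (toGT 1 (fun=> l))).
    by apply: cvgM (hl _); exact: cvg_cst.
  apply/funext => i; rewrite iter_trans// trans_level1 mulrA mulVf ?mul1r//.
  by rewrite gt_eqF// charp_gt0// node_ge4.
have [N0 h0] := (cvg_real_eventually _ _).1 (hb F Fa m) (d / 8) ltac:(lra).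
exists (maxn N0.+1 n.+1) => N; rewrite geq_max => /andP[N0N nN].
have := h0 N.-1 ltac:(lia); rewrite /F addn1 prednK; last by lia.
have := hC N (gtL (lam N)) n m (gtL_increasing _) ltac:(lia).
have [g1 g2] := gap N (gtL (lam N)) (gtL_increasing _).
move: (phi m (hpoly _ _ _ _ * _)) => v.
have [oc|no] := pselect (occurs N (gtL (lam N)) m).
  move: (phi m _) (g1 oc) => w dw h1 h2; split=> // _.
  have := ler_distD v w 0; have := ler_distD (b m) v 0.
  by have := distrC (b m) v; have := distrC w v; rewrite !subr0; lra.
rewrite (g2 no) => h1 h2; split=> // db.
have := ler_distD v (b m) 0; rewrite sub0r normrN in h1 *.
by rewrite !subr0; lra.
Qed.

Lemma exponents_determined (M : GT 1 -> R) (lam lam' : forall N, GT N) B :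
  (forall mu, citer (lam (i + 1)%N) mu @[i --> \oo] --> M mu) ->
  (forall mu, citer (lam' (i + 1)%N) mu @[i --> \oo] --> M mu) ->
  exists N0, forall N N', (N0 <= N)%N -> (N0 <= N')%N ->
    forall r, (r < N)%N -> (r < N')%N ->
    (gtL (lam N) r <= B)%N -> (gtL (lam' N') r <= B)%N ->
    gtL (lam N) r = gtL (lam' N') r.
Proof.
move=> hl hl'; have [S hS] := occurs_stable M.
have [N0 h0] := eventually_all B (hS lam hl).
have [N1 h1] := eventually_all B (hS lam' hl').
exists (maxn N0 N1) => N N'; rewrite !geq_max => /andP[NN _] /andP[_ NN'].
apply: increasing_eq_occurs; [exact: gtL_increasing|exact: gtL_increasing|].
by move=> m mB; rewrite (h0 N NN m mB) (h1 N' NN' m mB).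
Qed.

(** Otherwise [transL_escape] would make the law at level [r.+2] vanish
    identically. *)
Lemma exponents_bounded (M : forall n, GT n.+1 -> R) (lam : forall N, GT N) :
  (forall n, prob_mass (M n)) ->
  (forall n mu, citer (lam (i + n.+1)%N) mu @[i --> \oo] --> M n mu) ->
  forall r, exists B N0, forall N, (N0 <= N)%N -> (gtL (lam N) r <= B)%N.
Proof.
move=> Mp hl r; apply: contrapT => nb.
have esc X N0 : exists2 N, (N0 <= N)%N & (X <= gtL (lam N) r)%N.
  apply: contrapT => h; apply: nb; exists X, N0 => N NN.
  by rewrite leqNgt; apply/negP => /ltnW XL; apply: h; exists N.
have M0 (mu : GT r.+2) : M r.+1 mu = 0.
  have [C C0 hC] := transL_escape G q_gt0 q_lt1 mu.
  apply/eqP; rewrite -normr_le0; apply/ler_addgt0Pr => e e0; rewrite add0r.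
  have e2 : 0 < e / 2 by lra.
  have [X hX] := qexp_small q_gt0 q_lt1 C0 e2.
  have [N1 h1] := (cvg_real_eventually _ _).1 (hl r.+1 mu) _ e2.
  have [N NN XL] := esc X (N1 + r.+2)%N.
  have := h1 (N - r.+2)%N ltac:(lia); rewrite iter_trans// subnK; last by lia.
  have := hC N (gtL (lam N)) X (gtL_increasing _) ltac:(lia) XL; rewrite -transLE.
  have : C / node X <= e / 2.
    apply: le_trans (hX X (leqnn _)); apply: ler_wpM2l => //; exact: node_inv_le.
  by rewrite !ler_norml; lra.
have [_] := Mp r.+1; rewrite esum1; last by move=> mu _; rewrite M0.
by move/eqP; rewrite eqe eq_sym oner_eq0.
Qed.

(** Each exponent stays bounded, and the set of exponents below a bound is
    eventually constant; so each exponent is eventually constant. *)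
Lemma boundary_point_stabilizes (M : forall n, GT n.+1 -> R) (lam : forall N, GT N) :
  (forall n, prob_mass (M n)) ->
  (forall n mu, citer (lam (i + n.+1)%N) mu @[i --> \oo] --> M n mu) ->
  exists2 y, frakY y & stabilizes lam y.
Proof.
move=> Mp hl.
have ev r : exists l, exists N0, forall N, (N0 <= N)%N -> gtL (lam N) r = l.
  have [B [N1 h1]] := exponents_bounded Mp hl r.
  have [N0 h0] := exponents_determined B (hl 0%N) (hl 0%N).
  pose N2 := (N0 + N1 + r.+1)%N; exists (gtL (lam N2) r), N2 => N NN.
  by apply: h0; try (apply: h1); rewrite /N2 in NN *; lia.
have [l hl'] := choice ev.
have lr r : (r <= l r)%N.
  have [N0 h0] := hl' r; rewrite -(h0 (N0 + r.+1)%N); last by lia.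
  by rewrite /gtL leq_addl.
exists (fun r => l r - r)%N.
  apply/nondecreasing_seqP => r.
  have [N0 h0] := hl' r; have [N1 h1] := hl' r.+1.
  have := @gtL_increasing _ (lam (N0 + N1 + r.+2)%N) r r.+1 (leqnn _) ltac:(lia).
  rewrite h0; last by lia.
  by rewrite h1; [move=> ?; rewrite leEnat; have := lr r; lia|lia].
move=> r; apply/cvg_nat_eventually; have [N0 h0] := hl' r; exists N0 => N /h0 <-.
by rewrite /gtL addnK.
Qed.

Lemma boundary_measure_inj y y' : frakY y -> frakY y' ->
  boundary_measure q G y = boundary_measure q G y' -> y = y'.
Proof.
move=> yY yY' E; apply/funext => r.
have st := stabilizes_toGT yY; have st' := stabilizes_toGT yY'.
have h n (mu : GT n.+1) := @boundary_measure_cvg R G q q_gt0 q_lt1 y yY _ n mu st.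
have h' n (mu : GT n.+1) := @boundary_measure_cvg R G q q_gt0 q_lt1 y' yY' _ n mu st'.
rewrite -E in h'.
have [N0 h0] := @exponents_determined _ (fun N => toGT N (shifted y))
  (fun N => toGT N (shifted y')) (shifted y r + shifted y' r) (h 0%N) (h' 0%N).
have N1 : (r < N0 + r.+1)%N by lia.
have := h0 _ _ (leq_addr r.+1 N0) (leq_addr _ _) r N1 N1.
rewrite !gtL_toGT//; try exact: shifted_increasing.
by rewrite leq_addr leq_addl /shifted => /(_ isT isT) /addIn.
Qed.

End Boundary.

Theorem theorem6p5 (R : realType) (q : R) (G : bcd_type)
    (q_gt0 : 0 < q) (q_lt1 : q < 1) :
  set_bij frakY (martin_boundary q G) (boundary_measure q G).
Proof.
split=> [y yY|y y'|M [[Mp Mc] [lam hl]]].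
- split; first exact: boundary_measure_coherent.
  exists (fun N => toGT N (shifted y)) => n mu.
  exact: (@boundary_measure_cvg R G q q_gt0 q_lt1 y yY _ n mu (stabilizes_toGT yY)).
- by rewrite !inE; exact: boundary_measure_inj.
have [y yY st] := boundary_point_stabilizes q_gt0 q_lt1 Mp hl.
exists y => //; apply: functional_extensionality_dep => n; apply/funext => mu.
have h := @boundary_measure_cvg R G q q_gt0 q_lt1 y yY _ n mu st.
exact: norm_cvg_unique h (hl n mu).
Qed.
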